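(* Let $2<q<\frac{10}{3}$ and $f(t)=|t|^{q-2}t$. Then for every $a>0$ there exists a pair $(u,\lambda)\in S(a)\times\mathbb{R}$ which is a weak solution of the problem $$\Big(-u_{xx}+D_x^{-2}u_{yy}+\lambda u-f(u)\Big)_x=0 \text{ in } \mathbb{R}^2,\qquad \int_{\mathbb{R}^2}u^2\,dx\,dy=a^2,$$ with $\lambda<0$. Moreover, $u$ is a normalized ground state solution of this problem.
   Context: For $h:\mathbb{R}^2\to\mathbb{R}$ let $D_x^{-1}h(x,y)=\int_{-\infty}^x h(s,y)\,ds$. Let $Y=\{g_x: g\in C_0^\infty(\mathbb{R}^2)\}$ with inner product $\langle u,v\rangle_X=\int_{\mathbb{R}^2}(u_xv_x+D_x^{-1}u_y\,D_x^{-1}v_y+uv)\,dx\,dy$ and induced norm $\|\cdot\|$. The space $X$ consists of all $u:\mathbb{R}^2\to\mathbb{R}$ for which there is a sequence $(u_n)\subset Y$ with $u_n\to u$ a.e. in $\mathbb{R}^2$ and $\|u_j-u_k\|\to0$ as $j,k\to\infty$; it is a Hilbert space with the extended inner product. Put $\langle u,v\rangle_0=\int_{\mathbb{R}^2}(u_xv_x+D_x^{-1}u_y\,D_x^{-1}v_y)\,dx\,dy$, $\|u\|_0^2=\langle u,u\rangle_0$, and $|u|_r$ the $L^r(\mathbb{R}^2)$ norm. For $a>0$, $S(a)=\{u\in X:|u|_2^2=a^2\}$. With $F(t)=\int_0^tf(s)\,ds$, the energy is $J(u)=\frac12\|u\|_0^2-\int_{\mathbb{R}^2}F(u)\,dx\,dy$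 on $X$. A pair $(u,\lambda)\in S(a)\times\mathbb{R}$ is called a weak solution of the problem if $\langle u,\phi\rangle_0-\lambda\int_{\mathbb{R}^2}u\phi\,dx\,dy-\int_{\mathbb{R}^2}f(u)\phi\,dx\,dy=0$ for all $\phi\in X$. An element $u\in S(a)$ is a normalized ground state solution if $(J|_{S(a)})'(u)=0$ and $J(u)=\inf\{J(w): w\in S(a),\ (J|_{S(a)})'(w)=0\}$. *)

(* Defs.v *)
From HB Require Import structures.
From mathcomp Require Import all_boot all_order all_algebra.
From mathcomp Require Import all_classical all_reals all_analysis.
Set Implicit Arguments. Unset Strict Implicit. Unset Printing Implicit Defensive.
Import Order.TTheory GRing.Theory Num.Theory.
Import numFieldNormedType.Exports.
Local Open Scope classical_set_scope.
Local Open Scope ring_scope.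

Section KP.
Variable R : realType.

Definition leb2 := (@lebesgue_measure R \x @lebesgue_measure R)%E.

Definition int2 (h : R * R -> R) : R := Rintegral leb2 setT h.

Definition Dx (h : R * R -> R) : R * R -> R := fun z => 'D_((1:R), (0:R)) h z.
Definition Dy (h : R * R -> R) : R * R -> R := fun z => 'D_((0:R), (1:R)) h z.

Definition Dxinv (h : R * R -> R) : R * R -> R :=
  fun z => Rintegral (@lebesgue_measure R) `]-oo, z.1] (fun s => h (s, z.2)).

Fixpoint iterD (l : seq (R * R)) (h : R * R -> R) : R * R -> R :=
  match l with
  | [::] => h
  | v :: l' => fun z => 'D_v (iterD l' h) z
  end.

Definition smooth (h : R * R -> R) : Prop :=
  forall l : seq (R * R),
    continuous (iterD l h) /\ forall z v, derivable (iterD l h) z v.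

Definition Cc_inf (g : R * R -> R) : Prop :=
  smooth g /\ compact (closure [set z | g z != 0]).

Definition inY (u : R * R -> R) : Prop := exists g, Cc_inf g /\ u = Dx g.

Definition ipY0 (u v : R * R -> R) : R :=
  int2 (fun z => Dx u z * Dx v z + Dxinv (Dy u) z * Dxinv (Dy v) z).
Definition ipY (u v : R * R -> R) : R := ipY0 u v + int2 (fun z => u z * v z).
Definition normY (u : R * R -> R) : R := Num.sqrt (ipY u u).

Definition approx (u : R * R -> R) (s : nat -> R * R -> R) : Prop :=
  [/\ forall n, inY (s n),
      {ae leb2, forall z, (fun n => s n z) @ \oo --> u z} &
      forall e : R, 0 < e -> exists N : nat, forall j k : nat,
        (N <= j)%N -> (N <= k)%N -> normY (s j - s k) < e].

Definition inX (u : R * R -> R) : Prop := exists s, approx u s.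

(* a chosen approximating sequence (any one gives the same extended inner products) *)
Definition aseq (u : R * R -> R) : nat -> R * R -> R := xget (fun _ => 0) (approx u).

Definition ip0 (u v : R * R -> R) : R :=
  limn (fun n => ipY0 (aseq u n) (aseq v n)).

Definition S (a : R) (u : R * R -> R) : Prop :=
  inX u /\ int2 (fun z => u z ^+ 2) = a ^+ 2.

Definition fq (q : R) (t : R) : R := `|t| `^ (q - 2) * t.
Definition Fq (q : R) (t : R) : R :=
  if 0 <= t then Rintegral (@lebesgue_measure R) `[0, t] (fq q)
  else - Rintegral (@lebesgue_measure R) `[t, 0] (fq q).

Definition J (q : R) (u : R * R -> R) : R :=
  ip0 u u / 2 - int2 (fun z => Fq q (u z)).

Definition weak_solution (q a lambda : R) (u : R * R -> R) : Prop :=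
  S a u /\ forall phi, inX phi ->
    ip0 u phi - lambda * int2 (fun z => u z * phi z)
      - int2 (fun z => fq q (u z) * phi z) = 0.

(* (J|_{S(a)})'(u) = 0 : the derivative of J at u vanishes on the tangent
   space T_u S(a) = { phi in X : int u phi = 0 } *)
Definition crit_on_S (q a : R) (u : R * R -> R) : Prop :=
  S a u /\ forall phi, inX phi -> int2 (fun z => u z * phi z) = 0 ->
    derivable (fun t : R => J q (u \+ t *: phi)) 0 1 /\
    'D_1 (fun t : R => J q (u \+ t *: phi)) 0 = 0.

Definition normalized_ground_state (q a : R) (u : R * R -> R) : Prop :=
  crit_on_S q a u /\ forall w, crit_on_S q a w -> J q u <= J q w.

End KP.

(* Main.v *)
Require Import Defs.
From HB Require Import structures.
From mathcomp Require Import all_boot all_order all_algebra.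
From mathcomp Require Import all_classical all_reals all_analysis.
From mathcomp Require Import measurable_realfun ring lra.
Set Implicit Arguments. Unset Strict Implicit. Unset Printing Implicit Defensive.
Import Order.TTheory GRing.Theory Num.Theory.
Import numFieldNormedType.Exports.
Local Open Scope classical_set_scope.
Local Open Scope ring_scope.

(** Write [u = g_x] with [g] a test function.  Then [||u||_0^2 = int (g_xx^2 + g_y^2)] and
    [|u|_2^2 = int g_x^2], and the scaling [g(x, y) -> c g(t x, t^2 y)] shows that the sharp inequality
    [|u|_q^q <= K ||u||_0^(2 al) |u|_2^(2 be)] holds with a finite [K], where
    [al = 3(q-2)/4 < 1] because [q < 10/3].  So on [S(a)] the energy is at least [A/2 - (K/q) a^(2 be) A^al] with [A = ||u||_0^2], whose minimum is reached
    at a unique [A*]; any extremal of the inequality with [||u||_0^2 = A*] and [|u|_2 = a] is thus a global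
    minimiser of [J] on [S(a)].  By the weighted AM-GM inequality it also maximises
    [|u|_q^q / N(u)^(q/2)] for a suitable combination [N] of the two squared norms, and the
    vanishing of the derivative of this quotient is the weak equation, with an explicit [lambda < 0].

    An extremal is obtained without weak compactness or a general theory of [X].  A maximising
    sequence is translated so that it does not vanish, and a subsequence of it converges a.e. by
    the local equicontinuity of the primitives [g].  Convex combinations of its tails minimising
    [N] are Cauchy and have the same a.e. limit [w]; they play the part of the weak limit.  Fatou's lemma bounds
    [|w|_q^q] by [Lam m^(q/2)] and [|u_n - w|_q^q] by [Lam (1 - m)^(q/2)] in the limit, where [Lam] is the
    supremum, [N(u_n) = 1] and [m] is the limit of [N] along these combinations; the Brezis-Lieb
    lemma and strict superadditivity of [t^(q/2)] force [m = 1], hence strong convergence.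

    That [<u, v>_0] does not depend on the chosen approximating sequence is a closability
    statement: if [g_n] is Cauchy and [(g_n)_x -> 0] a.e., then [||(g_n)_x||_0 -> 0].  There the
    nonlocal term is handled by comparing [g_n] with its translates in [x]. *)

(** * Integration of continuous functions of bounded support *)

Section Integration.
Variable R : realType.
Notation mu := (@lebesgue_measure R).
Notation mu2 := ((@lebesgue_measure R \x @lebesgue_measure R)%E).

(** The obstacle is that elements of [X] are bare almost everywhere limits, perhaps not even
    measurable, and that [ip0] refers to a sequence selected by choice. Every estimate is therefore
    proved for test functions in terms of the primitive [g], and reaches [X] only at the end. One
    inequality supplies nearly all the analytic control: by [slice_bound], the integral of g_x^2
    over any horizontal line is at most the energy of [g]. It gives the L4 bound and the Hoelder
    bounds on [g], of order 1/2 in x and 1/4 in y. The L4 bound is why the estimates on powers ask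
    for [q < 4]. The admissible dilations have two parameters, so the energy and the mass of a
    maximising sequence can be prescribed exactly and separately. The compactness argument then sees
    a single quadratic form, a positive combination of the two, and both constraints return with
    strong convergence. Passing to a homogeneous inequality also removes the constraint from the
    first variation: the difference of its two sides is minimal at the extremal along every line of
    [X], and the weight of the mass term in the combination becomes the multiplier. *)

Definition Int1 (f : R -> R) : R := Rintegral mu setT f.

Definition cc1 (f : R -> R) : Prop :=
  continuous f /\ exists M : R, forall x, M < `|x| -> f x = 0.

Definition cc2 (h : R * R -> R) : Prop :=
  continuous h /\
  exists M : R, forall x y, (M < `|x|) || (M < `|y|) -> h (x, y) = 0.

Lemma measurable_rect (a b c d : R) :
  measurable ((`]a, b[ `*` `]c, d[) : set (R * R)).
Proof. by apply: measurableX; exact: measurable_itv. Qed.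

(** The measurable sets of the plane are generated by rectangles, so an open set is exhibited as a
    countable union of rectangles with rational corners. This is what makes continuous functions of
    two variables measurable. *)
Lemma open_measurable2 (O : set (R * R)) : open O -> measurable O.
Proof.
move=> oO.
pose rect (a b c d : rat) : set (R * R) := 
  `](ratr a : R), (ratr b : R)[ `*` `](ratr c : R), (ratr d : R)[.
have -> : O = \bigcup_a \bigcup_b \bigcup_c \bigcup_d
   (if pselect (rect a b c d `<=` O) then rect a b c d else set0).
  apply/seteqP; split => [[x y] Oxy|]; last first.
    by move=> z [a _ [b _ [c _ [d _]]]]; case: pselect => // h /h.
  have := oO; rewrite openE => /(_ _ Oxy) [[A B] /= [nA nB] AB].
  move: nA nB => /nbhs_ballP[e1 e10 h1] /nbhs_ballP[e2 e20 h2].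
  have /rat_in_itvoo [a] : x - e1 < x by rewrite ltrBlDr ltrDl.
  have /rat_in_itvoo [b] : x < x + e1 by rewrite ltrDl.
  have /rat_in_itvoo [c] : y - e2 < y by rewrite ltrBlDr ltrDl.
  have /rat_in_itvoo [d] : y < y + e2 by rewrite ltrDl.
  rewrite !in_itv/= => /andP[d1 d2] /andP[c1 c2] /andP[b1 b2] /andP[a1 a2].
  exists a => //; exists b => //; exists c => //; exists d => //.
  case: pselect => [h|[]].
    by split => /=; rewrite in_itv/=; apply/andP.
  move=> [s t] [/=]; rewrite !in_itv/= => /andP[s1 s2] /andP[t1 t2].
  apply: AB; split => /=.
    by apply: h1; rewrite /ball/= ltr_norml; apply/andP; split; lra.
  by apply: h2; rewrite /ball/= ltr_norml; apply/andP; split; lra.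
apply: bigcupT_measurable_rat => a; apply: bigcupT_measurable_rat => b.
apply: bigcupT_measurable_rat => c; apply: bigcupT_measurable_rat => d.
by case: (pselect _) => ? /=; [exact: measurable_rect|exact: measurable0].
Qed.

Lemma continuous_measurable2 (h : R * R -> R) :
  continuous h -> measurable_fun setT h.
Proof.
move=> /continuousP ch; apply: (measurability _ (RGenOpens.measurableE R)).
move=> _ [_ [a [b ->] <-]]; rewrite setTI; apply: open_measurable2.
exact/ch/interval_open.
Qed.

Lemma cc1_int (f : R -> R) : cc1 f -> mu.-integrable setT (EFin \o f).
Proof.
move=> [cf [M fM]].
rewrite (_ : f = f \_ `[(- `|M|), `|M| ]); last first.
  apply/funext => x; rewrite patchE; case: ifPn => // /negP xM.
  apply: fM; rewrite ltNge; apply/negP => xM'; apply: xM.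
  rewrite inE/= in_itv/= -ler_norml (le_trans xM')//; exact: ler_norm.
rewrite -restrict_EFin.
apply/integrable_restrict => //=; rewrite setTI.
apply: continuous_compact_integrable; first exact: segment_compact.
exact: continuous_subspaceT.
Qed.

Lemma cc2_int (h : R * R -> R) : cc2 h -> mu2.-integrable setT (EFin \o h).
Proof.
move=> [ch [M hM]]; pose K : set (R * R) := `[(- `|M|), `|M| ] `*` `[(- `|M|), `|M| ].
have mK : measurable K by apply: measurableX; exact: measurable_itv.
have cK : compact (K : set (R * R)).
  by apply: compact_setX; exact: segment_compact.
rewrite (_ : h = h \_ K); last first.
  apply/funext => -[x y]; rewrite patchE; case: ifPn => // /negP xM.
  apply: hM; rewrite !ltNge -negb_and; apply/negP => /andP[xM' yM']; apply: xM.
  by rewrite inE; split => /=; rewrite in_itv/= -ler_norml; 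
    [rewrite (le_trans xM') // | rewrite (le_trans yM')//]; exact: ler_norm.
rewrite -restrict_EFin.
apply/integrable_restrict => //=; rewrite setTI.
apply: measurable_bounded_integrable => //.
- pose I : set R := `[(- `|M|), `|M| ]%classic.
  have fin : (mu I * mu I < +oo)%E.
    by rewrite /I !lebesgue_measure_itv/=; case: ifP => _; rewrite -?EFinD -EFinM ltry.
  have e := product_measure1E mu mu (measurable_itv (`[(- `|M|), `|M| ]))
    (measurable_itv (`[(- `|M|), `|M| ])).
  rewrite [ltLHS]e.
  exact: fin.
- by apply: measurable_funTS; exact: continuous_measurable2.
- have := compact_bounded (continuous_compact (continuous_subspaceT ch) cK).
  move=> [r [rr hr]]; exists r; split => // x rx y Ky /=.
  by apply: hr => //; exists y.
Qed.

Lemma continuous_pair (T : topologicalType) (f g : T -> R) :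
  continuous f -> continuous g -> continuous (fun t => (f t, g t)).
Proof.
move=> cf cg t; have := cvg_pair (cf t) (cg t).
exact.
Qed.

Lemma continuous_comp2 (T : topologicalType) (f g : T -> R) (h : R * R -> R) :
  continuous f -> continuous g -> continuous h ->
  continuous (fun t => h (f t, g t)).
Proof.
move=> cf cg ch t.
apply: (@continuous_comp T (R * R)%type R (fun t => (f t, g t)) h t).
  exact: continuous_pair.
exact: ch.
Qed.

Lemma cc2_x (h : R * R -> R) y : cc2 h -> cc1 (fun x => h (x, y)).
Proof.
move=> [ch [M hM]]; split.
  by apply: continuous_comp2 => // x; [exact: cvg_id|exact: cvg_cst].
by exists M => x xM; apply: hM; rewrite xM.
Qed.

Lemma cc2_y (h : R * R -> R) x : cc2 h -> cc1 (fun y => h (x, y)).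
Proof.
move=> [ch [M hM]]; split.
  by apply: continuous_comp2 => // y; [exact: cvg_cst|exact: cvg_id].
by exists M => y xM; apply: hM; rewrite xM orbT.
Qed.

Lemma cc1D (f g : R -> R) : cc1 f -> cc1 g -> cc1 (fun x => f x + g x).
Proof.
move=> [cf [M fM]] [cg [N gN]]; split.
  by move=> x; apply: (@cvgD _ R^o); [exact: cf|exact: cg].
exists (Num.max M N) => x; rewrite gt_max => /andP[xM xN].
by rewrite fM // gN // addr0.
Qed.

Lemma cc1_comp (F f : R -> R) : continuous F -> F 0 = 0 -> cc1 f ->
  cc1 (fun x => F (f x)).
Proof.
move=> cF F0 [cf [M fM]]; split.
  by move=> x; apply: (@continuous_comp _ _ _ f F); [exact: cf|exact: cF].
by exists M => x xM; rewrite fM.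
Qed.

Lemma cc1M (f g : R -> R) : continuous f -> cc1 g -> cc1 (fun x => f x * g x).
Proof.
move=> cf [cg [N gN]]; split.
  by move=> x; apply: (@cvgM R); [exact: cf|exact: cg].
by exists N => x xN; rewrite gN // mulr0.
Qed.

Lemma cc2D (f g : R * R -> R) : cc2 f -> cc2 g -> cc2 (fun x => f x + g x).
Proof.
move=> [cf [M fM]] [cg [N gN]]; split.
  by move=> x; apply: (@cvgD _ R^o); [exact: cf|exact: cg].
exists (Num.max M N) => x y; rewrite !gt_max => xy.
have [xM xN] : (M < `|x|) || (M < `|y|) /\ (N < `|x|) || (N < `|y|).
  by move/orP: xy => [] /andP[-> ->]; rewrite ?orbT.
by rewrite fM // gN // addr0.
Qed.

Lemma cc2_comp (F : R -> R) (f : R * R -> R) : continuous F -> F 0 = 0 -> cc2 f ->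
  cc2 (fun x => F (f x)).
Proof.
move=> cF F0 [cf [M fM]]; split.
  by move=> x; apply: (@continuous_comp _ _ _ f F); [exact: cf|exact: cF].
by exists M => x y xM; rewrite fM.
Qed.

Lemma cc2M (f g : R * R -> R) : continuous f -> cc2 g -> cc2 (fun x => f x * g x).
Proof.
move=> cf [cg [N gN]]; split.
  by move=> x; apply: (@cvgM R); [exact: cf|exact: cg].
by exists N => x y xN; rewrite gN // mulr0.
Qed.

Lemma cc2Z (c : R) (f : R * R -> R) : cc2 f -> cc2 (fun x => c * f x).
Proof. by move=> cf; apply: cc2M => //; exact: cst_continuous. Qed.

Lemma cc2N (f : R * R -> R) : cc2 f -> cc2 (fun x => - f x).
Proof.
by apply: cc2_comp; rewrite ?oppr0 // => x; exact: opp_continuous.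
Qed.

Lemma cc2B (f g : R * R -> R) : cc2 f -> cc2 g -> cc2 (fun x => f x - g x).
Proof. by move=> cf cg; apply: cc2D => //; exact: cc2N. Qed.

Lemma cc1_norm (f : R -> R) : cc1 f -> cc1 (fun x => `|f x|).
Proof. by apply: cc1_comp; rewrite ?normr0 // => x; exact: norm_continuous. Qed.

Lemma Int1_ge0 (f : R -> R) : (forall x, 0 <= f x) -> 0 <= Int1 f.
Proof. by move=> f0; apply: Rintegral_ge0 => x _; exact: f0. Qed.

Lemma le_Int1 (f g : R -> R) : cc1 f -> cc1 g -> (forall x, f x <= g x) ->
  Int1 f <= Int1 g.
Proof. by move=> cf cg fg; apply: le_Rintegral => //; exact: cc1_int. Qed.

Lemma Int1_norm (f : R -> R) : cc1 f -> `|Int1 f| <= Int1 (fun x => `|f x|).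
Proof. by move=> cf; apply: le_normr_Rintegral => //; exact: cc1_int. Qed.

Lemma Int1_EFin (f : R -> R) : cc1 f -> (\int[mu]_x (f x)%:E)%E = (Int1 f)%:E.
Proof.
by move=> cf; rewrite /Int1 /Rintegral fineK //; apply: integrable_fin_num => //;
  exact: cc1_int.
Qed.

Lemma cc2_bounded (h : R * R -> R) : cc2 h -> exists2 C : R, 0 <= C & forall z, `|h z| <= C.
Proof.
move=> [ch [M hM]].
have cK : compact (`[(- `|M|), `|M| ] `*` `[(- `|M|), `|M| ] : set (R * R)).
  by apply: compact_setX; exact: segment_compact.
have := compact_bounded (continuous_compact (continuous_subspaceT ch) cK).
move=> [r [rr hr]]; exists (`|r| + 1); first by rewrite addr_ge0.
move=> [x y]; case: (ltP M `|x|) => xM.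
  by rewrite hM ?xM // normr0 addr_ge0.
case: (ltP M `|y|) => yM.
  by rewrite hM ?yM ?orbT // normr0 addr_ge0.
apply: (hr (`|r| + 1)).
  by rewrite ltr_pwDr // ler_norm.
exists (x, y) => //; split => /=; rewrite in_itv/= -ler_norml.
  by rewrite (le_trans xM) // ler_norm.
by rewrite (le_trans yM) // ler_norm.
Qed.

Lemma cc1_Int_x (h : R * R -> R) : cc2 h -> cc1 (fun y => Int1 (fun x => h (x, y))).
Proof.
move=> ch; have [C C0 hC] := cc2_bounded ch; have [cch [M hM]] := ch.
split; last first.
  exists M => y yM; rewrite /Int1 (_ : (fun x => _) = cst 0); last first.
    by apply/funext => x /=; rewrite hM ?yM ?orbT.
  by rewrite Rintegral_cst // mul0r.
move=> y; pose I : set R := `[(- `|M|), `|M| ]%classic.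
apply: (@continuity_under_integral R _ _ mu (fun y x => h (x, y)) setT
   measurableT (y - 1) (y + 1) _ _ (fun x => C * \1_I x)) => //.
- by move=> x _; apply: cc1_int; exact: cc2_x.
- by apply: aeW => x _ z _; have := (cc2_y x ch).1; exact.
- rewrite (_ : _ \o _ = (fun x => C%:E * (EFin \o \1_I) x)%E).
    by apply: integrableZl => //; exact: integrable_indic_itv.
  by apply/funext => x.
- move=> z _; apply: aeW => x _ /=; rewrite indicE.
  case: (boolP (x \in _)) => [_|/negP xM]; first by rewrite mulr1.
  rewrite mulr0 hM ?normr0//; apply/orP; left; rewrite ltNge; apply/negP => xM'.
  apply: xM; rewrite inE /I /= in_itv/= -ler_norml (le_trans xM') //; exact: ler_norm.
- by rewrite inE/= in_itv/=; apply/andP; split; lra.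
Qed.
End Integration.

(** * Iterated integrals, affine substitution, Cauchy-Schwarz and the fundamental theorem of
    calculus *)

Section Integration2.
Variable R : realType.
Notation mu := (@lebesgue_measure R).
Notation mu2 := ((@lebesgue_measure R \x @lebesgue_measure R)%E).

Lemma cc2_swap (h : R * R -> R) : cc2 h -> cc2 (fun z => h (z.2, z.1)).
Proof.
move=> [ch [M hM]]; split.
  by apply: continuous_comp2 => // z; [exact: cvg_snd|exact: cvg_fst].
by exists M => x y xy /=; apply: hM; rewrite orbC.
Qed.

Lemma cc1_Int_y (h : R * R -> R) : cc2 h -> cc1 (fun x => Int1 (fun y => h (x, y))).
Proof. by move=> /cc2_swap/cc1_Int_x. Qed.

Lemma int2_yx (h : R * R -> R) : cc2 h ->
  int2 h = Int1 (fun y => Int1 (fun x => h (x, y))).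
Proof.
move=> ch; rewrite /int2 /Rintegral -(integral21_prod_meas1 (cc2_int ch)).
by congr fine; apply: eq_integral => y _; rewrite -Int1_EFin //; exact: cc2_x.
Qed.

Lemma int2_xy (h : R * R -> R) : cc2 h ->
  int2 h = Int1 (fun x => Int1 (fun y => h (x, y))).
Proof.
move=> ch; rewrite /int2 /Rintegral -(integral12_prod_meas1 (cc2_int ch)).
by congr fine; apply: eq_integral => y _; rewrite -Int1_EFin //; exact: cc2_y.
Qed.

Lemma Int1D (f g : R -> R) : cc1 f -> cc1 g ->
  Int1 (fun x => f x + g x) = Int1 f + Int1 g.
Proof. by move=> cf cg; apply: RintegralD => //; exact: cc1_int. Qed.

Lemma Int1Z (c : R) (f : R -> R) : cc1 f -> Int1 (fun x => c * f x) = c * Int1 f.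
Proof. by move=> cf; apply: RintegralZl => //; exact: cc1_int. Qed.

Lemma cc1Z (c : R) (f : R -> R) : cc1 f -> cc1 (fun x => c * f x).
Proof. by move=> cf; apply: cc1M => //; exact: cst_continuous. Qed.

Lemma Int1B (f g : R -> R) : cc1 f -> cc1 g ->
  Int1 (fun x => f x - g x) = Int1 f - Int1 g.
Proof. by move=> cf cg; apply: RintegralB => //; exact: cc1_int. Qed.

Lemma int2D (f g : R * R -> R) : mu2.-integrable setT (EFin \o f) ->
  mu2.-integrable setT (EFin \o g) ->
  int2 (fun x => f x + g x) = int2 f + int2 g.
Proof. by move=> cf cg; apply: RintegralD. Qed.

Lemma int2Z c (f : R * R -> R) : mu2.-integrable setT (EFin \o f) ->
  int2 (fun x => c * f x) = c * int2 f.
Proof. by move=> cf; apply: RintegralZl. Qed.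

Lemma le_int2 (f g : R * R -> R) : mu2.-integrable setT (EFin \o f) ->
  mu2.-integrable setT (EFin \o g) -> (forall z, f z <= g z) -> int2 f <= int2 g.
Proof. by move=> cf cg fg; apply: le_Rintegral. Qed.

Lemma int2_ge0 (f : R * R -> R) : (forall z, 0 <= f z) -> 0 <= int2 f.
Proof. by move=> f0; apply: Rintegral_ge0 => x _; exact: f0. Qed.

Lemma Int1_affine (f : R -> R) (t s : R) : cc1 f -> 0 < t ->
  cc1 (fun x => f (t * x + s)) /\ Int1 f = t * Int1 (fun x => f (t * x + s)).
Proof.
move=> cf t0.
have dF (x : R) : is_derive x (1:R) (fun x => t * x + s) t.
  rewrite (_ : (fun x => _) = (t *: id + cst s)); last by apply/funext.
  apply: (is_derive_eq (is_deriveD (is_deriveZ t (is_derive_id x 1)) (is_derive_cst s x 1))).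
  by rewrite addr0 scaler1.
have cF : continuous (fun x => t * x + s : R).
  move=> x; apply: differentiable_continuous; apply/derivable1_diffP.
  exact: ex_derive.
have H g : cc1 g -> cc1 (fun x => g (t * x + s)).
  move=> [cg [M gM]]; split.
    by move=> x; apply: (@continuous_comp _ _ _ (fun x => t * x + s) g); [exact: cF|exact: cg].
  exists ((`|M| + `|s|) / t) => x; rewrite ltr_pdivrMr // => h; apply: gM.
  have := ler_norm M; have := ler_normD (t * x + s) (- s).
  by rewrite addrK normrN normrM (gtr0_norm t0); lra.
split; first exact: H.
have pos (g : R -> R) : cc1 g -> (forall x, 0 <= g x) ->
    Int1 g = t * Int1 (fun x => g (t * x + s)).
  move=> cg g0; rewrite -Int1Z; last exact: H.
  rewrite /Int1 /Rintegral; congr fine.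
  have F' : (fun x => t * x + s : R)^`()%classic = cst t.
    by apply/funext => x; rewrite derive1E; exact: derive_val.
  have -> := @increasing_ge0_integration_by_substitutionT R (fun x => t * x + s) g.
  - by rewrite F'; apply: eq_integral => x _ /=; rewrite mulrC.
  - by move=> x y xy /=; rewrite ltrD2r ltr_pM2l.
  - by rewrite F'; exact: cst_continuous.
  - by rewrite F'; exact: is_cvg_cst.
  - by rewrite F'; exact: is_cvg_cst.
  - by move=> x; exact: ex_derive.
  - apply/cvgrNyPle => A; near=> x; rewrite -lerBrDr mulrC -ler_pdivlMr //.
  - apply/cvgryPge => A; near=> x; rewrite -lerBlDr mulrC -ler_pdivrMr //.
  - exact: cg.1.
  - exact: g0.
(* The substitution theorem is applied to nonnegative integrands; the signed case follows from
   [f = (|f| + f) - |f|]. *)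
have cn := cc1_norm cf.
rewrite (_ : Int1 f = Int1 (fun x => `|f x| + f x) - Int1 (fun x => `|f x|)); last first.
  by rewrite Int1D //; lra.
rewrite (pos (fun x => `|f x| + f x)); [|exact: cc1D|]; last first.
  by move=> x; have := ler_norm (- f x); rewrite normrN; lra.
rewrite (pos (fun x => `|f x|)) //.
have e := Int1D (H _ cn) (H _ cf); rewrite /= in e.
by rewrite e; lra.
Unshelve. all: by end_near. Qed.
(** Discriminant criterion, with [a = 0] allowed. Cauchy-Schwarz, both for integrals and for
    abstract forms, is obtained from it. *)
Lemma quad_disc (a b c : R) : (forall t, 0 <= a * t ^+ 2 + 2 * b * t + c) ->
  b ^+ 2 <= a * c.
Proof.
move=> h; have := @deg_le2_poly_ge0 R (Poly [:: c; 2 * b; a]).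
rewrite !coef_Poly /= => H.
suff : (2 * b) ^+ 2 - 4 * a * c <= 0 by rewrite exprMn; lra.
apply: H => [|t]; first exact: (size_Poly [:: c; 2 * b; a]).
by rewrite !horner_cons hornerC; have := h t; lra.
Qed.

Lemma CS_Rintegral d (T : measurableType d) (m : {measure set T -> \bar R})
    (D : set T) (f g : T -> R) : measurable D ->
  m.-integrable D (EFin \o (fun x => f x ^+ 2)) ->
  m.-integrable D (EFin \o (fun x => g x ^+ 2)) ->
  m.-integrable D (EFin \o (fun x => f x * g x)) ->
  (Rintegral m D (fun x => f x * g x)) ^+ 2 <=
  Rintegral m D (fun x => f x ^+ 2) * Rintegral m D (fun x => g x ^+ 2).
Proof.
move=> mD if2 ig2 ifg; apply: quad_disc => t.
have iZ k (h : T -> R) : m.-integrable D (EFin \o h) ->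
    m.-integrable D (EFin \o (fun x => k * h x)).
  by move=> ih; apply: (integrableZl mD k ih).
have i1 := iZ (t ^+ 2) _ if2; have i2 := iZ (2 * t) _ ifg.
have -> : Rintegral m D (fun x => f x ^+ 2) * t ^+ 2 +
    2 * Rintegral m D (fun x => f x * g x) * t +
    Rintegral m D (fun x => g x ^+ 2) = Rintegral m D (fun x => (t * f x + g x) ^+ 2).
  have -> : (fun x => (t * f x + g x) ^+ 2) =
      (fun x => (t ^+ 2 * f x ^+ 2 + (2 * t) * (f x * g x)) + g x ^+ 2).
    by apply/funext => x; ring.
  rewrite RintegralD //; last exact: (integrableD mD i1 i2).
  rewrite RintegralD // !RintegralZl //.
  by ring.
by apply: Rintegral_ge0 => x _; exact: sqr_ge0.
Qed.

Lemma itv_int (f : R -> R) (a b : R) : continuous f ->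
  mu.-integrable `[a, b] (EFin \o f).
Proof.
move=> cf; apply: continuous_compact_integrable; first exact: segment_compact.
exact: continuous_subspaceT.
Qed.

Lemma ftc_itv (F f : R -> R) (a b : R) : a <= b ->
  (forall x, is_derive x (1:R) F (f x)) -> continuous f ->
  Rintegral mu `[a, b] f = F b - F a.
Proof.
move=> ab dF cf; move: ab; rewrite le_eqVlt => /predU1P[->|ab].
  by rewrite set_itv1 Rintegral_set1 subrr.
have cF : continuous F.
  move=> x; apply: differentiable_continuous; apply/derivable1_diffP.
  exact: (@ex_derive _ _ _ _ _ _ _ (dF x)).
rewrite /Rintegral (@continuous_FTC2 _ f F) //.
- exact: continuous_subspaceT.
- split.
  + by move=> x _; exact: (@ex_derive _ _ _ _ _ _ _ (dF x)).
  + by apply: cvg_at_right_filter; exact: cF.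
  + by apply: cvg_at_left_filter; exact: cF.
- by move=> x _; rewrite derive1E; exact: (@derive_val _ _ _ _ _ _ _ (dF x)).
Qed.

Lemma itv_int_le_Int1 (f : R -> R) (a b : R) : cc1 f -> (forall x, 0 <= f x) ->
  Rintegral mu `[a, b] f <= Int1 f.
Proof.
move=> cf f0; rewrite /Int1 /Rintegral fine_le //.
- apply: integrable_fin_num => //; exact: itv_int cf.1.
- apply: integrable_fin_num => //; exact: cc1_int.
- apply: ge0_subset_integral => //.
    by apply/measurable_EFinP; exact: continuous_measurable_fun cf.1.
  by move=> x _; rewrite lee_fin.
Qed.

(** Cauchy-Schwarz of [f] against the constant 1 on the interval. *)
Lemma ftc_sqr (F f : R -> R) (a b : R) : a <= b ->
  (forall x, is_derive x (1:R) F (f x)) -> continuous f ->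
  (F b - F a) ^+ 2 <= (b - a) * Rintegral mu `[a, b] (fun x => f x ^+ 2).
Proof.
move=> ab dF cf; rewrite -(ftc_itv ab dF cf).
have cf2 : continuous (fun x => f x ^+ 2).
  by move=> x; apply: (@cvgM R); exact: cf.
have := @CS_Rintegral _ _ mu `[a, b] (cst 1) f (measurable_itv _) .
rewrite /= (_ : (fun x => cst 1 x * f x) = f); last first.
  by apply/funext => x; rewrite mul1r.
rewrite (_ : (fun x => cst 1 x ^+ 2) = cst (1:R)); last first.
  by apply/funext => x; rewrite /= expr1n.
rewrite Rintegral_cst //; have -> : fine (mu `[a, b]%classic) = b - a.
  rewrite lebesgue_measure_itv /= lte_fin; case: ifP => //= /negbT.
  by rewrite -leNgt => ba; lra.
rewrite mul1r; apply.
- by apply: itv_int; exact: cst_continuous.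
- exact: itv_int.
- exact: itv_int.
Qed.

Lemma ftc_norm (F f : R -> R) (x : R) : cc1 F -> cc1 f ->
  (forall x, is_derive x (1:R) F (f x)) -> `|F x| <= Int1 (fun x => `|f x|).
Proof.
move=> [cF [M FM]] cf dF.
have [a ax Fa] : exists2 a, a <= x & F a = 0.
  exists (- (`|M| + `|x| + 1)); first by have := lerNnormlW (lexx `|x|); have := normr_ge0 M; lra.
  apply: FM; rewrite normrN ger0_norm; last by rewrite !addr_ge0.
  by have := ler_norm M; have := normr_ge0 x; lra.
rewrite -[F x]subr0 -Fa -(ftc_itv ax dF cf.1).
apply: (@le_trans _ _ (Rintegral mu `[a, x] (fun x => `|f x|))).
  by apply: le_normr_Rintegral => //; exact: itv_int cf.1.
by apply: itv_int_le_Int1; [exact: cc1_norm|].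
Qed.

Lemma Int1_deriv0 (F f : R -> R) : cc1 F -> cc1 f ->
  (forall x, is_derive x (1:R) F (f x)) -> Int1 f = 0.
Proof.
move=> [cF [M FM]] [cf [N fN]] dF.
pose A := `|M| + `|N| + 1.
have AM : M < A by rewrite /A; have := ler_norm M; have := normr_ge0 N; lra.
have AN : N < A by rewrite /A; have := ler_norm N; have := normr_ge0 M; lra.
have A0 : 0 <= A by rewrite /A !addr_ge0.
rewrite (_ : Int1 f = Rintegral mu `[- A, A] f).
  by rewrite (ftc_itv _ dF) ?FM ?subrr ?normrN ?ger0_norm //; lra.
rewrite [RHS]Rintegral_mkcond; congr Rintegral; apply/funext => x.
rewrite patchE; case: ifPn => // /negP xA; apply: fN.
rewrite ltNge; apply/negP => xN; apply: xA.
by rewrite inE/= in_itv/= -ler_norml; lra.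
Qed.

(** Tonelli on the strip [0 <= y - x <= s]: integrating [k y] over it first in [y] gives the moving
    windows that dominate [D], first in [x] gives [s * k y], since each section in [x] has length
    [s]. *)
Lemma smear (k D : R -> R) (s : R) : cc1 k -> (forall x, 0 <= k x) -> cc1 D ->
  0 <= s -> (forall x, 0 <= D x) ->
  (forall x, D x <= Rintegral mu `[x, x + s] k) -> Int1 D <= s * Int1 k.
Proof.
move=> ck k0 cD s0 D0 Dk.
pose A : set (R * R) := [set z | 0 <= z.2 - z.1 <= s].
have mA : measurable A.
  have cf : continuous (fun z : R * R => z.2 - z.1).
    by move=> z; apply: (@cvgB _ R^o); [exact: cvg_snd|exact: cvg_fst].
  have AE : A = [set: R * R] `&` (fun z : R * R => z.2 - z.1) @^-1` `[0, s]%classic.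
    by rewrite setTI; apply/seteqP; split => z /=; rewrite in_itv.
  by rewrite AE; apply: (continuous_measurable2 cf measurableT (measurable_itv `[0, s])).
pose H (z : R * R) : \bar R := (k z.2 * \1_A z)%:E.
have mH : measurable_fun setT H.
  apply/measurable_EFinP; apply: measurable_funM; last exact: measurable_indic.
  apply: continuous_measurable2 => z.
  by apply: (@continuous_comp _ _ _ snd k); [exact: cvg_snd|exact: ck.1].
have H0 z : (0 <= H z)%E by rewrite lee_fin mulr_ge0 // indicE; case: (_ \in _).
have E := @fubini_tonelli _ _ _ _ R mu mu H mH H0.
have DE := Int1_EFin cD; have kE := Int1_EFin ck.
have mk : measurable_fun setT (EFin \o k).
  by apply/measurable_EFinP; exact: continuous_measurable_fun ck.1.
have mD : measurable_fun setT (EFin \o D).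
  by apply/measurable_EFinP; exact: continuous_measurable_fun cD.1.
have DH : ((Int1 D)%:E <= \int[mu]_x \int[mu]_y H (x, y))%E.
  rewrite -DE; apply: ge0_le_integral; [exact: measurableT| | exact: mD| | ].
  - by move=> x _; rewrite lee_fin.
  - exact: (@measurable_fun_fubini_tonelli_F _ _ _ _ R mu H mH H0).
  - move=> x _; apply: (@le_trans _ _ (Rintegral mu `[x, x + s] k)%:E).
      by rewrite lee_fin.
    rewrite /Rintegral fineK; last first.
      apply: integrable_fin_num; first exact: measurable_itv.
      exact: (@itv_int k x (x + s) ck.1).
    rewrite integral_mkcond le_eqVlt; apply/orP; left; apply/eqP; congr integral; apply/funext => y.
    rewrite /H /= restrict_EFin /= patchE indicE.
    suff -> : (y \in `[x, (x + s)%R]%classic) = ((x, y) \in A).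
      by case: ifP; rewrite ?mulr1 ?mulr0.
    apply/idP/idP; rewrite !inE /A /= in_itv /= => /andP[? ?]; apply/andP; split; lra.
rewrite -lee_fin; apply: (le_trans DH).
rewrite E EFinM -kE -ge0_integralZl_EFin; [|exact: measurableT|by move=> x _; rewrite lee_fin|exact: mk|exact: s0].
apply: ge0_le_integral; [exact: measurableT| | exact: (@measurable_fun_fubini_tonelli_G _ _ _ _ R mu H mH H0)| | ].
- by move=> y _; apply: integral_ge0 => x _; exact: H0.
- by apply: measurable_funeM; exact: mk.
move=> y _; rewrite /H /=.
under eq_integral do rewrite EFinM.
have e1 : (fun x => \1_A (x, y)) = \1_(`[y - s, y]%classic) :> (R -> R).
  apply/funext => x; rewrite !indicE; congr (_%:R); congr nat_of_bool.
  by apply/idP/idP; rewrite !inE /A /= in_itv /= => /andP[? ?]; apply/andP; split; lra.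
have e3 : mu `[y - s, y]%classic = s%:E.
  rewrite lebesgue_measure_itv /= lte_fin; case: ifP => [_|/negbT].
    by rewrite -EFinD; congr EFin; ring.
  by rewrite -leNgt => ?; congr EFin; lra.
have e2 : (\int[mu]_x (\1_A (x, y))%:E = s%:E)%E.
  rewrite (_ : (fun x => _) = EFin \o \1_(`[y - s, y]%classic)); last by rewrite -e1.
  rewrite (integral_indic mu measurableT (measurable_itv _)) setIT; exact: e3.
rewrite ge0_integralZl_EFin; [|exact: measurableT| | |exact: k0].
- by rewrite e2 muleC.
- by move=> x _; rewrite lee_fin indicE; case: (_ \in _).
- apply/measurable_EFinP; rewrite e1; exact: measurable_indic.
Qed.
Lemma int2E (h : R * R -> R) : int2 h = \int[mu2]_z h z.
Proof. by []. Qed.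

Lemma int2_EFin (h : R * R -> R) : mu2.-integrable setT (EFin \o h) ->
  (\int[mu2]_z (h z)%:E)%E = (int2 h)%:E.
Proof.
by move=> ih; rewrite int2E /Rintegral fineK //; exact: (integrable_fin_num measurableT ih).
Qed.

Lemma int2_fine (h : R * R -> R) : int2 h = fine (\int[mu2]_z (h z)%:E)%E.
Proof. by []. Qed.

End Integration2.

(** * Test functions *)

Section TestFunctions.
Variable R : realType.
Implicit Types g h : R * R -> R.

(** The support is confined by a bound on the coordinates instead of by compactness of its closure;
    [testP] shows that the two agree. Sums, derivatives and affine changes of variables then only
    require a new bound. *)
Definition test g : Prop :=
  smooth g /\
  exists M : R, forall x y, (M < `|x|) || (M < `|y|) -> g (x, y) = 0.

Lemma smooth_derivable g : smooth g -> forall z v, derivable g z v.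
Proof. by move=> /(_ [::])[]. Qed.

Lemma smooth_continuous g : smooth g -> continuous g.
Proof. by move=> /(_ [::])[]. Qed.

Lemma test_cc g : test g -> cc2 g.
Proof. by move=> [/smooth_continuous cg gM]; split. Qed.

Lemma iterD_rcons l v g :
  Defs.iterD (rcons l v) g = Defs.iterD l (fun z => 'D_v g z).
Proof. by elim: l => //= w l ->. Qed.

Lemma smooth_derive g v : smooth g -> smooth (fun z => 'D_v g z).
Proof. by move=> sg l; rewrite -iterD_rcons; exact: sg. Qed.

Lemma open_outside (M : R) :
  open [set z : R * R | (M < `|z.1|) || (M < `|z.2|)].
Proof.
rewrite (_ : [set _ | _] =
    (fun z : R * R => `|z.1|) @^-1` [set x | M < x] `|`
    (fun z : R * R => `|z.2|) @^-1` [set x | M < x]); last first.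
  by apply/seteqP; split => z /=; [move/orP|move=> H; apply/orP].
apply: openU; apply: open_comp; try exact: open_gt.
- move=> z _; apply: (@continuous_comp _ _ _ fst (fun x : R => `|x|)); first exact: cvg_fst.
  exact: norm_continuous.
- move=> z _; apply: (@continuous_comp _ _ _ snd (fun x : R => `|x|)); first exact: cvg_snd.
  exact: norm_continuous.
Qed.

Lemma near_line (z v : R * R) (A : set (R * R)) : nbhs z A ->
  \forall h \near (0:R), A (h *: v + z).
Proof.
move=> zA.
have H : (fun h : R => h *: v + z) h @[h --> (0:R)] --> (0:R) *: v + z.
  apply: (@cvgD _ (R * R)%type); last exact: cvg_cst.
  by apply: (@cvgZ _ (R * R)%type); [exact: cvg_id|exact: cvg_cst].
rewrite scale0r add0r in H.
exact: H.
Qed.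

Lemma test_derive g v : test g -> test (fun z => 'D_v g z).
Proof.
move=> [sg [M gM]]; split; first exact: smooth_derive.
exists M => x y xy; rewrite /derive; apply: lim_near_cst => //.
(* The outside of the box is open, so at such a point the difference quotient vanishes for all small
   increments. *)
have nb : nbhs ((x, y) : R * R) [set z : R * R | (M < `|z.1|) || (M < `|z.2|)].
  by apply: open_nbhs_nbhs; split; [exact: open_outside|exact: xy].
have H := near_line v nb.
have H' : \forall k \near (0:R)^', (M < `|(k *: v + (x, y)).1|) || (M < `|(k *: v + (x, y)).2|).
  exact: nbhs_dnbhs.
apply: filterS H' => k kM; rewrite /= [g (x, y)]gM // subr0.
rewrite (_ : g _ = 0) ?scaler0 //.
have key (p : R * R) : (M < `|p.1|) || (M < `|p.2|) -> g p = 0 by case: p => a b /gM.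
exact: key kM.
Qed.

Lemma test_Dx g : test g -> test (Dx g).
Proof. exact: test_derive. Qed.

Lemma test_Dy g : test g -> test (Dy g).
Proof. exact: test_derive. Qed.

Lemma testP g : Cc_inf g <-> test g.
Proof.
split=> [[sg cg]|[sg [M gM]]]; split => //.
  have [r [rr hr]] := compact_bounded cg.
  exists (`|r| + 1) => x y xy; apply/eqP; apply/negP => /negP g0.
  have : `|(x, y) : R * R| <= `|r| + 1.
    apply: hr; last exact: subset_closure.
    by rewrite ltr_pwDr // ler_norm.
  rewrite prod_normE ge_max /= => /andP[? ?].
  by move: xy; rewrite !ltNge -negb_and => /negP; apply; apply/andP.
pose K : set (R * R) := `[- `|M|, `|M| ] `*` `[- `|M|, `|M| ].
have cK : compact K by apply: compact_setX; exact: segment_compact.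
have KE : K = closure K.
  apply/closure_id; apply: compact_closed cK.
  exact: (@norm_hausdorff R (R * R)%type).
have sub : closure [set z | g z != 0] `<=` K.
  rewrite KE; apply: closureS => -[x y] /= g0.
  split => /=; rewrite in_itv /= -ler_norml leNgt; apply/negP => h.
    by move/eqP: g0; apply; apply: gM; rewrite (le_lt_trans _ h) ?ler_norm.
  by move/eqP: g0; apply; apply: gM; rewrite orbC (le_lt_trans _ h) ?ler_norm.
exact: subclosed_compact (@closed_closure _ _) cK sub.
Qed.

Lemma is_derive_x g x y : smooth g ->
  is_derive x (1:R) (fun x => g (x, y)) (Dx g (x, y)).
Proof.
move=> sg; have := @smooth_derivable g sg (x, y) (1, 0).
have E : (fun h : R => h^-1 *: ((g \o shift (x, y)) (h *: (1, 0)) - g (x, y))) =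
   (fun h : R => h^-1 *: (((fun x => g (x, y)) \o shift x) (h *: 1) - g (x, y))).
  apply/funext => h /=; congr (_ *: (g _ - _)).
  by rewrite /shift /= ; congr (_, _) => /=; rewrite scaler0 add0r.
rewrite /derivable E => H; apply: DeriveDef; first exact: H.
by rewrite /Dx /derive E.
Qed.

Lemma is_derive_y g x y : smooth g ->
  is_derive y (1:R) (fun y => g (x, y)) (Dy g (x, y)).
Proof.
move=> sg; have := @smooth_derivable g sg (x, y) (0, 1).
have E : (fun h : R => h^-1 *: ((g \o shift (x, y)) (h *: (0, 1)) - g (x, y))) =
   (fun h : R => h^-1 *: (((fun y => g (x, y)) \o shift y) (h *: 1) - g (x, y))).
  apply/funext => h /=; congr (_ *: (g _ - _)).
  by rewrite /shift /= ; congr (_, _) => /=; rewrite scaler0 add0r.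
rewrite /derivable E => H; apply: DeriveDef; first exact: H.
by rewrite /Dy /derive E.
Qed.

Definition aff (t1 s1 t2 s2 : R) (z : R * R) : R * R :=
  (t1 * z.1 + s1, t2 * z.2 + s2).

(** The increment [h v] is mapped to [h (t1 v.1, t2 v.2)], so the difference quotients are equal as
    functions of [h]. Derivability and derivatives in every direction transfer without a chain rule
    in two variables. *)
Lemma aff_diffq t1 s1 t2 s2 g (z v : R * R) :
  (fun h : R => h^-1 *: (((g \o aff t1 s1 t2 s2) \o shift z) (h *: v) - (g \o aff t1 s1 t2 s2) z)) =
  (fun h : R => h^-1 *: ((g \o shift (aff t1 s1 t2 s2 z)) (h *: (t1 * v.1, t2 * v.2)) - g (aff t1 s1 t2 s2 z))).
Proof.
apply/funext => h /=; congr (_ *: (g _ - _)).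
rewrite /aff /shift /=; congr (_, _) => /=; rewrite /GRing.scale /=; ring.
Qed.

Lemma derive_aff t1 s1 t2 s2 g (z v : R * R) :
  'D_v (g \o aff t1 s1 t2 s2) z = 'D_(t1 * v.1, t2 * v.2) g (aff t1 s1 t2 s2 z).
Proof. by rewrite /derive aff_diffq. Qed.

Lemma derivable_aff t1 s1 t2 s2 g (z v : R * R) :
  derivable g (aff t1 s1 t2 s2 z) (t1 * v.1, t2 * v.2) ->
  derivable (g \o aff t1 s1 t2 s2) z v.
Proof. by rewrite /derivable aff_diffq. Qed.

Lemma aff_continuous t1 s1 t2 s2 : continuous (aff t1 s1 t2 s2).
Proof.
have H (t s : R) : continuous (fun x : R => t * x + s).
  move=> x; apply: (@cvgD _ R^o); last exact: cvg_cst.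
  by apply: (@cvgM R); [exact: cvg_cst|exact: cvg_id].
by move=> z; apply: (@continuous_pair R _ (fun z : R * R => t1 * z.1 + s1) (fun z : R * R => t2 * z.2 + s2)) => {}z;
 [apply: (@continuous_comp _ _ _ fst (fun x : R => t1 * x + s1)); [exact: cvg_fst|exact: H]
 |apply: (@continuous_comp _ _ _ snd (fun x : R => t2 * x + s2)); [exact: cvg_snd|exact: H]].
Qed.

Lemma smooth_aff t1 s1 t2 s2 g : smooth g -> smooth (g \o aff t1 s1 t2 s2).
Proof.
move=> sg l.
have -> : Defs.iterD l (g \o aff t1 s1 t2 s2) =
   Defs.iterD [seq (t1 * v.1, t2 * v.2) | v <- l] g \o aff t1 s1 t2 s2.
  elim: l => //= v l ->; apply/funext => z; exact: derive_aff.
have [c d] := sg [seq (t1 * v.1, t2 * v.2) | v <- l]; split.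
  by move=> z; apply: continuous_comp; [exact: aff_continuous|exact: c].
by move=> z v; apply: derivable_aff; exact: d.
Qed.

Lemma test_aff t1 s1 t2 s2 g : 0 < t1 -> 0 < t2 -> test g ->
  test (g \o aff t1 s1 t2 s2).
Proof.
move=> t10 t20 [sg [M gM]]; split; first exact: smooth_aff.
pose B (t s : R) : R := (`|M| + `|s|) / t.
have H (t s x : R) : 0 < t -> (`|M| + `|s|) / t < `|x| -> M < `|t * x + s|.
  move=> t0; rewrite ltr_pdivrMr // => h.
  have := ler_norm M; have := ler_normD (t * x + s) (- s).
  by rewrite addrK normrN normrM (gtr0_norm t0); lra.
exists (Num.max (B t1 s1) (B t2 s2)) => x y; rewrite !gt_max => xy.
apply: gM => /=; move/orP: xy => [/andP[/H h _]|/andP[_ /H h]].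
  by rewrite h.
by rewrite h // orbT.
Qed.

Lemma iterD_lin (c : R) g h l : smooth g -> smooth h ->
  Defs.iterD l (fun z => c * g z + h z) = (fun z => c * Defs.iterD l g z + Defs.iterD l h z).
Proof.
move=> sg sh; elim: l => //= v l IH; rewrite IH; apply/funext => z.
have dg := (sg l).2 z v; have dh := (sh l).2 z v.
rewrite (_ : (fun z => _) = c *: Defs.iterD l g + Defs.iterD l h) //.
by rewrite deriveD ?deriveZ //; exact: derivableZ.
Qed.

Lemma smooth_lin (c : R) g h : smooth g -> smooth h ->
  smooth (fun z => c * g z + h z).
Proof.
move=> sg sh l; rewrite iterD_lin //.
have [cg dg] := sg l; have [ch dh] := sh l; split.
  move=> z; apply: (@cvgD _ R^o); last exact: ch.
  by apply: (@cvgM R); [exact: cvg_cst|exact: cg].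
move=> z v; rewrite (_ : (fun z => _) = c *: Defs.iterD l g + Defs.iterD l h) //.
by apply: derivableD; [apply: derivableZ; exact: dg|exact: dh].
Qed.

Lemma test_lin (c : R) g h : test g -> test h -> test (fun z => c * g z + h z).
Proof.
move=> [sg [M gM]] [sh [N hN]]; split; first exact: smooth_lin.
exists (Num.max M N) => x y; rewrite !gt_max => xy.
have [xM xN] : (M < `|x|) || (M < `|y|) /\ (N < `|x|) || (N < `|y|).
  by move/orP: xy => [] /andP[-> ->]; rewrite ?orbT.
by rewrite gM // hN // mulr0 addr0.
Qed.

Lemma Dx_lin (c : R) g h : smooth g -> smooth h ->
  Dx (fun z => c * g z + h z) = (fun z => c * Dx g z + Dx h z).
Proof. by move=> sg sh; have := iterD_lin c [:: (1, 0)] sg sh. Qed.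

Lemma Dy_lin (c : R) g h : smooth g -> smooth h ->
  Dy (fun z => c * g z + h z) = (fun z => c * Dy g z + Dy h z).
Proof. by move=> sg sh; have := iterD_lin c [:: (0, 1)] sg sh. Qed.

End TestFunctions.

Opaque Dx Dy int2.

(** * Mixed derivatives, primitives of test functions and the slice bound *)

Section Calculus.
Variable R : realType.
Implicit Types g h : R * R -> R.
Notation mu := (@lebesgue_measure R).
Notation mu2 := ((@lebesgue_measure R \x @lebesgue_measure R)%E).

Lemma mvt1 (F f : R -> R) (a b : R) : a < b ->
  (forall x, is_derive x (1:R) F (f x)) ->
  exists2 c, a < c < b & F b - F a = f c * (b - a).
Proof.
move=> ab dF; have [|c + E] := @MVT R F f a b ab (fun x _ => dF x).
  apply: continuous_subspaceT => x.
  apply: differentiable_continuous; apply/derivable1_diffP.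
  exact: (@ex_derive _ _ _ _ _ _ _ (dF x)).
by rewrite in_itv /= => cab; exists c.
Qed.

Lemma is_derive_mul (F G : R -> R) (x f g : R) :
  is_derive x (1:R) F f -> is_derive x (1:R) G g ->
  is_derive x (1:R) (fun x => F x * G x) (f * G x + F x * g).
Proof.
move=> dF dG; have := is_deriveM dF dG.
rewrite (_ : F * G = (fun x => F x * G x)) //.
by move=> H; apply: (is_derive_eq H); rewrite /GRing.scale /=; ring.
Qed.

Lemma near_box (P : R * R -> Prop) (z : R * R) : (\forall w \near z, P w) ->
  exists2 e : R, 0 < e & forall s t, `|s - z.1| < e -> `|t - z.2| < e -> P (s, t).
Proof.
move=> [[A B] /= [/nbhs_ballP[e1 e10 h1] /nbhs_ballP[e2 e20 h2]] AB].
exists (Num.min e1 e2); first by rewrite lt_min; apply/andP.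
move=> s t; rewrite !lt_min => /andP[s1 _] /andP[_ t2]; apply: AB; split => /=.
  by apply: h1; rewrite /ball /= distrC.
by apply: h2; rewrite /ball /= distrC.
Qed.

Lemma continuous_box (F : R * R -> R) (x y e : R) : continuous F -> 0 < e ->
  exists2 d : R, 0 < d & forall s t, x - d < s < x + d -> y - d < t < y + d ->
    F (x, y) - e < F (s, t) < F (x, y) + e.
Proof.
move=> cF e0; have H : \forall w \near (x, y), `|F (x, y) - F w| < e.
  by move/cvgrPdist_lt : (cF (x, y)) => /(_ e e0).
have [d d0 h] := near_box H; exists d => // s t sx ty.
have : `|F (x, y) - F (s, t)| < e.
  by apply: h => /=; rewrite ltr_distl.
by rewrite ltr_distlC.
Qed.

(* Both mixed derivatives are approximated by the same second difference of g. *)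
Lemma second_difference g (x y k : R) (P : smooth g) : 0 < k ->
  exists s t, [/\ x < s < x + k, y < t < y + k &
    (g (x + k, y + k) - g (x + k, y)) - (g (x, y + k) - g (x, y)) =
    Dy (Dx g) (s, t) * (k * k)].
Proof.
move=> k0; have sx : smooth (Dx g) by exact: smooth_derive.
have xk : x < x + k by lra.
have yk : y < y + k by lra.
have [c cx E1] := @mvt1 (fun s => g (s, y + k) - g (s, y)) (fun s => Dx g (s, y + k) - Dx g (s, y)) _ _ xk
    (fun s => is_deriveB (is_derive_x s (y + k) P) (is_derive_x s y P)).
have [d dy E2] := mvt1 yk (fun t => is_derive_y c t sx).
exists c, d; split => //; rewrite E1 E2.
by move: (Dy _ _) => D; ring.
Qed.

Lemma second_difference' g (x y k : R) (P : smooth g) : 0 < k ->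
  exists s t, [/\ x < s < x + k, y < t < y + k &
    (g (x + k, y + k) - g (x + k, y)) - (g (x, y + k) - g (x, y)) =
    Dx (Dy g) (s, t) * (k * k)].
Proof.
move=> k0; have sy : smooth (Dy g) by exact: smooth_derive.
have xk : x < x + k by lra.
have yk : y < y + k by lra.
have [c cy E1] := @mvt1 (fun s => g (x + k, s) - g (x, s)) (fun s => Dy g (x + k, s) - Dy g (x, s)) _ _ yk
    (fun s => is_deriveB (is_derive_y (x + k) s P) (is_derive_y x s P)).
have [d dx E2] := mvt1 xk (fun s => is_derive_x s c sy).
exists d, c; split => //; rewrite E2 in E1.
move: (Dx _ _) E1 => D.
move: (g (x + k, y + k)) (g (x + k, y)) (g (x, y + k)) (g (x, y)) => a1 a2 a3 a4 E1.
by transitivity (a1 - a3 - (a2 - a4)); [ring|rewrite E1; ring].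
Qed.

Lemma schwarz g : smooth g -> Dy (Dx g) = Dx (Dy g).
Proof.
move=> sg; apply/funext => -[x y].
have : continuous (Dy (Dx g)) by apply: smooth_continuous; do 2 apply: smooth_derive.
have : continuous (Dx (Dy g)) by apply: smooth_continuous; do 2 apply: smooth_derive.
have D1 := @second_difference g x y ^~ sg; have D2 := @second_difference' g x y ^~ sg.
move: (Dy (Dx g)) (Dx (Dy g)) D1 D2 => F1 F2 D1 D2 c2 c1.
apply/eqP/negPn/negP => ne.
(* The two values differ by [2 e], while on a small square each function stays strictly within [e]
   of its own value; yet there they take a common value. *)
pose e := `|F1 (x, y) - F2 (x, y)| / 2.
have e0 : 0 < e by rewrite divr_gt0 // normr_gt0 subr_eq0.
have [d1 d10 h1] := continuous_box x y c1 e0.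
have [d2 d20 h2] := continuous_box x y c2 e0.
have [k k0 [kd1 kd2]] : exists2 k, 0 < k & k < d1 /\ k < d2.
  exists (Num.min d1 d2 / 2); first by rewrite divr_gt0 // lt_min d10 d20.
  have [] : Num.min d1 d2 <= d1 /\ Num.min d1 d2 <= d2 by rewrite !ge_min !lexx orbT.
  have : 0 < Num.min d1 d2 by rewrite lt_min d10 d20.
  move: (Num.min _ _) => m; lra.
have [c [d [/andP[? ?] /andP[? ?] E1]]] := D1 k k0.
have [c' [d' [/andP[? ?] /andP[? ?] E2]]] := D2 k k0.
have E : F1 (c, d) = F2 (c', d').
  by apply: (mulIf (_ : k * k != 0)); [rewrite mulf_neq0 // gt_eqF|rewrite -E1 -E2].
have := h1 c d; have := h2 c' d'; rewrite E.
have -> : x - d1 < c < x + d1 by apply/andP; split; lra.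
have -> : y - d1 < d < y + d1 by apply/andP; split; lra.
have -> : x - d2 < c' < x + d2 by apply/andP; split; lra.
have -> : y - d2 < d' < y + d2 by apply/andP; split; lra.
move=> /(_ isT isT) /andP[? ?] /(_ isT isT) /andP[? ?].
have : `|F1 (x, y) - F2 (x, y)| < 2 * e.
  by rewrite ltr_norml; apply/andP; split; lra.
by rewrite /e mulrC divfK ?ltxx // pnatr_eq0.
Qed.

Lemma Rint_ray (F f : R -> R) (x : R) : cc1 F -> cc1 f ->
  (forall x, is_derive x (1:R) F (f x)) -> Rintegral mu `]-oo, x] f = F x.
Proof.
move=> [cF [M FM]] [cf [N fN]] dF.
pose A := `|M| + `|N| + `|x| + 1.
have AM : M < A by rewrite /A; have := ler_norm M; have := normr_ge0 N; have := normr_ge0 x; lra.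
have AN : N < A by rewrite /A; have := ler_norm N; have := normr_ge0 M; have := normr_ge0 x; lra.
have A0 : 0 <= A by rewrite /A !addr_ge0.
have Ax : - A <= x by have := lerNnormlW (lexx `|x|); have := normr_ge0 M; have := normr_ge0 N; rewrite /A; lra.
have := ftc_itv Ax dF cf; rewrite (FM (- A)) ?normrN ?ger0_norm // subr0 => <-.
rewrite Rintegral_mkcond [RHS]Rintegral_mkcond; congr Rintegral; apply/funext => s.
rewrite !patchE; case: ifPn; case: ifPn => //; rewrite !inE /= !in_itv /= ?notin_setE /= ?in_itv /= => h1 h2.
- rewrite fN //; have sA : s < - A by apply/negPn/negP => h3; apply: h1; rewrite h2 andbT leNgt.
  by rewrite ltr0_norm; lra.
- by exfalso; apply: h2; case/andP: h1.
Qed.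

(** By [schwarz] the integrand is the x-derivative of [Dy g], which vanishes far to the left. *)
Lemma Dxinv_test g : test g -> Dxinv (Dy (Dx g)) = Dy g.
Proof.
move=> tg; apply/funext => -[x y]; rewrite schwarz /Dxinv /=; last exact: tg.1.
have ty := test_Dy tg.
apply: (@Rint_ray (fun s => Dy g (s, y)) (fun s => Dx (Dy g) (s, y))).
- by apply: cc2_x; apply: test_cc.
- by apply: cc2_x; apply: test_cc; exact: test_Dx.
- by move=> s; apply: is_derive_x; exact: ty.1.
Qed.

Opaque Dxinv.
Lemma diff_under (h hy : R * R -> R) : cc2 h -> cc2 hy ->
  (forall x y, is_derive y (1:R) (fun y => h (x, y)) (hy (x, y))) ->
  forall y, is_derive y (1:R) (fun y => Int1 (fun x => h (x, y)))
    (Int1 (fun x => hy (x, y))).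
Proof.
move=> ch chy dh y; pose f (y x : R) := h (x, y).
have [C C0 hC] := cc2_bounded chy; have [cch [M hM]] := chy.
pose I : set R := `[(- `|M|), `|M| ]%classic; pose G x := C * \1_I x.
have p1 y' x' : partial1of2 f y' x' = hy (x', y').
  by rewrite partial1of2E -?derive1E ?derive1E; exact: (@derive_val _ _ _ _ _ _ _ (dh x' y')).
have yI : `](y - 1), (y + 1)[%classic y by rewrite /= in_itv /=; apply/andP; split; lra.
have i1 (y' : R) : `](y - 1), (y + 1)[%classic y' -> mu.-integrable setT (EFin \o f y').
  by move=> _; apply: cc1_int; exact: cc2_x.
have d1 (y' x' : R) : `](y - 1), (y + 1)[%classic y' -> [set: R] x' -> derivable (f ^~ x') y' 1.
  by move=> _ _; exact: (@ex_derive _ _ _ _ _ _ _ (dh x' y')).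
have G0 x : 0 <= G x by rewrite /G mulr_ge0 // indicE; case: (_ \in _).
have iG : mu.-integrable setT (EFin \o G).
  rewrite (_ : _ \o _ = (fun x => C%:E * (EFin \o \1_I) x)%E); last by apply/funext.
  by apply: integrableZl; [exact: measurableT|exact: integrable_indic_itv].
have Gub (y' x' : R) : `](y - 1), (y + 1)[%classic y' -> [set: R] x' -> `|partial1of2 f y' x'| <= G x'.
  move=> _ _; rewrite p1 /G indicE.
  case: (boolP (x' \in _)) => [_|/negP xM]; first by rewrite mulr1.
  rewrite mulr0 hM ?normr0//; apply/orP; left; rewrite ltNge; apply/negP => xM'.
  apply: xM; rewrite inE /I /= in_itv/= -ler_norml (le_trans xM') //; exact: ler_norm.
have D := derivable_under_integral measurableT yI i1 d1 G0 iG Gub.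
have E := differentiation_under_integral measurableT yI i1 d1 G0 iG Gub.
apply: DeriveDef; first exact: D.
rewrite -derive1E; apply: etrans; first exact: E.
by congr Rintegral; apply/funext => x; rewrite p1.
Qed.

(* [fa g h] is [<g_x, h_x>_0] and [fb g h] is the L2 product of [g_x] and [h_x]: working with the
   primitives [g] makes [D_x^-1] disappear. *)
Definition fa g h : R := int2 (fun z => Dx (Dx g) z * Dx (Dx h) z + Dy g z * Dy h z).
Definition fb g h : R := int2 (fun z => Dx g z * Dx h z).

Lemma ipY0_repr (u v p r : R * R -> R) : Dxinv (Dy u) = p -> Dxinv (Dy v) = r ->
  ipY0 u v = int2 (fun z => Dx u z * Dx v z + p z * r z).
Proof. by move=> <- <-. Qed.

Lemma ipY0E g h : test g -> test h -> ipY0 (Dx g) (Dx h) = fa g h.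
Proof. by move=> tg th; exact: (ipY0_repr (Dxinv_test tg) (Dxinv_test th)). Qed.

Lemma cc2MM g h : cc2 g -> cc2 h -> cc2 (fun z => g z * h z).
Proof. by move=> cg ch; apply: cc2M => //; exact: cg.1. Qed.

Lemma cc2X2 g : cc2 g -> cc2 (fun z => g z ^+ 2).
Proof. by move=> cg; exact: cc2MM. Qed.

Lemma fa_cc g h : test g -> test h ->
  cc2 (fun z => Dx (Dx g) z * Dx (Dx h) z + Dy g z * Dy h z).
Proof.
move=> tg th; apply: cc2D; apply: cc2MM.
- exact: test_cc (test_Dx (test_Dx tg)).
- exact: test_cc (test_Dx (test_Dx th)).
- exact: test_cc (test_Dy tg).
- exact: test_cc (test_Dy th).
Qed.

(** To be read with [u = g_x], [v = g_y] and [m] their common mixed derivative. The y-derivative of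
    the integral of [u^2] along a horizontal line is the integral of [2 u m = 2 u v_x], that is of
    [- 2 u_x v] after integration by parts, and [2 |u_x v| <= u_x^2 + v^2]. Integrating this in y
    from below the support gives the bound on every line. *)
Lemma slice_bound_gen (u v ux m : R * R -> R) (y : R) :
  cc2 u -> cc2 v -> cc2 ux -> cc2 m ->
  (forall x y, is_derive x (1:R) (fun x => u (x, y)) (ux (x, y))) ->
  (forall x y, is_derive y (1:R) (fun y => u (x, y)) (m (x, y))) ->
  (forall x y, is_derive x (1:R) (fun x => v (x, y)) (m (x, y))) ->
  Int1 (fun x => u (x, y) ^+ 2) <= int2 (fun z => ux z * ux z + v z * v z).
Proof.
move=> cu cv cux cm dxu dyu dxv.
pose h z := u z ^+ 2; pose hy z := 2 * (u z * m z).
have ch : cc2 h by exact: cc2X2.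
have chy : cc2 hy by apply: cc2Z; exact: cc2MM.
have dh x' y' : is_derive y' (1:R) (fun y => h (x', y)) (hy (x', y')).
  have := is_derive_mul (dyu x' y') (dyu x' y').
  by rewrite (_ : _ + _ = hy (x', y')) // /hy; ring.
pose k z := - (2 * (ux z * v z)).
have ck : cc2 k by apply: cc2N; apply: cc2Z; exact: cc2MM.
have hk y' : Int1 (fun x => hy (x, y')) = Int1 (fun x => k (x, y')).
  have cc : cc2 (fun z => ux z * v z + u z * m z) by apply: cc2D; exact: cc2MM.
  apply/eqP; rewrite -subr_eq0 -Int1B; [|exact: (cc2_x y' chy)|exact: (cc2_x y' ck)].
  apply/eqP; rewrite (_ : (fun x => _) = (fun x => 2 * (ux (x, y') * v (x, y') + u (x, y') * m (x, y')))); last first.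
    by apply/funext => x; rewrite /hy /k; ring.
  rewrite Int1Z; last exact: (cc2_x y' cc).
  have D x := is_derive_mul (dxu x y') (dxv x y').
  by rewrite (Int1_deriv0 (cc2_x y' (cc2MM cu cv)) (cc2_x y' cc) D) mulr0.
have H := ftc_norm y (cc1_Int_x ch) (cc1_Int_x chy) (diff_under ch chy dh).
apply: (le_trans (ler_norm _)); apply: (le_trans H).
have cf : cc2 (fun z => ux z * ux z + v z * v z) by apply: cc2D; exact: cc2MM.
rewrite (int2_yx cf); apply: le_Int1; first exact: cc1_norm (cc1_Int_x chy).
  exact: cc1_Int_x cf.
move=> y'; rewrite hk; apply: (le_trans (Int1_norm (cc2_x y' ck))).
apply: le_Int1; first exact: cc1_norm (cc2_x y' ck).
  exact: (cc2_x y' cf).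
move=> x; rewrite /k ler_norml; move: (ux (x, y')) (v (x, y')) => p r.
have := sqr_ge0 (p + r); have := sqr_ge0 (p - r) => ? ?.
by apply/andP; split; lra.
Qed.

Lemma slice_bound g y : test g -> Int1 (fun x => Dx g (x, y) ^+ 2) <= fa g g.
Proof.
move=> tg; have tx := test_Dx tg; have ty := test_Dy tg.
apply: (@slice_bound_gen (Dx g) (Dy g) (Dx (Dx g)) (Dx (Dy g))).
- exact: test_cc.
- exact: test_cc.
- exact: test_cc (test_Dx tx).
- exact: test_cc (test_Dx ty).
- by move=> x' y'; apply: is_derive_x; exact: tx.1.
- by move=> x' y'; rewrite -(schwarz tg.1); apply: is_derive_y; exact: tx.1.
- by move=> x' y'; apply: is_derive_x; exact: ty.1.
Qed.

End Calculus.

(** * Anisotropic Sobolev and Hoelder estimates *)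

Section Inequalities.
Variable R : realType.
Implicit Types g h : R * R -> R.
Notation mu := (@lebesgue_measure R).

Lemma cc1X2 (f : R -> R) : cc1 f -> cc1 (fun x => f x ^+ 2).
Proof. by move=> cf; apply: cc1M => //; exact: cf.1. Qed.

(** The derivative of [F^2] is [2 F f], split by Young's inequality with weight [s]. The free weight
    serves [holder_y_gen], where the two integrals have different orders in [s]. *)
Lemma sqr_le_Int1 (F f : R -> R) (s x : R) : 0 < s -> cc1 F -> cc1 f ->
  (forall x, is_derive x (1:R) F (f x)) ->
  F x ^+ 2 <= s^-1 * Int1 (fun x => F x ^+ 2) + s * Int1 (fun x => f x ^+ 2).
Proof.
move=> s0 cF cf dF.
have cfF : cc1 (fun x => 2 * (F x * f x)) by apply: cc1Z; apply: cc1M => //; exact: cF.1.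
have cF2 := cc1X2 cF; have cf2 := cc1X2 cf.
have D y : is_derive y (1:R) (fun x => F x ^+ 2) (2 * (F y * f y)).
  by have := is_derive_mul (dF y) (dF y); rewrite (_ : _ + _ = 2 * (F y * f y)) //; ring.
have := ftc_norm x cF2 cfF D; rewrite ger0_norm ?sqr_ge0 // => H; apply: (le_trans H).
rewrite -!Int1Z // -Int1D; [|exact: cc1Z|exact: cc1Z].
apply: le_Int1; first exact: cc1_norm.
  by apply: cc1D; exact: cc1Z.
move=> y; move: (F y) (f y) => p r; rewrite ler_norml.
have si : 0 < s^-1 by rewrite invr_gt0.
have E : s^-1 * p ^+ 2 + s * r ^+ 2 - 2 * (p * r) = s^-1 * (p - s * r) ^+ 2.
  by field; rewrite gt_eqF.
have E' : s^-1 * p ^+ 2 + s * r ^+ 2 + 2 * (p * r) = s^-1 * (p + s * r) ^+ 2.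
  by field; rewrite gt_eqF.
have := mulr_ge0 (ltW si) (sqr_ge0 (p - s * r)); rewrite -E.
have := mulr_ge0 (ltW si) (sqr_ge0 (p + s * r)); rewrite -E'.
by move=> ? ?; apply/andP; split; lra.
Qed.

(** On each line [u^4] is at most the supremum of [u^2] times [u^2]: the supremum is controlled by
    [sqr_le_Int1] with weight 1 and remains integrable in y, and the other factor integrates to at
    most [C]. *)
Lemma L4_gen (u ux : R * R -> R) (C : R) : cc2 u -> cc2 ux ->
  (forall x y, is_derive x (1:R) (fun x => u (x, y)) (ux (x, y))) ->
  (forall y, Int1 (fun x => u (x, y) ^+ 2) <= C) ->
  int2 (fun z => u z ^+ 4) <= C * (int2 (fun z => u z ^+ 2) + int2 (fun z => ux z ^+ 2)).
Proof.
move=> cu cux du uC.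
have cu2 := cc2X2 cu; have cux2 := cc2X2 cux.
have cu4 : cc2 (fun z => u z ^+ 4).
  have := cc2X2 cu2; congr cc2; apply/funext => z; by rewrite -exprM.
rewrite (int2_yx cu4) (int2_yx cu2) (int2_yx cux2).
have c1 := cc1_Int_x cu2; have c2 := cc1_Int_x cux2.
rewrite -Int1D // -Int1Z; last exact: cc1D.
apply: le_Int1; first exact: cc1_Int_x cu4.
  by apply: cc1Z; exact: cc1D.
move=> y /=; have cy := cc2_x y cu; have cxy := cc2_x y cux.
set S := _ + _.
have S0 : 0 <= S by rewrite addr_ge0 // Int1_ge0 // => x; exact: sqr_ge0.
have H x : u (x, y) ^+ 2 <= S.
  by have := sqr_le_Int1 x ltr01 cy cxy (du ^~ y); rewrite invr1 !mul1r.
apply: (@le_trans _ _ (Int1 (fun x => S * u (x, y) ^+ 2))).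
  apply: le_Int1; first exact: cc2_x y cu4.
    by apply: cc1Z; exact: cc1X2.
  move=> x; rewrite (exprD _ 2 2); apply: ler_wpM2r => //; exact: sqr_ge0.
rewrite Int1Z; last exact: cc1X2.
by rewrite mulrC; apply: ler_wpM2r.
Qed.

Lemma itv_mono (f : R -> R) (a b b' : R) : continuous f -> (forall x, 0 <= f x) ->
  b <= b' -> Rintegral mu `[a, b] f <= Rintegral mu `[a, b'] f.
Proof.
move=> cf f0 bb; rewrite /Rintegral fine_le //.
- by apply: integrable_fin_num; [exact: measurable_itv|exact: itv_int].
- by apply: integrable_fin_num; [exact: measurable_itv|exact: itv_int].
- apply: ge0_subset_integral; [exact: measurable_itv|exact: measurable_itv| | |].
  + by apply/measurable_EFinP; apply: measurable_funTS; exact: continuous_measurable_fun.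
  + by move=> x _; rewrite lee_fin.
  + by apply: subset_itvl; rewrite bnd_simp.
Qed.

(** One factor [s] is already in the pointwise hypothesis, the other comes from [smear] on each
    horizontal line. *)
Lemma smear2 (k D : R * R -> R) (s : R) : 0 <= s -> cc2 k -> cc2 D ->
  (forall x y, D (x, y) ^+ 2 <= s * Rintegral mu `[x, x + s] (fun x => k (x, y) ^+ 2)) ->
  int2 (fun z => D z ^+ 2) <= s ^+ 2 * int2 (fun z => k z ^+ 2).
Proof.
move=> s0 ck cD H.
have ck2 := cc2X2 ck; have cD2 := cc2X2 cD.
rewrite (int2_yx ck2) (int2_yx cD2) -Int1Z; last exact: cc1_Int_x ck2.
apply: le_Int1; first exact: cc1_Int_x cD2.
  by apply: cc1Z; exact: cc1_Int_x ck2.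
move=> y; have cky := cc2_x y ck2; have cDy := cc2_x y cD2.
rewrite expr2 -mulrA -Int1Z //.
apply: (smear (cc1Z s cky)) => //.
- by move=> x; rewrite mulr_ge0 // sqr_ge0.
- by move=> x; exact: sqr_ge0.
- move=> x; rewrite RintegralZl; [exact: H|exact: measurable_itv|].
  exact: (@itv_int R (fun x => k (x, y) ^+ 2) x (x + s) cky.1).
Qed.

(** Difference quotient of step [e] in x. It stands in for g_x wherever only the values of [g] are
    under control: it is close to g_x in L2, uniformly on bounded energy. *)
Definition pe (e : R) g : R * R -> R := fun z => (g (z.1 + e, z.2) - g z) / e.

Lemma shift_affE (s t : R) g : (fun z => g (z.1 + s, z.2 + t)) = g \o aff 1 s 1 t.
Proof. by apply/funext => z; rewrite /aff /= !mul1r. Qed.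

Lemma cc2_shift (s t : R) g : cc2 g -> cc2 (fun z => g (z.1 + s, z.2 + t)).
Proof.
move=> [cg [M gM]]; rewrite shift_affE; split.
  by move=> z; apply: continuous_comp; [exact: aff_continuous|exact: cg].
exists (`|M| + `|s| + `|t|) => x y xy; rewrite /aff /= !mul1r; apply: gM.
have := ler_norm M; have := ler_normD (x + s) (- s); have := ler_normD (y + t) (- t).
rewrite !addrK !normrN; have := normr_ge0 s; have := normr_ge0 t => ? ? ? ? ?.
by move/orP: xy => [h|h]; apply/orP; [left|right]; lra.
Qed.

Lemma cc2_diffx (s : R) g : cc2 g -> cc2 (fun z => g (z.1 + s, z.2) - g z).
Proof.
move=> cg; apply: cc2B => //; have := cc2_shift s 0 cg.
by rewrite (_ : (fun z => g (z.1 + s, z.2 + 0)) = (fun z => g (z.1 + s, z.2))) //;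
  apply/funext => z; rewrite addr0.
Qed.

Lemma cc2_diffy (s : R) g : cc2 g -> cc2 (fun z => g (z.1, z.2 + s) - g z).
Proof.
move=> cg; apply: cc2B => //; have := cc2_shift 0 s cg.
by rewrite (_ : (fun z => g (z.1 + 0, z.2 + s)) = (fun z => g (z.1, z.2 + s))) //;
  apply/funext => z; rewrite addr0.
Qed.

Lemma diffx_L2_gen (g gx : R * R -> R) (s : R) : 0 <= s -> cc2 g -> cc2 gx ->
  (forall x y, is_derive x (1:R) (fun x => g (x, y)) (gx (x, y))) ->
  int2 (fun z => (g (z.1 + s, z.2) - g z) ^+ 2) <= s ^+ 2 * int2 (fun z => gx z ^+ 2).
Proof.
move=> s0 cg cgx dg; apply: (@smear2 gx (fun z => g (z.1 + s, z.2) - g z)) => //.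
  exact: cc2_diffx.
move=> x y /=; have xs : x <= x + s by rewrite lerDl.
have := ftc_sqr xs (dg ^~ y) (cc2_x y cgx).1.
by rewrite addrAC subrr add0r.
Qed.

Lemma pe_L2_gen (g gx gxx : R * R -> R) (e : R) : 0 < e -> cc2 g -> cc2 gx -> cc2 gxx ->
  (forall x y, is_derive x (1:R) (fun x => g (x, y)) (gx (x, y))) ->
  (forall x y, is_derive x (1:R) (fun x => gx (x, y)) (gxx (x, y))) ->
  int2 (fun z => (gx z - pe e g z) ^+ 2) <= e ^+ 2 * int2 (fun z => gxx z ^+ 2).
Proof.
move=> e0 cg cgx cgxx dg dgx; apply: (@smear2 gxx (fun z => gx z - pe e g z)) => //.
- exact: ltW.
- apply: cc2B => //; rewrite /pe.
  rewrite (_ : (fun z => _) = (fun z => e^-1 * (g (z.1 + e, z.2) - g z))).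
    by apply: cc2Z; exact: cc2_diffx.
  by apply/funext => z; rewrite mulrC.
move=> x y; rewrite /pe /=.
have xe : x < x + e by rewrite ltrDl.
(* The quotient is [gx] at an intermediate point, so the error is an increment of [gx] over a length
   less than [e]. *)
have [c /andP[xc ce] ->] := mvt1 xe (dg ^~ y).
rewrite (_ : x + e - x = e); last by ring.
rewrite mulfK ?gt_eqF // -sqrrN opprB.
apply: (le_trans (ftc_sqr (ltW xc) (dgx ^~ y) (cc2_x y cgxx).1)).
apply: ler_pM.
- by rewrite subr_ge0 ltW.
- by apply: Rintegral_ge0 => z _; exact: sqr_ge0.
- by lra.
- apply: itv_mono; [|by move=> z; exact: sqr_ge0|exact: ltW].
  exact: (cc2_x y (cc2X2 cgxx)).1.
Qed.

Lemma holder_x_gen (g gx : R * R -> R) (h x y C : R) : 0 <= h -> cc2 g -> cc2 gx ->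
  (forall x y, is_derive x (1:R) (fun x => g (x, y)) (gx (x, y))) ->
  (forall y, Int1 (fun x => gx (x, y) ^+ 2) <= C) ->
  (g (x + h, y) - g (x, y)) ^+ 2 <= h * C.
Proof.
move=> h0 cg cgx dg gC; have xs : x <= x + h by rewrite lerDl.
have := ftc_sqr xs (dg ^~ y) (cc2_x y cgx).1.
rewrite (_ : x + h - x = h); last by ring.
move=> H; apply: (le_trans H); apply: ler_wpM2l => //.
apply: le_trans (gC y); apply: itv_int_le_Int1.
  exact: (cc2_x y (cc2X2 cgx)).
by move=> ?; exact: sqr_ge0.
Qed.

(** On a horizontal line, the increment over the height [s^2] has squared L2 norm at most [s^2 C] by
    the bound on [gy], and its x-derivative at most [4 C] by the slice bounds at the two heights.
    [sqr_le_Int1] with weight [s] gives [s C + 4 s C]; the height is written [s^2] to make the two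
    orders match. *)
Lemma holder_y_gen (g gx gy : R * R -> R) (s x y C : R) : 0 < s -> cc2 g -> cc2 gx -> cc2 gy ->
  (forall x y, is_derive x (1:R) (fun x => g (x, y)) (gx (x, y))) ->
  (forall x y, is_derive y (1:R) (fun y => g (x, y)) (gy (x, y))) ->
  (forall y, Int1 (fun x => gx (x, y) ^+ 2) <= C) ->
  int2 (fun z => gy z ^+ 2) <= C ->
  (g (x, y + s ^+ 2) - g (x, y)) ^+ 2 <= 5 * s * C.
Proof.
move=> s0 cg cgx cgy dx dy gC yC.
have cG := cc2_x y (cc2_diffy (s ^+ 2) cg); have cGx := cc2_x y (cc2_diffy (s ^+ 2) cgx).
have D x' : is_derive x' (1:R) (fun x => g (x, y + s ^+ 2) - g (x, y)) (gx (x', y + s ^+ 2) - gx (x', y)).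
  exact: is_deriveB.
have H := sqr_le_Int1 x s0 cG cGx D; apply: (le_trans H) => /=.
have i1 : Int1 (fun x => (g (x, y + s ^+ 2) - g (x, y)) ^+ 2) <= s ^+ 2 * C.
  apply: (@le_trans _ _ (s ^+ 2 * int2 (fun z => gy z ^+ 2))); last first.
    by apply: ler_wpM2l => //; exact: sqr_ge0.
  have cy2 := cc2X2 cgy.
  rewrite (int2_xy cy2) -Int1Z; last exact: cc1_Int_y cy2.
  apply: le_Int1; [exact: cc1X2 cG|by apply: cc1Z; exact: cc1_Int_y cy2|].
  move=> x'; have ys : y <= y + s ^+ 2 by rewrite lerDl sqr_ge0.
  have := ftc_sqr ys (dy x') (cc2_y x' cgy).1.
  rewrite (_ : y + s ^+ 2 - y = s ^+ 2); last by ring.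
  move=> H'; apply: (le_trans H'); apply: ler_wpM2l; first exact: sqr_ge0.
  apply: itv_int_le_Int1; first exact: cc2_y x' cy2.
  by move=> ?; exact: sqr_ge0.
have i2 : Int1 (fun x => (gx (x, y + s ^+ 2) - gx (x, y)) ^+ 2) <= 4 * C.
  have c1 := cc2_x (y + s ^+ 2) (cc2X2 cgx); have c2 := cc2_x y (cc2X2 cgx).
  apply: (@le_trans _ _ (2 * Int1 (fun x => gx (x, y + s ^+ 2) ^+ 2) + 2 * Int1 (fun x => gx (x, y) ^+ 2))).
    rewrite -!Int1Z // -Int1D; [|exact: cc1Z|exact: cc1Z].
    apply: le_Int1; [exact: cc1X2 cGx|by apply: cc1D; exact: cc1Z|].
    move=> x'; move: (gx _) (gx _) => p r; have := sqr_ge0 (p + r) => ?; lra.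
  by have := gC y; have := gC (y + s ^+ 2); lra.
have si : 0 < s^-1 by rewrite invr_gt0.
have j1 := ler_wpM2l (ltW si) i1; have j2 := ler_wpM2l (ltW s0) i2.
apply: (le_trans (lerD j1 j2)).
rewrite (_ : s^-1 * _ = s * C); last by field; rewrite gt_eqF.
by lra.
Qed.

End Inequalities.

(** * Nonnegative symmetric forms *)

Section Forms.
Variables (R : realType) (V : lmodType R).

(** The axioms are relative to [P] because the forms are integrals, linear only on suitable
    functions, while the ambient module contains all functions. Degeneracy is allowed: functions
    equal almost everywhere are not identified. *)
Record psform (P : V -> Prop) (B : V -> V -> R) : Prop := PSForm {
  ps_lin : forall c x y, P x -> P y -> P (c *: x + y);
  ps_Blin : forall c x y z, P x -> P y -> P z ->
    B (c *: x + y) z = c * B x z + B y z;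
  ps_sym : forall x y, P x -> P y -> B x y = B y x;
  ps_ge0 : forall x, P x -> 0 <= B x x }.

Variables (P : V -> Prop) (B : V -> V -> R).
Hypothesis HB : psform P B.

Let N x := B x x.

Lemma psB x y : P x -> P y -> P (x - y).
Proof. by move=> px py; rewrite -scaleN1r addrC; exact: (ps_lin HB). Qed.

Lemma ps_comb s t x y : P x -> P y -> P (s *: x + t *: y).
Proof.
move=> px py; apply: (ps_lin HB) => //; rewrite -[_ *: y]addr0 -(subrr y).
by apply: (ps_lin HB) => //; exact: psB.
Qed.

Lemma ps_N c x y : P x -> P y ->
  N (c *: x + y) = c ^+ 2 * N x + 2 * c * B x y + N y.
Proof.
move=> px py; have pxy : P (c *: x + y) by exact: (ps_lin HB).
rewrite /N (ps_Blin HB) // (ps_sym HB px pxy) (ps_sym HB py pxy).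
by rewrite !(ps_Blin HB) // (ps_sym HB py px); ring.
Qed.

Lemma ps_NB x y : P x -> P y -> N (x - y) = N x - 2 * B x y + N y.
Proof.
move=> px py; rewrite -scaleN1r addrC ps_N // (ps_sym HB py px); ring.
Qed.

Lemma ps_CS x y : P x -> P y -> (B x y) ^+ 2 <= N x * N y.
Proof.
move=> px py; apply: quad_disc => t; have := ps_ge0 HB (ps_lin HB t px py).
by rewrite -/(N _) ps_N //; lra.
Qed.

Lemma ps_Blin0 z : P z -> B 0 z = 0.
Proof.
move=> pz; have := ps_Blin HB (-1) pz pz pz.
by rewrite scaleN1r addNr => ->; rewrite mulN1r addNr.
Qed.

Lemma ps_NZ c x : P x -> N (c *: x) = c ^+ 2 * N x.
Proof.
move=> px; have p0 : P 0 by rewrite -(subrr x); exact: psB.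
have := ps_N c px p0; rewrite addr0 => ->.
by rewrite (ps_sym HB px p0) /N !ps_Blin0 //; ring.
Qed.

Lemma ps_N_mix s t x y : P x -> P y ->
  N (s *: x + t *: y) = s ^+ 2 * N x + 2 * (s * t) * B x y + t ^+ 2 * N y.
Proof.
move=> px py.
have pty : P (t *: y) by have := ps_comb 0 t px py; rewrite scale0r add0r.
rewrite ps_N // ps_NZ // (ps_sym HB px pty) (_ : B _ _ = t * B x y); first ring.
have p0 : P 0 by rewrite -(subrr x); exact: psB.
by have := ps_Blin HB t py p0 px; rewrite addr0 ps_Blin0 // addr0 (ps_sym HB py px).
Qed.

(** Young's inequality on the cross term. For small [s] the first constant is close to 1, which
    preserves the sharp bound [1 - al] in [hull_min]. *)
Lemma ps_tri s x y z : 0 < s -> P x -> P y -> P z ->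
  N (x - z) <= (1 + s) * N (x - y) + (1 + s^-1) * N (y - z).
Proof.
move=> s0 px py pz; have pa := psB px py; have pb := psB py pz.
have -> : x - z = 1 *: (x - y) + 1 *: (y - z) by rewrite !scale1r addrA subrK.
rewrite ps_N_mix //.
have := ps_ge0 HB (ps_comb s (-1) pa pb); rewrite -/(N _) ps_N_mix // => H.
have si : 0 < s^-1 by rewrite invr_gt0.
have := mulr_ge0 (ltW si) H.
rewrite (_ : s^-1 * _ = s * N (x - y) - 2 * B (x - y) (y - z) + s^-1 * N (y - z)); first lra.
by field; rewrite gt_eqF.
Qed.

Lemma ps_tri2 x y z : P x -> P y -> P z ->
  N (x - z) <= 2 * N (x - y) + 2 * N (y - z).
Proof. by move=> px py pz; have := ps_tri ltr01 px py pz; rewrite invr1. Qed.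

Inductive hull (A : V -> Prop) : V -> Prop :=
| hull_base x : A x -> hull A x
| hull_conv t x y : 0 <= t <= 1 -> hull A x -> hull A y ->
    hull A ((1 - t) *: x + t *: y).

Lemma hull_ind_convex (A Q : V -> Prop) : (forall x, A x -> Q x) ->
  (forall t x y, 0 <= t <= 1 -> Q x -> Q y -> Q ((1 - t) *: x + t *: y)) ->
  forall x, hull A x -> Q x.
Proof. by move=> AQ cQ x; elim=> {x}[x /AQ //|t x y t01 _ ? _ ?]; exact: cQ. Qed.

Lemma hullS (A A' : V -> Prop) : (forall x, A x -> A' x) ->
  forall x, hull A x -> hull A' x.
Proof.
move=> AA; apply: hull_ind_convex => [x /AA|t x y t01]; first exact: hull_base.
exact: hull_conv.
Qed.

Lemma ps_N_convex (C : R) : 0 <= C -> forall x, hull (fun x => P x /\ N x <= C) x -> P x /\ N x <= C.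
Proof.
move=> C0; apply: hull_ind_convex => // t x y /andP[t0 t1] [px Nx] [py Ny].
split; first exact: ps_comb.
rewrite ps_N_mix //.
have H : 2 * B x y <= N x + N y.
  by have := ps_ge0 HB (psB px py); rewrite -/(N _) ps_NB //; lra.
have s0 : 0 <= 1 - t by lra.
have K := ler_wpM2l (mulr_ge0 s0 t0) H.
have := ler_wpM2l s0 Nx; have := ler_wpM2l t0 Ny => ? ?; nra.
Qed.

Definition tail (U : nat -> V) (m : nat) (x : V) := exists2 n, (m <= n)%N & x = U n.

Section HullMin.
Variable U : nat -> V.
Hypothesis PU : forall n, P (U n).
Hypothesis NU : forall n, N (U n) <= 1.

Let K m := hull (tail U m).

Let KP m x : K m x -> P x /\ N x <= 1.
Proof.
move=> Kx; apply: ps_N_convex; first exact: ler01.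
by apply: hullS Kx => _ [n _ ->].
Qed.

Let KS m m' x : (m <= m')%N -> K m' x -> K m x.
Proof.
by move=> mm; apply: hullS => _ [n mn ->]; exists n => //; exact: leq_trans mn.
Qed.

Let d m := inf [set N x | x in [set x | K m x]].

Let KU m : K m (U m). Proof. by apply: hull_base; exists m. Qed.

Let has_inf_d m : has_inf [set N x | x in [set x | K m x]].
Proof.
split; first by exists (N (U m)); exists (U m) => //=; exact: KU.
by exists 0 => _ [x /= /KP[px _] <-]; exact: ps_ge0 HB _ px.
Qed.

Let d_le m x : K m x -> d m <= N x.
Proof. by move=> Kx; apply: ge_inf; [exact: (has_inf_d m).2|exists x]. Qed.

Let d_mono m m' : (m <= m')%N -> d m <= d m'.
Proof.
move=> mm; apply: lb_le_inf; first exact: (has_inf_d m').1.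
by move=> _ [x /= Kx <-]; apply: d_le; exact: KS Kx.
Qed.

Let d_ge0 m : 0 <= d m.
Proof.
apply: lb_le_inf; first exact: (has_inf_d m).1.
by move=> _ [x /= /KP[px _] <-]; exact: ps_ge0 HB _ px.
Qed.

Let d_le1 m : d m <= 1. Proof. by apply: le_trans (d_le (KU m)) _. Qed.

Let alpha := sup (range d).

Let has_sup_d : has_sup (range d).
Proof. by split; [exists (d 0%N); exists 0%N|exists 1 => _ [m _ <-]; exact: d_le1]. Qed.

Let d_alpha m : d m <= alpha.
Proof. by apply: ub_le_sup; [exact: has_sup_d.2|exists m]. Qed.

Let alpha_near e : 0 < e -> exists M, forall m, (M <= m)%N -> alpha - e < d m.
Proof.
move=> e0; have [_ [M _ <-] h] := sup_adherent e0 has_sup_d.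
by exists M => m Mm; apply: lt_le_trans h _; exact: d_mono.
Qed.

(** [v m] nearly minimises [N] on the convex hull of the [m]-th tail. The infima increase with [m]
    to a limit [al], and the parallelogram identity makes [v] Cauchy. The last clause is the
    variational inequality at a minimiser: the angle at [v] towards [U n] is nearly obtuse, so
    [N (U n - v)] is at most [N (U n) - N v] up to a small error. A weakly convergent sequence would
    satisfy the same relation with its weak limit. *)
Lemma hull_min : exists (v : nat -> V) (al : R),
  [/\ 0 <= al <= 1,
      forall m, hull (tail U m) (v m),
      forall e, 0 < e -> exists M, forall m, (M <= m)%N -> al - e < N (v m) < al + e,
      forall e, 0 < e -> exists M, forall m m', (M <= m)%N -> (M <= m')%N ->
        N (v m - v m') <= e &
      forall e, 0 < e -> exists M, forall n m, (M <= n)%N -> (M <= m)%N ->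
        N (U n - v m) <= 1 - al + e].
Proof.
have [v vP] : exists v : nat -> V, forall m, K m (v m) /\ N (v m) < d m + m.+1%:R^-1.
  suff /choice[v vP] : forall m, exists x, K m x /\ N x < d m + m.+1%:R^-1 by exists v.
  move=> m.
  have e0 : 0 < m.+1%:R^-1 :> R by rewrite invr_gt0 ltr0n.
  by have [_ [x /= Kx <-] h] := inf_adherent e0 (has_inf_d m); exists x.
have inv_near e : 0 < e -> exists M, forall m, (M <= m)%N -> m.+1%:R^-1 < e :> R.
  move=> e0; have := @cvg_harmonic R; move/cvgrPdist_lt => /(_ e e0) [M _ h].
  exists M => m /h; rewrite /harmonic /= sub0r normrN ger0_norm //.
have Pv m : P (v m) := (KP (vP m).1).1.
have near e : 0 < e -> exists M, forall m, (M <= m)%N ->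
    [/\ alpha - e < d m, d m <= N (v m), N (v m) < alpha + e & m.+1%:R^-1 < e].
  move=> e0; have [M1 h1] := alpha_near e0; have [M2 h2] := inv_near e e0.
  exists (maxn M1 M2) => m; rewrite geq_max => /andP[m1 m2].
  split; [exact: h1|exact: d_le (vP m).1| |exact: h2].
  apply: (lt_le_trans (vP m).2); apply: lerD; [exact: d_alpha|exact: ltW (h2 _ m2)].
(* The midpoint lies in the hull, so its norm is at least [d m]; with [ps_NB] this is the
   parallelogram argument. *)
have mid x y m : K m x -> K m y -> 4 * d m <= N x + 2 * B x y + N y.
  move=> Kx Ky; have h01 : 0 <= (2^-1 : R) <= 1 by apply/andP; split; lra.
  have := d_le (hull_conv h01 Kx Ky); rewrite ps_N_mix; [|exact: (KP Kx).1|exact: (KP Ky).1].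
  lra.
have cauchy e : 0 < e -> exists M, forall m m', (M <= m)%N -> (M <= m')%N ->
        N (v m - v m') <= e.
  move=> e0; have e8 : 0 < e / 8 by rewrite divr_gt0.
  have [M h] := near _ e8; exists M.
  have wl m m' : (M <= m)%N -> (m <= m')%N -> N (v m - v m') <= e.
    move=> Mm mm; have Mm' := leq_trans Mm mm.
    have [a1 a2 a3 _] := h _ Mm; have [b1 b2 b3 _] := h _ Mm'.
    have := mid _ _ _ (vP m).1 (KS mm (vP m').1).
    by rewrite ps_NB //; lra.
  move=> m m' Mm Mm'; case/orP: (leq_total m m') => mm; first exact: wl.
  by rewrite -[X in N X]opprB -scaleN1r ps_NZ ?sqrrN ?expr1n ?mul1r; [exact: wl|exact: psB].
exists v, alpha; split => //.
- rewrite (le_trans (d_ge0 0) (d_alpha 0)) /=.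
  by apply: ge_sup; [exact: has_sup_d.1|move=> _ [m _ <-]].
- by move=> m; exact: (vP m).1.
- move=> e e0; have [M h] := near _ e0; exists M => m /h[a b c _].
  by rewrite c andbT; exact: lt_le_trans a b.
move=> e e0.
(* first against one fixed v M, then move M by the Cauchy property *)
have key e' : 0 < e' -> e' < 1 -> exists M0, forall M, (M0 <= M)%N -> forall n, (M <= n)%N ->
    N (U n - v M) <= 1 - alpha + e'.
  move=> e'0 e'1; pose t := e' / 8.
  have t0 : 0 < t by rewrite divr_gt0.
  have t1 : t < 1 by rewrite /t; lra.
  (* [v M] is within [t^2] of the infimum, so moving by [t] towards [U n] lowers [N] by at most
     [t^2]. After division by [t] this bounds [B (v M) (U n) - N (v M)] below by [- 5 t / 2], and
     [e' = 8 t] leaves room for every error. *)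
  have tt : 0 < t ^+ 2 by rewrite exprn_gt0.
  have [M0 h] := near _ tt; exists M0 => M M0M n Mn.
  have [a1 a2 a3 a4] := h _ M0M.
  have Kn : K M (U n) by apply: hull_base; exists n.
  have b1 : d M <= N ((1 - t) *: v M + t *: U n).
    by apply: d_le; apply: hull_conv; [apply/andP; split; lra|exact: (vP M).1|].
  rewrite ps_N_mix // in b1; have b2 : N (v M) < d M + t ^+ 2.
    by apply: lt_trans (vP M).2 _; rewrite ltrD2l.
  have b3 := NU n; have b4 := (KP (vP M).1).2.
  have b5 := ps_ge0 HB (PU n); have b6 := ps_ge0 HB (Pv M).
  rewrite -/(N _) in b5; rewrite -/(N _) in b6.
  rewrite ps_NB // (ps_sym HB (PU n)) //.
  set p := N (v M) in b1 b2 b4 b6 a2 a3 *; set r := N (U n) in b1 b3 b5 *.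
  set b := B (v M) (U n) in b1 *.
  have c1 : 0 <= 2 * t * (b - p) + t ^+ 2 * (p - 2 * b + r + 1) by lra.
  have c2 : 0 <= t * (2 * (b - p) + t * (p - 2 * b + r + 1)) by lra.
  have c3 : 0 <= 2 * (b - p) + t * (p - 2 * b + r + 1).
    by rewrite -(pmulr_rge0 _ t0).
  have c4 : - 2 * b <= p + r.
    have := ps_ge0 HB (ps_comb 1 1 (Pv M) (PU n)); rewrite -/(N _) ps_N_mix // -/p -/r -/b; lra.
  have c5 : t * (p - 2 * b + r + 1) <= t * 5 by rewrite ler_pM2l //; lra.
  have c6 : t ^+ 2 <= t by rewrite expr2 ger_pMr // ltW.
  have te : e' = 8 * t by rewrite /t; lra.
  clearbody t; lra.
(* [e1] is the weight of the triangle inequality through [v M]. The distance from [v M] to [v m] is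
   taken of order [e1^2] to absorb the factor [1 + e1^-1]. *)
pose e1 := Num.min (e / 8) (1 / 2).
have e10 : 0 < e1 by rewrite lt_min; apply/andP; split; lra.
have e11 : e1 <= e / 8 by rewrite ge_min lexx.
have e12 : e1 <= 1 / 2 by rewrite ge_min lexx orbT.
have e13 : e1 < 1 by lra.
have [M0 h0] := key _ e10 e13.
have ee : 0 < e1 ^+ 2 by rewrite exprn_gt0.
have [M1 h1] := cauchy _ ee.
exists (maxn M0 M1) => n m; set M := maxn M0 M1 => Mn Mm.
have H1 := h0 M (leq_maxl _ _) n Mn.
have H2 := h1 M m (leq_maxr _ _) (leq_trans (leq_maxr _ _) Mm).
have := ps_tri e10 (PU n) (Pv M) (Pv m) => H.
have al0 : 0 <= alpha by exact: le_trans (d_ge0 0) (d_alpha 0).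
have i0 : 0 < 1 + e1^-1 by rewrite addr_gt0 // invr_gt0.
have j1 : (1 + e1) * N (U n - v M) <= (1 + e1) * (1 - alpha + e1) by rewrite ler_pM2l //; lra.
have j2 : (1 + e1^-1) * N (v M - v m) <= e1 ^+ 2 + e1.
  apply: (@le_trans _ _ ((1 + e1^-1) * e1 ^+ 2)); first by rewrite ler_pM2l.
  by rewrite mulrDl mul1r expr2 mulrA mulVf ?mul1r // gt_eqF.
have j3 : e1 * e1 <= e1 by rewrite ger_pMr // ltW.
have j4 : 0 <= e1 * alpha by rewrite mulr_ge0 // ltW.
nra.
Qed.

End HullMin.
End Forms.

(** * The energy and mass forms on test functions, and their behaviour under dilations *)

Section TestForms.
Variable R : realType.
Implicit Types g h : R * R -> R.
Notation mu := (@lebesgue_measure R).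

Lemma fa_repr g h (p1 r1 p2 r2 : R * R -> R) :
  Dx (Dx g) = p1 -> Dy g = r1 -> Dx (Dx h) = p2 -> Dy h = r2 ->
  fa g h = int2 (fun z => p1 z * p2 z + r1 z * r2 z).
Proof. by move=> <- <- <- <-. Qed.

Lemma fb_repr g h (p1 p2 : R * R -> R) :
  Dx g = p1 -> Dx h = p2 -> fb g h = int2 (fun z => p1 z * p2 z).
Proof. by move=> <- <-. Qed.

Lemma Dxx_lin (c : R) g h : smooth g -> smooth h ->
  Dx (Dx (fun z => c * g z + h z)) = (fun z => c * Dx (Dx g) z + Dx (Dx h) z).
Proof.
move=> sg sh; apply: etrans (Dx_lin c (smooth_derive _ sg) (smooth_derive _ sh)).
by rewrite -(Dx_lin c sg sh).
Qed.

Lemma int2_lin (c : R) (p1 p2 p3 : R * R -> R) : cc2 p1 -> cc2 p2 -> cc2 p3 ->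
  int2 (fun z => (c * p1 z + p2 z) * p3 z) =
  c * int2 (fun z => p1 z * p3 z) + int2 (fun z => p2 z * p3 z).
Proof.
move=> c1 c2 c3; have i1 := cc2_int (cc2MM c1 c3); have i2 := cc2_int (cc2MM c2 c3).
have i1' := cc2_int (cc2Z c (cc2MM c1 c3)).
rewrite -(int2Z c i1) -(int2D i1' i2); congr int2; apply/funext => z; ring.
Qed.

Lemma int2_lin2 (c : R) (p1 p2 p3 r1 r2 r3 : R * R -> R) :
  cc2 p1 -> cc2 p2 -> cc2 p3 -> cc2 r1 -> cc2 r2 -> cc2 r3 ->
  int2 (fun z => (c * p1 z + p2 z) * p3 z + (c * r1 z + r2 z) * r3 z) =
  c * int2 (fun z => p1 z * p3 z + r1 z * r3 z) + int2 (fun z => p2 z * p3 z + r2 z * r3 z).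
Proof.
move=> c1 c2 c3 d1 d2 d3.
have e (p r p' r' : R * R -> R) : cc2 p -> cc2 r -> cc2 p' -> cc2 r' ->
   int2 (fun z => p z * p' z + r z * r' z) = int2 (fun z => p z * p' z) + int2 (fun z => r z * r' z).
  move=> cp cr cp' cr'.
  by rewrite -(int2D (cc2_int (cc2MM cp cp')) (cc2_int (cc2MM cr cr'))).
rewrite (e _ _ _ _ c1 d1 c3 d3) (e _ _ _ _ c2 d2 c3 d3).
rewrite (e _ _ _ _ (cc2D (cc2Z c c1) c2) (cc2D (cc2Z c d1) d2) c3 d3).
by rewrite (int2_lin c c1 c2 c3) (int2_lin c d1 d2 d3); ring.
Qed.

Lemma int2_sym2 (p p' r r' : R * R -> R) :
  int2 (fun z => p z * p' z + r z * r' z) = int2 (fun z => p' z * p z + r' z * r z).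
Proof. by congr int2; apply/funext => z; rewrite mulrC [r z * _]mulrC. Qed.

Lemma int2_sym (p p' : R * R -> R) :
  int2 (fun z => p z * p' z) = int2 (fun z => p' z * p z).
Proof. by congr int2; apply/funext => z; rewrite mulrC. Qed.

Lemma int2_sqr_ge0 (p : R * R -> R) : 0 <= int2 (fun z => p z * p z).
Proof. by apply: int2_ge0 => z; rewrite -expr2 sqr_ge0. Qed.

Lemma int2_sqr2_ge0 (p r : R * R -> R) : 0 <= int2 (fun z => p z * p z + r z * r z).
Proof. by apply: int2_ge0 => z; rewrite -!expr2 addr_ge0 // sqr_ge0. Qed.

Lemma int2_sqr_le (p r : R * R -> R) : cc2 p -> cc2 r ->
  int2 (fun z => p z ^+ 2) <= int2 (fun z => p z * p z + r z * r z).
Proof.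
move=> cp cr; apply: (le_int2 (cc2_int (cc2X2 cp)) (cc2_int (cc2D (cc2MM cp cp) (cc2MM cr cr)))).
by move=> z; rewrite -!expr2 lerDl sqr_ge0.
Qed.

Lemma int2_sqr_le' (p r : R * R -> R) : cc2 p -> cc2 r ->
  int2 (fun z => r z ^+ 2) <= int2 (fun z => p z * p z + r z * r z).
Proof.
move=> cp cr; apply: (le_int2 (cc2_int (cc2X2 cr)) (cc2_int (cc2D (cc2MM cp cp) (cc2MM cr cr)))).
by move=> z; rewrite -!expr2 lerDr sqr_ge0.
Qed.

Definition fnt : lmodType R := (R * R)%type -> R^o.

Lemma fa_ps : psform (V := fnt) (@test R) (@fa R).
Proof.
split.
- by move=> c x y; exact: test_lin.
- move=> c x y z tx ty tz.
  rewrite (@fa_repr (c *: (x : fnt) + (y : fnt)) z _ _ _ _ (Dxx_lin c tx.1 ty.1) (Dy_lin c tx.1 ty.1) erefl erefl).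
  rewrite (@int2_lin2 c (Dx (Dx x)) (Dx (Dx y)) (Dx (Dx z)) (Dy x) (Dy y) (Dy z)) //.
  + exact: test_cc (test_Dx (test_Dx tx)).
  + exact: test_cc (test_Dx (test_Dx ty)).
  + exact: test_cc (test_Dx (test_Dx tz)).
  + exact: test_cc (test_Dy tx).
  + exact: test_cc (test_Dy ty).
  + exact: test_cc (test_Dy tz).
- by move=> x y _ _; exact: int2_sym2.
- by move=> x _; exact: int2_sqr2_ge0.
Qed.

Lemma fb_ps : psform (V := fnt) (@test R) (@fb R).
Proof.
split.
- by move=> c x y; exact: test_lin.
- move=> c x y z tx ty tz.
  rewrite (@fb_repr (c *: (x : fnt) + (y : fnt)) z _ _ (Dx_lin c tx.1 ty.1) erefl).
  apply: (@int2_lin c (Dx x) (Dx y) (Dx z)).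
  + exact: test_cc (test_Dx tx).
  + exact: test_cc (test_Dx ty).
  + exact: test_cc (test_Dx tz).
- by move=> x y _ _; exact: int2_sym.
- by move=> x _; exact: int2_sqr_ge0.
Qed.

Definition fN (l1 l2 : R) g h := l1 * fa g h + l2 * fb g h.

Lemma psform_comb (V : lmodType R) (P : V -> Prop) (B1 B2 : V -> V -> R) (l1 l2 : R) :
  0 <= l1 -> 0 <= l2 -> psform P B1 -> psform P B2 ->
  psform P (fun x y => l1 * B1 x y + l2 * B2 x y).
Proof.
move=> l10 l20 H1 H2; split.
- exact: (ps_lin H1).
- move=> c x y z tx ty tz; rewrite (ps_Blin H1) // (ps_Blin H2) //; ring.
- by move=> x y tx ty; rewrite (ps_sym H1) // (ps_sym H2).
- by move=> x tx; rewrite addr_ge0 // mulr_ge0 //; [exact: ps_ge0 H1 _ tx|exact: ps_ge0 H2 _ tx].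
Qed.

Lemma fN_ps (l1 l2 : R) : 0 <= l1 -> 0 <= l2 -> psform (V := fnt) (@test R) (fN l1 l2).
Proof. by move=> l10 l20; exact: psform_comb l10 l20 fa_ps fb_ps. Qed.

Lemma Dx2_le_fa g : test g -> int2 (fun z => Dx (Dx g) z ^+ 2) <= fa g g.
Proof.
move=> tg; apply: int2_sqr_le; first exact: test_cc (test_Dx (test_Dx tg)).
exact: test_cc (test_Dy tg).
Qed.

Lemma Dy2_le_fa g : test g -> int2 (fun z => Dy g z ^+ 2) <= fa g g.
Proof.
move=> tg; apply: int2_sqr_le'; first exact: test_cc (test_Dx (test_Dx tg)).
exact: test_cc (test_Dy tg).
Qed.

Lemma fbE g : fb g g = int2 (fun z => Dx g z ^+ 2).
Proof. by []. Qed.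

Lemma test_L4 g : test g -> int2 (fun z => Dx g z ^+ 4) <= fa g g * (fb g g + fa g g).
Proof.
move=> tg; have tx := test_Dx tg.
apply: (le_trans (@L4_gen R (Dx g) (Dx (Dx g)) (fa g g) _ _ _ _)).
- exact: test_cc.
- exact: test_cc (test_Dx tx).
- by move=> x y; apply: is_derive_x; exact: tx.1.
- by move=> y; exact: slice_bound.
apply: ler_wpM2l; first exact: ps_ge0 fa_ps _ tg.
by rewrite fbE lerD2l; exact: Dx2_le_fa.
Qed.

Lemma test_holder_x g (h x y : R) : test g -> 0 <= h ->
  (g (x + h, y) - g (x, y)) ^+ 2 <= h * fa g g.
Proof.
move=> tg h0; have tx := test_Dx tg.
apply: (@holder_x_gen R g (Dx g)) => //.
- exact: test_cc.
- exact: test_cc.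
- by move=> x' y'; apply: is_derive_x; exact: tg.1.
- by move=> y'; exact: slice_bound.
Qed.

Lemma test_holder_y g (s x y : R) : test g -> 0 < s ->
  (g (x, y + s ^+ 2) - g (x, y)) ^+ 2 <= 5 * s * fa g g.
Proof.
move=> tg s0; have tx := test_Dx tg.
apply: (@holder_y_gen R g (Dx g) (Dy g) s x y (fa g g) s0).
- exact: test_cc.
- exact: test_cc.
- exact: test_cc (test_Dy tg).
- by move=> x' y'; apply: is_derive_x; exact: tg.1.
- by move=> x' y'; apply: is_derive_y; exact: tg.1.
- by move=> y'; exact: slice_bound.
- exact: Dy2_le_fa.
Qed.

Lemma test_pe g (e : R) : test g -> 0 < e ->
  int2 (fun z => (Dx g z - pe e g z) ^+ 2) <= e ^+ 2 * fa g g.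
Proof.
move=> tg e0; have tx := test_Dx tg.
apply: (le_trans (@pe_L2_gen R g (Dx g) (Dx (Dx g)) e e0 _ _ _ _ _)).
- exact: test_cc.
- exact: test_cc.
- exact: test_cc (test_Dx tx).
- by move=> x' y'; apply: is_derive_x; exact: tg.1.
- by move=> x' y'; apply: is_derive_x; exact: tx.1.
by apply: ler_wpM2l; [exact: sqr_ge0|exact: Dx2_le_fa].
Qed.

Lemma test_diffx g (s : R) : test g -> 0 <= s ->
  int2 (fun z => (g (z.1 + s, z.2) - g z) ^+ 2) <= s ^+ 2 * fb g g.
Proof.
move=> tg s0; have tx := test_Dx tg; rewrite fbE.
apply: diffx_L2_gen => //; [exact: test_cc|exact: test_cc|].
by move=> x' y'; apply: is_derive_x; exact: tg.1.
Qed.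

Lemma int2_aff (t1 s1 t2 s2 : R) h : cc2 h -> 0 < t1 -> 0 < t2 ->
  cc2 (h \o aff t1 s1 t2 s2) /\ int2 h = t1 * t2 * int2 (h \o aff t1 s1 t2 s2).
Proof.
move=> ch t10 t20.
have cc : cc2 (h \o aff t1 s1 t2 s2).
  have [cch [M hM]] := ch; split.
    by move=> z; apply: continuous_comp; [exact: aff_continuous|exact: cch].
  have H (t s x : R) : 0 < t -> (`|M| + `|s|) / t < `|x| -> M < `|t * x + s|.
    move=> t0; rewrite ltr_pdivrMr // => H.
    have := ler_norm M; have := ler_normD (t * x + s) (- s).
    by rewrite addrK normrN normrM (gtr0_norm t0); lra.
  exists (Num.max ((`|M| + `|s1|) / t1) ((`|M| + `|s2|) / t2)) => x y; rewrite !gt_max => xy.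
  by apply: hM => /=; move/orP: xy => [/andP[/(H _ _ _ t10) -> _]|/andP[_ /(H _ _ _ t20) ->]] //; rewrite orbT.
split => //; rewrite (int2_yx cc) (int2_yx ch).
have [c1 ->] := Int1_affine s2 (cc1_Int_x ch) t20.
rewrite [t1 * t2]mulrC -mulrA -(Int1Z t1 (cc1_Int_x cc)).
congr (_ * Int1 _); apply/funext => y.
by have [_ ->] := Int1_affine s1 (cc2_x (t2 * y + s2) ch) t10.
Qed.

Lemma is_derive_affine (t s x : R) : is_derive x (1:R) (fun x => t * x + s) t.
Proof.
rewrite (_ : (fun x => _) = (t *: id + cst s)); last by apply/funext.
apply: (is_derive_eq (is_deriveD (is_deriveZ t (is_derive_id x 1)) (is_derive_cst s x 1))).
by rewrite addr0 scaler1.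
Qed.

Lemma smooth0 : smooth (cst 0 : R * R -> R).
Proof.
have H l : Defs.iterD l (cst 0 : R * R -> R) = cst 0.
  elim: l => //= v l ->; apply/funext => z; exact: derive_cst.
by move=> l; rewrite H; split; [exact: cst_continuous|move=> z v; exact: derivable_cst].
Qed.

Lemma test_scale (c : R) g : test g -> test (fun z => c * g z).
Proof.
move=> tg; have t0 : test (cst 0 : R * R -> R) by split; [exact: smooth0|exists 0].
have := test_lin c tg t0; congr test; apply/funext => z; exact: addr0.
Qed.

Lemma derive_scale (c : R) g v : smooth g ->
  (fun z => 'D_v (fun z => c * g z) z) = (fun z => c * 'D_v g z).
Proof. by move=> sg; apply/funext => z; apply: deriveZ; exact: smooth_derivable. Qed.

Lemma Dx_scale (c : R) g : smooth g -> Dx (fun z => c * g z) = (fun z => c * Dx g z).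
Proof. exact: derive_scale. Qed.

Lemma Dy_scale (c : R) g : smooth g -> Dy (fun z => c * g z) = (fun z => c * Dy g z).
Proof. exact: derive_scale. Qed.

Lemma Dx_aff t1 s1 t2 s2 g : smooth g ->
  Dx (g \o aff t1 s1 t2 s2) = (fun z => t1 * Dx g (aff t1 s1 t2 s2 z)).
Proof.
move=> sg; apply/funext => -[x y].
have d1 := is_derive_x x y (smooth_aff t1 s1 t2 s2 sg).
have d2 := @is_derive1_comp R (fun x => g (x, t2 * y + s2)) (fun x => t1 * x + s1) x _ _ (is_derive_x (t1 * x + s1) (t2 * y + s2) sg) (is_derive_affine t1 s1 x).
rewrite -(@derive_val _ _ _ _ _ _ _ d1) [RHS]mulrC -(@derive_val _ _ _ _ _ _ _ d2).
by [].
Qed.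

Lemma Dy_aff t1 s1 t2 s2 g : smooth g ->
  Dy (g \o aff t1 s1 t2 s2) = (fun z => t2 * Dy g (aff t1 s1 t2 s2 z)).
Proof.
move=> sg; apply/funext => -[x y].
have d1 := is_derive_y x y (smooth_aff t1 s1 t2 s2 sg).
have d2 := @is_derive1_comp R (fun y => g (t1 * x + s1, y)) (fun y => t2 * y + s2) y _ _ (is_derive_y (t1 * x + s1) (t2 * y + s2) sg) (is_derive_affine t2 s2 y).
rewrite -(@derive_val _ _ _ _ _ _ _ d1) [RHS]mulrC -(@derive_val _ _ _ _ _ _ _ d2).
by [].
Qed.

(** With y scaled as the square of x, the terms g_xx and g_y acquire the same factor [c t^2]. So
    [fa] scales by the single factor [c^2 t], and [fb] by [c^2 / t], independent of the former. With
    [t = 1] and [c = 1] or [c = -1] these are translations, up to sign. *)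
Definition dil (c t s1 s2 : R) g : R * R -> R :=
  fun z => c * (g \o aff t s1 (t ^+ 2) s2) z.

Section Dilation.
Variables (c t s1 s2 : R) (g : R * R -> R).
Hypotheses (t0 : 0 < t) (tg : test g).
Let A := aff t s1 (t ^+ 2) s2.
Let t20 : 0 < t ^+ 2. Proof. exact: exprn_gt0. Qed.

Lemma dil_sqr2 (p r : R * R -> R) (k : R) :
  (fun z => (k * (p \o A) z) * (k * (p \o A) z) + (k * (r \o A) z) * (k * (r \o A) z)) =
  (fun z => k ^+ 2 * ((fun z => p z * p z + r z * r z) \o A) z).
Proof. apply/funext => z /=; ring. Qed.

Lemma dil_sqr (p : R * R -> R) (k : R) :
  (fun z => (k * (p \o A) z) * (k * (p \o A) z)) =
  (fun z => k ^+ 2 * ((fun z => p z * p z) \o A) z).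
Proof. apply/funext => z /=; ring. Qed.

Lemma test_dil : test (dil c t s1 s2 g).
Proof. by apply: test_scale; exact: test_aff. Qed.

Lemma Dx_dil : Dx (dil c t s1 s2 g) = (fun z => (c * t) * (Dx g \o A) z).
Proof.
rewrite /dil (Dx_scale c (smooth_aff _ _ _ _ tg.1)) (Dx_aff _ _ _ _ tg.1).
by apply/funext => z; rewrite mulrA.
Qed.

Lemma Dy_dil : Dy (dil c t s1 s2 g) = (fun z => (c * t ^+ 2) * (Dy g \o A) z).
Proof.
rewrite /dil (Dy_scale c (smooth_aff _ _ _ _ tg.1)) (Dy_aff _ _ _ _ tg.1).
by apply/funext => z; rewrite mulrA.
Qed.

Lemma Dxx_dil : Dx (Dx (dil c t s1 s2 g)) = (fun z => (c * t ^+ 2) * (Dx (Dx g) \o A) z).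
Proof.
rewrite Dx_dil (Dx_scale (c * t) (smooth_aff _ _ _ _ (test_Dx tg).1)).
rewrite (Dx_aff _ _ _ _ (test_Dx tg).1).
by apply/funext => z; rewrite mulrA -[c * t * t]mulrA.
Qed.

Lemma int2_dil h : cc2 h -> int2 (h \o A) = (t ^+ 3)^-1 * int2 h.
Proof.
move=> ch; have [_ ->] := int2_aff s1 s2 ch t0 t20.
by rewrite (exprS t 2) mulKf // mulf_neq0 // gt_eqF.
Qed.

Lemma fa_dil : fa (dil c t s1 s2 g) (dil c t s1 s2 g) = c ^+ 2 * t * fa g g.
Proof.
have cf := fa_cc tg tg; have [cA _] := int2_aff s1 s2 cf t0 t20.
rewrite (fa_repr Dxx_dil Dy_dil Dxx_dil Dy_dil).
rewrite (_ : (fun z => _) = (fun z => (c * t ^+ 2) ^+ 2 *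
  ((fun z => Dx (Dx g) z * Dx (Dx g) z + Dy g z * Dy g z) \o A) z)); last first.
  exact: dil_sqr2.
rewrite (int2Z _ (cc2_int cA)) int2_dil // -/(fa g g).
by field; rewrite gt_eqF.
Qed.

Lemma fb_dil : fb (dil c t s1 s2 g) (dil c t s1 s2 g) = c ^+ 2 / t * fb g g.
Proof.
have cf := cc2MM (test_cc (test_Dx tg)) (test_cc (test_Dx tg)).
have [cA _] := int2_aff s1 s2 cf t0 t20.
rewrite (fb_repr Dx_dil Dx_dil).
rewrite (_ : (fun z => _) = (fun z => (c * t) ^+ 2 *
  ((fun z => Dx g z * Dx g z) \o A) z)); last first.
  exact: dil_sqr.
rewrite (int2Z _ (cc2_int cA)) int2_dil // -/(fb g g).
by field; rewrite gt_eqF.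
Qed.

End Dilation.
End TestForms.

(** * Powers and the functional [Phi] *)

Section Powers.
Variable R : realType.

Lemma powR_le (a b r : R) : 0 <= r -> 0 <= a -> a <= b -> a `^ r <= b `^ r.
Proof.
move=> r0 a0 ab; apply: ge0_ler_powR => //; rewrite nnegrE //; exact: le_trans ab.
Qed.

Lemma normpow_continuous (r : R) : 0 < r -> continuous (fun t : R => `|t| `^ r).
Proof.
move=> r0 t; have [->|t0] := eqVneq t 0.
  apply/cvgrPdist_lt => e e0; rewrite normr0 powR0 ?gt_eqF //.
  have d0 : 0 < e `^ r^-1 by rewrite powR_gt0.
  have nb : \forall x \near (0 : R), `|x| < e `^ r^-1 by exact: (@nbhs0_lt _ R^o).
  apply: filterS nb => x xd.
  rewrite sub0r normrN ger0_norm ?powR_ge0 //.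
  have E : (e `^ r^-1) `^ r = e by rewrite -powRrM mulVf ?powRr1 ?gt_eqF // ltW.
  rewrite -[ltRHS]E; apply: gt0_ltr_powR => //; rewrite ?nnegrE ?powR_ge0 //.
have tp : 0 < `|t| by rewrite normr_gt0.
apply: (@continuous_comp _ _ _ (fun x : R => `|x|) (@powR R ^~ r)); first exact: norm_continuous.
apply: differentiable_continuous; apply/derivable1_diffP; apply: derivable_powR.
by rewrite in_itv /= tp.
Unshelve. all: by end_near. Qed.

Variable q : R.
Hypothesis q2 : 2 < q.
Hypothesis q4 : q < 4.

Let q0 : 0 < q. Proof. by apply: lt_trans q2. Qed.

Lemma powR_split (x : R) : 0 <= x -> x `^ q = x `^ (q - 2) * x ^+ 2.
Proof.
move=> x0; rewrite -powR_mulrn // -powRD ?subrK //.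
by apply/implyP => /eqP H; move: q2; lra.
Qed.

Lemma fq_continuous : continuous (fq q).
Proof.
move=> t; apply: (@cvgM R); last exact: cvg_id.
by apply: normpow_continuous; rewrite subr_gt0.
Qed.

Lemma normpow_small (x r : R) : 0 <= x -> x <= r -> x `^ q <= r `^ (q - 2) * x ^+ 2.
Proof.
move=> x0 xr; rewrite powR_split //; apply: ler_wpM2r; first exact: sqr_ge0.
by apply: powR_le => //; rewrite subr_ge0 ltW.
Qed.

Lemma normpow_large (x r : R) : 0 < r -> r^-1 <= x -> x `^ q <= r `^ (4 - q) * x ^+ 4.
Proof.
move=> r0 rx; have x0 : 0 < x by apply: lt_le_trans rx; rewrite invr_gt0.
have -> : x ^+ 4 = x `^ q * x `^ (4 - q).
  rewrite -powRD; last by apply/implyP => _; rewrite gt_eqF.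
  by rewrite addrC subrK powR_mulrn // ltW.
rewrite mulrCA ler_peMr ?powR_ge0 // -powRM; [|exact: ltW|exact: ltW].
have p1 : (1 : R) `^ (4 - q) = 1 by rewrite powR1.
rewrite -[leLHS]p1; apply: powR_le => //; first by rewrite subr_ge0 ltW.
by rewrite -ler_pdivrMl // mulr1.
Qed.

Lemma normE2 (t : R) : t ^+ 2 = `|t| ^+ 2. Proof. by rewrite real_normK ?num_real. Qed.

Lemma normE4 (t : R) : t ^+ 4 = `|t| ^+ 4.
Proof. by rewrite (exprM t 2 2) (exprM `|t| 2 2) -normE2. Qed.

Lemma normpow_le (t : R) : `|t| `^ q <= t ^+ 2 + t ^+ 4.
Proof.
rewrite normE2 normE4; have := normr_ge0 t; move: `|t| => x x0.
have [x1|x1] := leP x 1.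
  apply: (le_trans (normpow_small x0 x1)); rewrite powR1 mul1r lerDl; exact: exprn_ge0.
have := @normpow_large x 1 ltr01; rewrite invr1 => /(_ (ltW x1)) h.
by apply: (le_trans h); rewrite powR1 mul1r lerDr; exact: exprn_ge0.
Qed.

(** Values below [r] are charged to the square and values above [1/r] to the fourth power, with
    small constants because [2 < q < 4]. Between the two, the cube dominates at the price [2/r]. The
    cube is the term that [Phi_interp] can make small. *)
Lemma normpow_interp (eta : R) : 0 < eta -> exists2 C, 0 <= C &
  forall t : R, `|t| `^ q <= eta * (t ^+ 2 + t ^+ 4) + C * `|t| ^+ 3.
Proof.
move=> e0; pose r := Num.min (eta `^ (q - 2)^-1) (eta `^ (4 - q)^-1).
have a0 : 0 < q - 2 by rewrite subr_gt0.
have b0 : 0 < 4 - q by rewrite subr_gt0.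
have r0 : 0 < r by rewrite lt_min !powR_gt0.
have r1 : r `^ (q - 2) <= eta.
  apply: (@le_trans _ _ ((eta `^ (q - 2)^-1) `^ (q - 2))).
    by apply: powR_le; [exact: ltW|exact: ltW|rewrite ge_min lexx].
  by rewrite -powRrM mulVf ?gt_eqF // powRr1 // ltW.
have r2 : r `^ (4 - q) <= eta.
  apply: (@le_trans _ _ ((eta `^ (4 - q)^-1) `^ (4 - q))).
    by apply: powR_le; [exact: ltW|exact: ltW|rewrite ge_min lexx orbT].
  by rewrite -powRrM mulVf ?gt_eqF // powRr1 // ltW.
exists (2 * r^-1); first by rewrite mulr_ge0 // invr_ge0 ltW.
move=> t; have := normpow_le t; rewrite normE2 normE4; have := normr_ge0 t; move: `|t| => x x0 N.
have x2 : 0 <= x ^+ 2 by exact: exprn_ge0.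
have x3 : 0 <= x ^+ 3 by exact: exprn_ge0.
have x4 : 0 <= x ^+ 4 by exact: exprn_ge0.
have ri : 0 < r^-1 by rewrite invr_gt0.
have c3 : 0 <= 2 * r^-1 * x ^+ 3 by rewrite !mulr_ge0 // ltW.
have [x1|x1] := leP x r.
  have := normpow_small x0 x1; have := ler_wpM2r x2 r1; have := mulr_ge0 (ltW e0) x4; lra.
have [y1|y1] := leP r^-1 x.
  have := normpow_large r0 y1; have := ler_wpM2r x4 r2; have := mulr_ge0 (ltW e0) x2; lra.
have xp : 0 < x by lra.
have z1 : x ^+ 4 <= r^-1 * x ^+ 3 by rewrite (exprS x 3) ler_wpM2r // ltW.
have z2 : x ^+ 2 <= r^-1 * x ^+ 3.
  rewrite (exprSr x 2) [x ^+ 2 * x]mulrC mulrA ler_peMl // ler_pdivlMl // mulr1; exact: ltW.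
have := mulr_ge0 (ltW e0) x2; have := mulr_ge0 (ltW e0) x4; lra.
Qed.

(** Either [|b| <= s |a|] or [|a| <= s^-1 |b|], and one term suffices in each case. The constant in
    front of [a] tends to 1 with [s], as the Brezis-Lieb argument requires. *)
Lemma normpow_add (a b s : R) : 0 < s ->
  `|a + b| `^ q <= (1 + s) `^ q * `|a| `^ q + (1 + s^-1) `^ q * `|b| `^ q.
Proof.
move=> s0; have si : 0 < s^-1 by rewrite invr_gt0.
have n0 : 0 <= (1 + s) `^ q * `|a| `^ q by rewrite mulr_ge0 ?powR_ge0.
have n1 : 0 <= (1 + s^-1) `^ q * `|b| `^ q by rewrite mulr_ge0 ?powR_ge0.
have [h|h] := leP `|b| (s * `|a|).
  apply: (@le_trans _ _ ((1 + s) `^ q * `|a| `^ q)); last by rewrite lerDl.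
  rewrite -powRM //; last by rewrite addr_ge0 // ltW.
  apply: powR_le; [exact: ltW|by []|].
  by rewrite mulrDl mul1r (le_trans (ler_normD _ _)) // lerD2l.
apply: (@le_trans _ _ ((1 + s^-1) `^ q * `|b| `^ q)); last by rewrite lerDr.
rewrite -powRM //; last by rewrite addr_ge0 // ltW.
apply: powR_le; [exact: ltW|by []|].
rewrite mulrDl mul1r addrC (le_trans (ler_normD _ _)) // lerD2l ler_pdivlMl //; exact: ltW.
Qed.

(** The bound is uniform in [t]: it is the domination for differentiating [Phi] under the integral
    sign. *)
Lemma fq_bound (a b t : R) : `|t| <= 1 ->
  `|fq q (a + t * b) * b| <= (`|a| + `|b|) `^ q.
Proof.
move=> t1; set x := a + t * b; set y := `|a| + `|b|.
have y0 : 0 <= y by rewrite addr_ge0.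
have xy : `|x| <= y.
  by rewrite (le_trans (ler_normD _ _)) // lerD2l normrM ler_piMl.
have by_ : `|b| <= y by rewrite lerDr.
rewrite normrM /fq normrM (ger0_norm (powR_ge0 _ _)) powR_split // -mulrA.
apply: ler_pM; [exact: powR_ge0|by rewrite mulr_ge0| |by rewrite expr2 ler_pM].
by apply: powR_le => //; rewrite subr_ge0 ltW.
Qed.

Lemma is_derive_normpow (t : R) : is_derive t (1:R) (fun t : R => `|t| `^ q) (q * fq q t).
Proof.
have [->|t0] := eqVneq t 0.
  rewrite /fq mulr0 mulr0.
  have H : (fun h : R => h^-1 *: (((fun t : R => `|t| `^ q) \o shift 0) (h *: (1:R)) - `|0 : R| `^ q)) @ (0:R)^' --> (0:R).
    apply/cvgrPdist_lt => e e0; rewrite normr0 powR0 ?gt_eqF //.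
    near=> h; have h0 : h != 0 by near: h; exact: nbhs_dnbhs_neq.
    rewrite /shift /= addr0 subr0 sub0r normrN /GRing.scale /= mulr1 normrM normfV.
    rewrite (ger0_norm (powR_ge0 _ _)) ltr_pdivrMl ?normr_gt0 //.
    have h1 : `|h| <= 1 by near: h; exact: (@dnbhs0_le _ R^o).
    have h2 : `|h| < e by near: h; exact: (@dnbhs0_lt _ R^o).
    apply: (le_lt_trans (normpow_small (normr_ge0 _) h1)).
    by rewrite powR1 mul1r expr2 ltr_pM2l // normr_gt0.
  by apply: DeriveDef; [apply/cvg_ex; exists 0; exact: H|apply/cvg_lim => //; exact: H].
(* Away from 0 the absolute value is removed by writing the power as [(t^2)^(q/2)]. *)
have E : (fun t : R => `|t| `^ q) = (@powR R ^~ (q / 2)) \o (fun t => t * t).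
  apply/funext => x /=; rewrite -expr2 normE2 -powR_mulrn // -powRrM mulrCA divff ?mulr1 //.
have tp : 0 < t * t by rewrite -expr2 exprn_even_gt0.
have d1 : is_derive (t * t) (1:R) (@powR R ^~ (q / 2)) (q / 2 * (t * t) `^ (q / 2 - 1)).
  have D : derivable (@powR R ^~ (q / 2)) (t * t) 1.
    by apply: derivable_powR; rewrite in_itv /= tp.
  apply: DeriveDef => //; rewrite -derive1E powR_derive1 //.
  by rewrite in_itv /= tp.
have d2 := is_derive_mul (is_derive_id t 1) (is_derive_id t 1).
rewrite E.
apply: (is_derive_eq (@is_derive1_comp R (@powR R ^~ (q / 2)) (fun t => t * t) t _ _ d1 d2)).
rewrite /fq -expr2 normE2 -powR_mulrn // -powRrM.
rewrite (_ : 2 * (q / 2 - 1) = q - 2); last by field.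
by rewrite /GRing.scale /=; field.
Unshelve. all: by end_near. Qed.

Lemma FqE (t : R) : Fq q t = q^-1 * `|t| `^ q.
Proof.
have D (x : R) : is_derive x (1:R) (fun t : R => q^-1 * `|t| `^ q) (fq q x).
  have := is_deriveZ q^-1 (is_derive_normpow x).
  rewrite (_ : q^-1 *: _ = fq q x) //.
  by rewrite /GRing.scale /= mulKf // gt_eqF.
have z0 : q^-1 * `|0 : R| `^ q = 0 by rewrite normr0 powR0 ?mulr0 // gt_eqF.
rewrite /Fq; case: ifPn => [t0|].
  by rewrite (ftc_itv t0 D fq_continuous) z0 subr0.
rewrite -ltNge => t0.
by rewrite (ftc_itv (ltW t0) D fq_continuous) z0 sub0r opprK.
Qed.

End Powers.

(** * The integral of the [q]-th power, and non-vanishing *)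

Section Phi.
Variable R : realType.
Variable q : R.
Hypothesis q2 : 2 < q.
Hypothesis q4 : q < 4.

Definition Phi (u : R * R -> R) : R := int2 (fun z => `|u z| `^ q).

Let q0 : 0 < q. Proof. by apply: lt_trans q2. Qed.

Lemma cc2_normpow (u : R * R -> R) : cc2 u -> cc2 (fun z => `|u z| `^ q).
Proof.
apply: (cc2_comp (normpow_continuous q0)).
by rewrite normr0 powR0 // gt_eqF.
Qed.

Lemma cc2X4 (u : R * R -> R) : cc2 u -> cc2 (fun z => u z ^+ 4).
Proof.
move=> cu; have := cc2X2 (cc2X2 cu); congr cc2; apply/funext => z.
by rewrite -exprM.
Qed.

Lemma Phi_le (u : R * R -> R) : cc2 u ->
  Phi u <= int2 (fun z => u z ^+ 2) + int2 (fun z => u z ^+ 4).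
Proof.
move=> cu; have i2 := cc2_int (cc2X2 cu); have i4 := cc2_int (cc2X4 cu).
rewrite -(int2D i2 i4); apply: le_int2; first exact: cc2_int (cc2_normpow cu).
  exact: cc2_int (cc2D (cc2X2 cu) (cc2X4 cu)).
by move=> z; exact: normpow_le.
Qed.

Lemma Phi_ge0 (u : R * R -> R) : 0 <= Phi u.
Proof. by apply: int2_ge0 => z; exact: powR_ge0. Qed.

(** The cube is estimated by [|u|^3 <= d u^2 + |u - p| u^2] and
    [|u - p| u^2 <= e u^4 + e^-1 (u - p)^2]. The factor [e^-1] is harmless because the L2 error of
    [p] carries [e^2]. *)
Lemma Phi_interp (u p : R * R -> R) (eta Ce d e C : R) : cc2 u -> cc2 p ->
  0 <= eta -> 0 <= Ce -> 0 <= d -> 0 < e ->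
  (forall t : R, `|t| `^ q <= eta * (t ^+ 2 + t ^+ 4) + Ce * `|t| ^+ 3) ->
  (forall z, `|p z| <= d) -> int2 (fun z => u z ^+ 2) <= C ->
  int2 (fun z => u z ^+ 4) <= 2 * C ^+ 2 ->
  int2 (fun z => (u z - p z) ^+ 2) <= e ^+ 2 * C ->
  Phi u <= (eta + Ce * d) * C + (eta + Ce * e) * (2 * C ^+ 2) + Ce * e * C.
Proof.
move=> cu cp eta0 Ce0 d0 e0 H pd u2C u4C upC.
have ei : 0 < e^-1 by rewrite invr_gt0.
have cup := cc2B cu cp.
have c1 := cc2Z (eta + Ce * d) (cc2X2 cu).
have c2 := cc2Z (eta + Ce * e) (cc2X4 cu).
have c3 := cc2Z (Ce * e^-1) (cc2X2 cup).
apply: (@le_trans _ _ (int2 (fun z => (eta + Ce * d) * u z ^+ 2 +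
   (eta + Ce * e) * u z ^+ 4 + (Ce * e^-1) * (u z - p z) ^+ 2))).
  apply: le_int2; first exact: cc2_int (cc2_normpow cu).
    exact: cc2_int (cc2D (cc2D c1 c2) c3).
  move=> z; apply: (le_trans (H (u z))).
  have := pd z; move: (u z) (p z) => s r rd.
  have : `|s| ^+ 3 <= d * s ^+ 2 + (e * s ^+ 4 + e^-1 * (s - r) ^+ 2).
    have n3 : `|s| ^+ 3 = `|s| * s ^+ 2 by rewrite (exprS _ 2) -normE2.
    have n1 : `|s| <= d + `|s - r|.
      by have := ler_normD (s - r) r; rewrite subrK; lra.
    have n2 : `|s - r| * s ^+ 2 <= e * s ^+ 4 + e^-1 * (s - r) ^+ 2.
      have := mulr_ge0 (ltW ei) (sqr_ge0 (e * s ^+ 2 - `|s - r|)).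
      rewrite (normE2 (s - r)) (exprM s 2 2).
      have := mulr_ge0 (normr_ge0 (s - r)) (sqr_ge0 s).
      have : 0 <= e * (s ^+ 2) ^+ 2 by rewrite mulr_ge0 ?sqr_ge0 // ltW.
      have : 0 <= e^-1 * `|s - r| ^+ 2 by rewrite mulr_ge0 ?sqr_ge0 // ltW.
      move: `|s - r| (s ^+ 2) => a b ? ? ?.
      rewrite (_ : e^-1 * (e * b - a) ^+ 2 = e * b ^+ 2 - 2 * (a * b) + e^-1 * a ^+ 2).
        by lra.
      by field; rewrite gt_eqF.
    have := ler_wpM2r (sqr_ge0 s) n1; rewrite n3; lra.
  move=> /(ler_wpM2l Ce0); lra.
rewrite (int2D (cc2_int (cc2D c1 c2)) (cc2_int c3)) (int2D (cc2_int c1) (cc2_int c2)).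
rewrite (int2Z _ (cc2_int (cc2X2 cu))) (int2Z _ (cc2_int (cc2X4 cu))) (int2Z _ (cc2_int (cc2X2 cup))).
have k0 : 0 <= Ce * e^-1 by rewrite mulr_ge0 // ltW.
have := ler_wpM2l k0 upC.
rewrite (_ : Ce * e^-1 * (e ^+ 2 * C) = Ce * e * C); last by field; rewrite gt_eqF.
have k1 : 0 <= eta + Ce * d by rewrite addr_ge0 // mulr_ge0.
have k2 : 0 <= eta + Ce * e by rewrite addr_ge0 // mulr_ge0 // ltW.
have := ler_wpM2l k1 u2C; have := ler_wpM2l k2 u4C; lra.
Qed.

(* If all increments [g(x + e, y) - g(x, y)] are small then [g_x] is close in L2 to a uniformly small
   difference quotient, which makes [Phi (g_x)] small. *)
Lemma nonvanishing (c C : R) : 0 < c -> 0 <= C -> exists e d : R, [/\ 0 < e, 0 < d &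
  forall g, test g -> fa g g <= C -> fb g g <= C -> c <= Phi (Dx g) ->
    exists z, d <= `|g (z.1 + e, z.2) - g z| ].
Proof.
move=> c0 C0; pose B := C + 2 * C ^+ 2.
have B0 : 0 <= B by rewrite addr_ge0 // mulr_ge0 // sqr_ge0.
pose eta := c / (4 * (B + 1)).
have eta0 : 0 < eta by rewrite divr_gt0 // mulr_gt0 // ltr_wpDl.
have [Ce Ce0 H] := normpow_interp q2 q4 eta0.
pose e := c / (8 * ((Ce + 1) * (B + 1))).
have e0 : 0 < e by rewrite divr_gt0 // !mulr_gt0 // ltr_wpDl.
(* If every increment is below [e * e], the quotient of step [e] is bounded by [e]. The constants in
   [eta] and [e] keep each of the two resulting terms below [c / 4]. *)
exists e, (e * e); split => //; first by rewrite mulr_gt0.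
move=> g tg faC fbC Pc; apply: contrapT => /forallNP nz.
have pd z : `|pe e g z| <= e.
  rewrite /pe normrM normfV (gtr0_norm e0) ler_pdivrMr //.
  by rewrite leNgt; apply/negP => /ltW; exact: nz.
have tx := test_Dx tg; have cx := test_cc tx.
have cp : cc2 (pe e g).
  rewrite /pe (_ : (fun z => _) = (fun z => e^-1 * (g (z.1 + e, z.2) - g z))).
    by apply: cc2Z; apply: cc2_diffx; exact: test_cc.
  by apply/funext => z; rewrite mulrC.
have fa0 : 0 <= fa g g := ps_ge0 (fa_ps R) tg.
have fb0 : 0 <= fb g g := ps_ge0 (fb_ps R) tg.
have u4 : int2 (fun z => Dx g z ^+ 4) <= 2 * C ^+ 2.
  apply: (le_trans (test_L4 tg)).
  apply: (@le_trans _ _ (C * (C + C))); last by rewrite expr2 mulrDr; lra.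
  by apply: ler_pM => //; [rewrite addr_ge0|exact: lerD].
have up : int2 (fun z => (Dx g z - pe e g z) ^+ 2) <= e ^+ 2 * C.
  by apply: (le_trans (test_pe tg e0)); apply: ler_wpM2l => //; exact: sqr_ge0.
have := @Phi_interp (Dx g) (pe e g) eta Ce e e C cx cp (ltW eta0) Ce0 (ltW e0) e0 H pd fbC u4 up.
move: (Phi (Dx g)) Pc => P Pc.
have E1 : eta * (4 * (B + 1)) = c by rewrite divfK // gt_eqF // mulr_gt0 // ltr_wpDl.
have E2 : e * (8 * ((Ce + 1) * (B + 1))) = c by rewrite divfK // gt_eqF // !mulr_gt0 // ltr_wpDl.
have k1 : eta * B <= c / 4.
  have : 0 <= eta by exact: ltW.
  lra.
have k2 : Ce * e * (2 * B) <= c / 4.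
  have h1 : 0 <= e * Ce by rewrite mulr_ge0 // ltW.
  have h2 : 0 <= e * B by rewrite mulr_ge0 // ltW.
  have h3 : 0 <= e by exact: ltW.
  have := E2; rewrite (_ : e * _ = 8 * (e * Ce * B) + 8 * (e * Ce) + 8 * (e * B) + 8 * e); last by ring.
  rewrite (_ : Ce * e * (2 * B) = 2 * (e * Ce * B)); last by ring.
  lra.
rewrite (_ : _ + _ + _ = eta * B + Ce * e * (2 * C + 2 * C ^+ 2)); last by rewrite /B; ring.
have k3 : Ce * e * (2 * C + 2 * C ^+ 2) <= Ce * e * (2 * B).
  apply: ler_wpM2l; first by rewrite mulr_ge0 // ltW.
  by rewrite /B; have := sqr_ge0 C; lra.
lra.
Qed.

End Phi.

(** * Compactness almost everywhere *)

Section Compactness.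
Variable R : realType.
Notation mu := (@lebesgue_measure R).
Notation mu2 := ((@lebesgue_measure R \x @lebesgue_measure R)%E).

Definition ae2 (P : R * R -> Prop) : Prop := {ae @leb2 R, forall z, P z}.

Lemma ae2_filter : Filter (almost_everywhere (@leb2 R)).
Proof. exact: (@ae_filter_ringOfSetsType _ _ R (mu \x mu)%E). Qed.

Lemma ae2S (P Q : R * R -> Prop) : (forall z, P z -> Q z) -> ae2 P -> ae2 Q.
Proof. by move=> PQ; apply: (@filterS _ _ ae2_filter). Qed.

Lemma ae2S2 (P Q S : R * R -> Prop) : (forall z, P z -> Q z -> S z) ->
  ae2 P -> ae2 Q -> ae2 S.
Proof. by move=> PQ; apply: (@filterS2 _ _ ae2_filter). Qed.

Lemma ae2T (P : R * R -> Prop) : (forall z, P z) -> ae2 P.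
Proof. by move=> H; apply: (@filterE _ _ ae2_filter). Qed.

Lemma cvg_geometric_increments (u : nat -> R) (M : R) (K : nat) :
  (forall k, (K <= k)%N -> `|u k - u k.+1| <= M * 2^-1 ^+ k) -> cvgn u.
Proof.
move=> H.
have M0 : 0 <= M.
  have := le_trans (normr_ge0 _) (H K (leqnn _)).
  by rewrite pmulr_lge0 // exprn_gt0 // invr_gt0.
have tele k j : (K <= k)%N -> `|u k - u (k + j)%N| <= 2 * M * (2^-1 ^+ k - 2^-1 ^+ (k + j)).
  move=> Kk; elim: j => [|j IH]; first by rewrite addn0 !subrr mulr0 normr0.
  have h := H (k + j)%N (leq_trans Kk (leq_addr _ _)).
  rewrite addnS exprS.
  have := ler_normD (u k - u (k + j)%N) (u (k + j)%N - u (k + j).+1).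
  rewrite addrA subrK; move: IH h; move: (2^-1 ^+ k) (2^-1 ^+ (k + j)) => a b; lra.
apply/cauchy_cvgP; apply: cauchy_exP => e e0.
have [N0 hN] : exists N0, forall k, (N0 <= k)%N -> 2 * M * 2^-1 ^+ k < e.
  have c : (2 * M) * (2^-1 : R) ^+ k @[k --> \oo] --> 2 * M * 0.
    apply: (@cvgM R); first exact: cvg_cst.
    by apply: cvg_expr; rewrite ger0_norm ?invr_ge0 // invf_lt1 // ltr1n.
  rewrite mulr0 in c; move/cvgrPdist_lt : c => /(_ e e0) [N0 _ h].
  exists N0 => k /h /=; rewrite sub0r normrN; apply: le_lt_trans; exact: ler_norm.
exists (u (maxn K N0)); exists (maxn K N0) => // n /= Hn; rewrite /ball /=.
rewrite -(subnKC Hn); apply: (le_lt_trans (tele _ _ (leq_maxl _ _))).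
apply: le_lt_trans (hN _ (leq_maxr K N0)).
by rewrite ler_wpM2l ?mulr_ge0 // gerBl; apply: exprn_ge0; rewrite invr_ge0.
Qed.

Lemma geometric_sum_le (c : R) n : 0 <= c -> \sum_(0 <= k < n) c * 4^-1 ^+ k <= 2 * c.
Proof.
move=> c0; suff : \sum_(0 <= k < n) c * 4^-1 ^+ k <= 2 * c - 2 * c * 4^-1 ^+ n.
  have : 0 <= 2 * c * 4^-1 ^+ n by rewrite !mulr_ge0 // exprn_ge0 // invr_ge0.
  lra.
elim: n => [|n IH]; first by rewrite big_geq // expr0 mulr1 subrr.
rewrite big_nat_recr //= exprS.
have : 0 <= c * 4^-1 ^+ n by rewrite mulr_ge0 // exprn_ge0 // invr_ge0.
move: IH; move: (\sum_(0 <= k < n) _) => s; move: (4^-1 ^+ n) => b; lra.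
Qed.

(** The series of the [f k] has a finite integral by monotone convergence, hence is finite almost
    everywhere and bounds each of its terms. *)
Lemma ae_summable (f : nat -> R * R -> R) (C : R) : 0 <= C ->
  (forall k, cc2 (f k)) -> (forall k z, 0 <= f k z) ->
  (forall k, int2 (f k) <= C * 4^-1 ^+ k) ->
  ae2 (fun z => exists M : R, forall k, f k z <= M).
Proof.
move=> C0 cf f0 fC.
pose F z := (\sum_(0 <= k <oo) (f k z)%:E)%E.
have mf k : measurable_fun setT (EFin \o f k).
  by apply/measurable_EFinP; apply: continuous_measurable2; exact: (cf k).1.
have f0' k z : [set: R * R] z -> (0 <= (EFin \o f k) z)%E by move=> _; rewrite lee_fin.
have IF : (\int[mu2]_z F z)%E = (\sum_(0 <= k <oo) \int[mu2]_z (EFin \o f k) z)%E.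
  exact: (integral_nneseries mu2 measurableT mf f0').
have I0 k : (0 <= \int[mu2]_z (EFin \o f k) z)%E by apply: integral_ge0 => z _; rewrite lee_fin.
have Ilt : (\int[mu2]_z F z <= (2 * C)%:E)%E.
  rewrite IF; apply: lime_le.
    by apply: is_cvg_nneseries => k _ _; exact: I0.
  apply: nearW => n; apply: (@le_trans _ _ (\sum_(0 <= k < n) C * 4^-1 ^+ k)%:E); last first.
    by rewrite lee_fin geometric_sum_le.
  rewrite -sumEFin; apply: lee_sum => k _.
  rewrite (_ : (\int[mu2]_z (EFin \o f k) z)%E = (int2 (f k))%:E); first by rewrite lee_fin.
  exact: int2_EFin (cc2_int (cf k)).
have mF : measurable_fun setT F.
  by apply: ge0_emeasurable_sum => [k z _ _|k _]; [rewrite lee_fin|exact: mf].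
have F0 z : (0 <= F z)%E by apply: nneseries_ge0 => k _ _; rewrite lee_fin.
have iF : mu2.-integrable setT F.
  apply/integrableP; split => //.
  rewrite (_ : (\int[mu2]_z `|F z|)%E = (\int[mu2]_z F z)%E).
    by apply: le_lt_trans Ilt _; rewrite ltry.
  by apply: eq_integral => z _; rewrite gee0_abs.
have : ae2 (fun z => [set: R * R] z -> F z \is a fin_num) by exact: (integrable_ae measurableT iF).
apply: ae2S => z /(_ I) Fz.
exists (fine (F z)) => k; rewrite -lee_fin fineK //.
have := @nneseries_lim_ge R (fun k => (f k z)%:E) xpredT 0 k.+1 (fun n _ _ => f0 n z).
apply: le_trans; rewrite big_nat_recr //=; apply: leeDr.
by apply: sume_ge0 => n _; rewrite lee_fin.
Qed.

(** [u k] and [u k.+1] are compared through [p k] and [p' k]. The squared errors multiplied by [4^k]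
    still have integrals of order [4^-k], so [ae_summable] bounds the errors at almost every point
    by a multiple of [2^-k], and the increments of [u] become geometric. *)
Lemma ae_cvg_fast (u p p' : nat -> R * R -> R) (C : R) : 0 <= C ->
  (forall k, cc2 (u k)) -> (forall k, cc2 (p k)) -> (forall k, cc2 (p' k)) ->
  (forall k, int2 (fun z => (u k z - p k z) ^+ 2) <= C * 16^-1 ^+ k) ->
  (forall k, int2 (fun z => (u k.+1 z - p' k z) ^+ 2) <= C * 16^-1 ^+ k) ->
  (forall z, exists K, forall k, (K <= k)%N -> `|p k z - p' k z| <= 2^-1 ^+ k) ->
  ae2 (fun z => cvgn (fun k => u k z)).
Proof.
move=> C0 cu cp cp' H1 H2 H3.
pose f k z := 4 ^+ k * ((u k z - p k z) ^+ 2 + (u k.+1 z - p' k z) ^+ 2).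
have c1 k := cc2X2 (cc2B (cu k) (cp k)); have c2 k := cc2X2 (cc2B (cu k.+1) (cp' k)).
have p4 k : 0 < 4 ^+ k :> R by rewrite exprn_gt0.
have C2 : 0 <= 2 * C by rewrite mulr_ge0.
have cf k : cc2 (f k) by apply: cc2Z; exact: cc2D.
have f0 k z : 0 <= f k z by rewrite mulr_ge0 ?addr_ge0 ?sqr_ge0 // ltW.
have fI k : int2 (f k) <= 2 * C * 4^-1 ^+ k.
  rewrite /f (int2Z _ (cc2_int (cc2D (c1 k) (c2 k)))) (int2D (cc2_int (c1 k)) (cc2_int (c2 k))).
  have E : (4^-1 : R) ^+ k = 4 ^+ k * 16^-1 ^+ k by rewrite -exprMn; congr (_ ^+ _); field.
  rewrite E (_ : 2 * C * _ = 4 ^+ k * (C * 16^-1 ^+ k + C * 16^-1 ^+ k)); last by ring.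
  by rewrite ler_pM2l // lerD.
have := ae_summable C2 cf f0 fI.
apply: ae2S => z [M fM].
have [K HK] := H3 z.
apply: (@cvg_geometric_increments _ (2 * Num.sqrt M + 1) K) => k Kk.
have M0 : 0 <= M.
  by apply: le_trans (fM 0%N); rewrite mulr_ge0 ?addr_ge0 ?sqr_ge0 // ltW.
have two : (2^-1 : R) ^+ k * 2^-1 ^+ k * 4 ^+ k = 1.
  by rewrite -!exprMn (_ : 2^-1 * 2^-1 * 4 = 1) ?expr1n //; field.
have i0 : 0 < 2^-1 ^+ k :> R by rewrite exprn_gt0 // invr_gt0.
have bd x : x ^+ 2 * 4 ^+ k <= M -> `|x| <= Num.sqrt M * 2^-1 ^+ k.
  move=> h; rewrite -sqrtr_sqr -[X in _ * X]ger0_norm ?(ltW i0) // -sqrtr_sqr -sqrtrM //.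
  rewrite ler_sqrt ?mulr_ge0 ?sqr_ge0 //.
  apply: (@le_trans _ _ (x ^+ 2 * 4 ^+ k * 2^-1 ^+ k ^+ 2)).
    by rewrite -mulrA [4 ^+ k * _]mulrC (expr2 (2^-1 ^+ k)) two mulr1.
  by rewrite ler_wpM2r // sqr_ge0.
have := fM k; rewrite /f mulrDr ![4 ^+ k * _]mulrC => fk.
have a0 := mulr_ge0 (sqr_ge0 (u k z - p k z)) (ltW (p4 k)).
have b0 := mulr_ge0 (sqr_ge0 (u k.+1 z - p' k z)) (ltW (p4 k)).
have h1 : `|u k z - p k z| <= Num.sqrt M * 2^-1 ^+ k by apply: bd; lra.
have h2 : `|u k.+1 z - p' k z| <= Num.sqrt M * 2^-1 ^+ k by apply: bd; lra.
have h3 := HK k Kk.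
have := ler_normD (u k z - p k z) (p k z - p' k z).
have := ler_normD (u k z - p' k z) (p' k z - u k.+1 z).
rewrite !addrA !subrK [`|p' k z - _|]distrC mulrDl mul1r.
move: h1 h2 h3; move: (Num.sqrt M * 2^-1 ^+ k) (2^-1 ^+ k) => a b; lra.
Qed.

(** An ultrafilter assigns a limit to all bounded sequences at once, here at every point of the
    plane, which replaces diagonal extraction. The limit is the supremum of the levels exceeded on a
    set of [U]. *)
Lemma ultra_lim (U : set_system nat) (f : nat -> R) (M : R) : UltraFilter U ->
  (forall n, `|f n| <= M) ->
  exists L, forall d, 0 < d -> U [set n | `|f n - L| <= d].
Proof.
move=> uU fM; have pU := ultra_proper (F := U).
pose A := [set x | U [set n | x <= f n]].
have hA : has_sup A.
  split.
    exists (- M); rewrite /A /=; apply: filterE => n.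
    by have := fM n; rewrite ler_norml => /andP[].
  exists M => x; rewrite /A /= => /filter_ex [n /= xn].
  by apply: (le_trans xn); apply: (le_trans (ler_norm _)); exact: fM.
exists (sup A) => d d0.
have [x Ax xd] := sup_adherent d0 hA.
have Uc : U (~` [set n | sup A + d <= f n]).
  case: (in_ultra_setVsetC [set n | sup A + d <= f n] uU) => // H.
  by have := ub_le_sup hA.2 H; rewrite gerDl leNgt d0.
apply: filterS2 Ax Uc => n /= xn /negP; rewrite -ltNge => nd.
by rewrite ler_norml; apply/andP; split; lra.
Qed.

(** The square of the Hoelder modulus per unit of energy. The factor 2 comes from splitting an
    increment into its x and y parts, the term [5 * sqrt] from [test_holder_y] with [s] the root of
    the height. *)
Definition modulus (z z' : R * R) : R :=
  2 * (`|z.1 - z'.1| + 5 * Num.sqrt `|z.2 - z'.2|).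

Lemma modulus_ge0 z z' : 0 <= modulus z z'.
Proof. by rewrite /modulus mulr_ge0 // addr_ge0 // mulr_ge0 // sqrtr_ge0. Qed.

Lemma test_modulus g (C : R) z z' : test g -> fa g g <= C ->
  (g z - g z') ^+ 2 <= modulus z z' * C.
Proof.
move=> tg gC; have fa0 : 0 <= fa g g := ps_ge0 (fa_ps R) tg.
have C0 := le_trans fa0 gC.
have hx x x' y : (g (x, y) - g (x', y)) ^+ 2 <= `|x - x'| * C.
  wlog le : x x' / x' <= x.
    move=> W; case/orP: (le_total x' x) => h; first exact: W.
    by rewrite -sqrrN opprB distrC; exact: W.
  have h0 : 0 <= x - x' by rewrite subr_ge0.
  have := @test_holder_x R g (x - x') x' y tg h0; rewrite (_ : x' + (x - x') = x) ?(ger0_norm h0); last by ring.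
  move=> H.
  by apply: (le_trans H); rewrite ler_wpM2l.
have hy x y y' : (g (x, y) - g (x, y')) ^+ 2 <= 5 * Num.sqrt `|y - y'| * C.
  wlog le : y y' / y' <= y.
    move=> W; case/orP: (le_total y' y) => h; first exact: W.
    by rewrite -sqrrN opprB distrC; exact: W.
  have [->|ne] := eqVneq y y'.
    by rewrite !subrr normr0 sqrtr0 mulr0 mul0r expr2 mul0r.
  have h0 : 0 < y - y' by rewrite subr_gt0 lt_neqAle eq_sym ne le.
  have s0 : 0 < Num.sqrt (y - y') by rewrite sqrtr_gt0.
  have := @test_holder_y R g (Num.sqrt (y - y')) x y' tg s0.
  rewrite sqr_sqrtr ?(ltW h0) // (_ : y' + (y - y') = y); last by ring.
  rewrite (gtr0_norm h0) => H.
  by apply: (le_trans H); rewrite ler_wpM2l // mulr_ge0 // ltW.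
case: z z' => x y [x' y']; have := hx x x' y; have := hy x' y y'; rewrite /modulus /=.
move: (g (x, y)) (g (x', y)) (g (x', y')) => a b c h1 h2.
have := sqr_ge0 ((a - b) - (b - c)); nra.
Qed.

Lemma modulus_cvg0 (z : R * R) (e : R) : 0 < e -> \forall w \near z, modulus w z <= e.
Proof.
move=> e0; pose r := Num.min (e / 4) ((e / 20) ^+ 2).
have r0 : 0 < r by rewrite lt_min exprn_gt0 ?divr_gt0.
exists (ball z.1 r, ball z.2 r).
  by split; exact: nbhsx_ballx.
move=> w [/= b1 b2]; move: b1 b2; rewrite /ball /= => b1 b2.
rewrite /modulus (distrC w.1) (distrC w.2).
have h1 : `|z.1 - w.1| <= e / 4 by apply: le_trans (ltW b1) _; rewrite ge_min lexx.
have h2 : Num.sqrt `|z.2 - w.2| <= e / 20.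
  have <- : Num.sqrt ((e / 20) ^+ 2) = e / 20.
    by rewrite sqrtr_sqr ger0_norm // divr_ge0 // ltW.
  rewrite ler_sqrt ?sqr_ge0 //.
  by apply: le_trans (ltW b2) _; rewrite ge_min lexx orbT.
lra.
Qed.
End Compactness.

(** * Arzela-Ascoli along an ultrafilter, and almost everywhere convergence of the derivatives *)

Section LocalCompactness.
Variable R : realType.
Variables (G : nat -> R * R -> R) (C : R).
Hypothesis tG : forall n, test (G n).
Hypothesis GC : forall n, fa (G n) (G n) <= C.

Let C0 : 0 <= C.
Proof. by apply: le_trans (GC 0%N); exact: (ps_ge0 (fa_ps R)). Qed.

(** The energy controls only increments of [G n], so values are normalised at the origin; difference
    quotients do not see the constant. *)
Let H n z := G n z - G n (0, 0).

Let Hmod n z z' : (H n z - H n z') ^+ 2 <= modulus z z' * C.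
Proof.
have := test_modulus z z' (tG n) (GC n); congr (_ <= _).
by rewrite /H; congr (_ ^+ 2); ring.
Qed.

Let Hbound n z : `|H n z| <= Num.sqrt (modulus z (0, 0) * C).
Proof.
rewrite -sqrtr_sqr ler_sqrt; last by rewrite mulr_ge0 // modulus_ge0.
exact: test_modulus (tG n) (GC n).
Qed.

Lemma uniform_ultralimit (U : set_system nat) : UltraFilter U ->
  exists L : R * R -> R, forall K : set (R * R), compact K -> forall d, 0 < d ->
    U [set n | forall z, K z -> `|H n z - L z| <= d].
Proof.
move=> uU; have pU := ultra_proper (F := U).
have /choice[L LP] : forall z, exists l, forall d, 0 < d -> U [set n | `|H n z - l| <= d].
  by move=> z; apply: ultra_lim => n; exact: Hbound.
exists L => K /compact_near_coveringP cK d d0.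
pose e := (d / 8) ^+ 2 / (C + 1).
have d8 : 0 < d / 8 by rewrite divr_gt0.
have e0 : 0 < e by rewrite divr_gt0 ?exprn_gt0 // ltr_wpDl.
have eC : e * C <= (d / 8) ^+ 2.
  rewrite /e -mulrA ger_pMr ?exprn_gt0 // ler_pdivrMl ?ltr_wpDl //; lra.
have close n z x : modulus z x <= e -> `|H n z - H n x| <= d / 8.
  move=> m; have <- : Num.sqrt ((d / 8) ^+ 2) = d / 8.
    by rewrite sqrtr_sqr ger0_norm // ltW.
  rewrite -sqrtr_sqr ler_sqrt ?sqr_ge0 //.
  apply: (le_trans (Hmod n z x)); apply: le_trans eC; exact: ler_wpM2r.
have fU : Filter U by exact: pU.
apply: (cK nat U (fun n z => `|H n z - L z| <= d) fU) => x Kx.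
exists ([set z | modulus z x <= e], [set n | `|H n x - L x| <= d / 4]).
  split; first exact: modulus_cvg0.
  by apply: LP; rewrite divr_gt0.
move=> [z n] [/= mzx nx].
(* The auxiliary index [n'] may depend on [z]: it serves only to transfer the common modulus of
   continuity to [L]. *)
have [n' [/= h1 h2]] := filter_ex (filterI (LP x _ d8) (LP z _ d8)).
have h3 := close n z x mzx; have h4 := close n' z x mzx.
move: h1 h2 h3 h4 nx; rewrite !ler_norml.
by move=> /andP[? ?] /andP[? ?] /andP[? ?] /andP[? ?] /andP[? ?]; apply/andP; split; lra.
Qed.

(** Uniform convergence of the primitives says nothing directly about g_x. It does control
    difference quotients, and [test_pe] says that these are close to g_x in L2; the rates are chosen
    so that both errors are summable. *)
Lemma local_compactness : exists phi : nat -> nat, (forall k, (k <= phi k)%N) /\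
  ae2 (fun z => cvgn (fun k => Dx (G (phi k)) z)).
Proof.
have [U [uU sU]] := ultraFilterLemma (eventually_filter : ProperFilter (@eventually)).
have pU := ultra_proper (F := U).
have [L LP] := uniform_ultralimit uU.
(* The radius is [k + 1] so that, for large [k], the square contains a given point and also its
   shift by [e k <= 1]. *)
pose K (k : nat) : set (R * R) := `[- k.+1%:R, k.+1%:R] `*` `[- k.+1%:R, k.+1%:R].
have cK k : compact (K k) by apply: compact_setX; exact: segment_compact.
have i8 k : 0 < (8^-1 : R) ^+ k / 4 by rewrite divr_gt0 // exprn_gt0 // invr_gt0.
pose E k := [set n | forall z, K k z -> `|H n z - L z| <= 8^-1 ^+ k / 4].
(* All [E i] with [i <= k] are imposed, so that [phi k] and [phi k.+1] can be compared on the same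
   square [K k]. *)
have UE k : U [set n | forall i, (i <= k)%N -> E i n].
  elim: k => [|k IH].
    by apply: filterS (LP _ (cK 0%N) _ (i8 0%N)) => n En i; rewrite leqn0 => /eqP ->.
  apply: filterS2 IH (LP _ (cK k.+1) _ (i8 k.+1)) => n h1 h2 i.
  by rewrite leq_eqVlt => /predU1P[->//|]; rewrite ltnS; exact: h1.
have /choice[phi phiP] : forall k, exists n, (k <= n)%N /\ forall i, (i <= k)%N -> E i n.
  move=> k; have Uk : U [set n | (k <= n)%N] by apply: sU; exists k.
  by have [n [h1 h2]] := filter_ex (filterI Uk (UE k)); exists n.
exists phi; split; first by move=> k; exact: (phiP k).1.
(* With this step the squared L2 error is at most [C * 16^-k], and four deviations of [8^-k / 4],
   divided by [4^-k], amount to [2^-k]. *)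
pose e k : R := 4^-1 ^+ k.
have e0 k : 0 < e k by rewrite exprn_gt0 // invr_gt0.
have e1 k : e k <= 1 by rewrite exprn_ile1 // ?invr_ge0 // invf_le1 // ler1n.
have cpe k g : test g -> cc2 (pe (e k) g).
  move=> tg; rewrite /pe (_ : (fun z => _) = (fun z => (e k)^-1 * (g (z.1 + e k, z.2) - g z))).
    by apply: cc2Z; apply: cc2_diffx; exact: test_cc.
  by apply/funext => z; rewrite mulrC.
have e16 k : e k ^+ 2 = 16^-1 ^+ k.
  by rewrite /e -exprM mulnC exprM; congr (_ ^+ _); field.
have pI k g : test g -> fa g g <= C -> int2 (fun z => (Dx g z - pe (e k) g z) ^+ 2) <= C * 16^-1 ^+ k.
  move=> tg gC; apply: (le_trans (test_pe tg (e0 k))).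
  by rewrite -e16 mulrC; apply: ler_wpM2r => //; exact: sqr_ge0.
apply: (@ae_cvg_fast R (fun k => Dx (G (phi k))) (fun k => pe (e k) (G (phi k)))
   (fun k => pe (e k) (G (phi k.+1))) C C0).
- by move=> k; exact: test_cc (test_Dx (tG _)).
- by move=> k; exact: cpe.
- by move=> k; exact: cpe.
- by move=> k; exact: pI.
- by move=> k; exact: pI.
move=> [x y].
have [N hN] : exists N : nat, `|x| <= N%:R /\ `|y| <= N%:R.
  exists (maxn (Num.truncn `|x|).+1 (Num.truncn `|y|).+1).
  split; [apply: le_trans (ltW (Num.Theory.truncnS_gt `|x|)) _|apply: le_trans (ltW (Num.Theory.truncnS_gt `|y|)) _].
    by rewrite ler_nat leq_maxl.
  by rewrite ler_nat leq_maxr.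
exists N => k Nk.
have xk : `|x| <= k%:R by apply: (le_trans hN.1); rewrite ler_nat.
have yk : `|y| <= k%:R by apply: (le_trans hN.2); rewrite ler_nat.
have k1 : k.+1%:R = k%:R + 1 :> R by rewrite -natr1.
have K1 : K k (x, y).
  split; rewrite /= in_itv /= -ler_norml k1; [move: xk|move: yk]; lra.
have K2 : K k (x + e k, y).
  split; rewrite /= in_itv /= -ler_norml k1; last by move: yk; lra.
  apply: (le_trans (ler_normD _ _)); rewrite (ger0_norm (ltW (e0 k))).
  by apply: lerD.
have F1 z : K k z -> `|H (phi k) z - L z| <= 8^-1 ^+ k / 4 := (phiP k).2 k (leqnn _) z.
have F2 z : K k z -> `|H (phi k.+1) z - L z| <= 8^-1 ^+ k / 4 := (phiP k.+1).2 k (leqnSn _) z.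
have := F1 _ K1; have := F1 _ K2; have := F2 _ K1; have := F2 _ K2.
rewrite /pe /= -mulrBl normrM normfV (gtr0_norm (e0 k)) ler_pdivrMr //.
have -> : 2^-1 ^+ k * e k = 8^-1 ^+ k by rewrite /e -exprMn; congr (_ ^+ _); field.
rewrite /H.
move: (G (phi k) (x, y)) (G (phi k) (x + e k, y)) (G (phi k.+1) (x, y)) (G (phi k.+1) (x + e k, y)).
move: (G (phi k) (0, 0)) (G (phi k.+1) (0, 0)) (L (x, y)) (L (x + e k, y)) (8^-1 ^+ k).
move=> a b l l' d g1 g2 g3 g4; rewrite !ler_norml.
by move=> /andP[? ?] /andP[? ?] /andP[? ?] /andP[? ?]; apply/andP; split; lra.
Qed.
End LocalCompactness.

(** * Measurable limits, Fatou and dominated convergence on the plane *)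

Section MeasureTools.
Variable R : realType.
Notation mu := (@lebesgue_measure R).
Notation mu2 := ((@lebesgue_measure R \x @lebesgue_measure R)%E).
Implicit Types (u h w : R * R -> R).

Definition meas2 h : Prop := measurable_fun setT h.
Definition intg2 h : Prop := mu2.-integrable setT (EFin \o h).

Lemma intg2_meas h : intg2 h -> meas2 h.
Proof. by move=> /integrableP[/measurable_EFinP]. Qed.

Lemma cc2_meas h : cc2 h -> meas2 h.
Proof. by move=> [ch _]; exact: continuous_measurable2. Qed.

Lemma meas2_comp (F : R -> R) u : continuous F -> meas2 u -> meas2 (fun z => F (u z)).
Proof.
by move=> cF mu_; apply: (measurableT_comp (f := F)) => //; exact: continuous_measurable_fun.
Qed.

Lemma meas2D u h : meas2 u -> meas2 h -> meas2 (fun z => u z + h z).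
Proof. exact: measurable_funD. Qed.

Lemma meas2B u h : meas2 u -> meas2 h -> meas2 (fun z => u z - h z).
Proof. exact: measurable_funB. Qed.

Lemma meas2M u h : meas2 u -> meas2 h -> meas2 (fun z => u z * h z).
Proof. exact: measurable_funM. Qed.

Lemma meas2_cst (c : R) : meas2 (fun=> c).
Proof. exact: measurable_cst. Qed.

Lemma meas2Z (c : R) u : meas2 u -> meas2 (fun z => c * u z).
Proof. by move=> mu_; apply: meas2M => //; exact: meas2_cst. Qed.

Lemma intg2_le h g : meas2 h -> intg2 g -> (forall z, `|h z| <= g z) -> intg2 h.
Proof.
move=> mh ig hg; apply: (le_integrable measurableT _ _ ig).
  exact/measurable_EFinP.
by move=> z _ /=; rewrite lee_fin (le_trans (hg z)) // ler_norm.
Qed.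

Lemma intg2D u h : intg2 u -> intg2 h -> intg2 (fun z => u z + h z).
Proof. by move=> iu ih; exact: (integrableD measurableT iu ih). Qed.

Lemma intg2Z (c : R) u : intg2 u -> intg2 (fun z => c * u z).
Proof. by move=> iu; exact: (integrableZl measurableT c iu). Qed.

Lemma ae2_null (P : R * R -> Prop) : ae2 P ->
  exists N : set (R * R), [/\ measurable N, mu2 N = 0 & forall z, ~ N z -> P z].
Proof.
move=> [N [mN N0 PN]]; exists N; split => // z nN; apply: contrapT => nP.
by apply: nN; apply: PN.
Qed.

(** An almost everywhere limit need not be measurable for the product sigma-algebra. Cutting the
    sequence off on a measurable null set makes it converge everywhere, to a measurable function. *)
Lemma ae2_cvg_measurable (u : nat -> R * R -> R) : (forall k, meas2 (u k)) ->
  ae2 (fun z => cvgn (fun k => u k z)) ->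
  exists2 w, meas2 w & ae2 (fun z => u k z @[k --> \oo] --> w z).
Proof.
move=> mu_ au; have [N [mN N0 HN]] := ae2_null au.
pose w z := lim (u k z @[k --> \oo]) * \1_(~` N) z.
have mC : measurable (~` N) by exact: measurableC.
have conv z : u k z * \1_(~` N) z @[k --> \oo] --> w z.
  rewrite /w indicE; have [zN|zN] := boolP (z \in ~` N).
    apply: (@cvgM R); last exact: cvg_cst.
    by apply: HN; move: zN; rewrite inE.
  by rewrite mulr0; under eq_fun do rewrite mulr0; exact: cvg_cst.
exists w.
  apply: (@measurable_fun_cvg _ _ _ setT (fun k z => u k z * \1_(~` N) z)) => //.
  move=> k; apply: meas2M; first exact: mu_.
  exact: measurable_indic.
exists N; split => // z /= nz; apply: contrapT => zN; apply: nz.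
have := conv z; rewrite indicE mem_set //.
by under eq_fun do rewrite mulr1.
Qed.

Lemma fatou2 (h : nat -> R * R -> R) (g : R * R -> R) (c : R) (M : nat) :
  (forall m, intg2 (h m)) -> (forall m z, 0 <= h m z) ->
  meas2 g -> (forall z, 0 <= g z) ->
  ae2 (fun z => h m z @[m --> \oo] --> g z) ->
  (forall m, (M <= m)%N -> int2 (h m) <= c) ->
  intg2 g /\ int2 g <= c.
Proof.
move=> ih h0 mg g0 hg hc; have [N [mN N0 HN]] := ae2_null hg.
have mC : measurable (~` N) by exact: measurableC.
pose i1 z : R := \1_(~` N) z.
have i01 z : 0 <= i1 z <= 1 by rewrite /i1 indicE; case: (_ \in _); rewrite ?lexx ?ler01.
have mi1 : meas2 i1 by exact: measurable_indic.
(* The shift by [M] makes the bound on the integrals hold from the first index, and the indicator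
   makes convergence hold at every point. *)
pose f m z : \bar R := (h (m + M)%N z * i1 z)%:E.
have mf m : measurable_fun setT (f m).
  by apply/measurable_EFinP; apply: meas2M => //; exact: intg2_meas.
have f0 m z : [set: R * R] z -> (0 <= f m z)%E.
  by move=> _; rewrite lee_fin mulr_ge0 //; have /andP[] := i01 z.
have F := fatou mu2 measurableT mf f0.
have mg' : measurable_fun setT (EFin \o g) by exact/measurable_EFinP.
have mgi : measurable_fun setT (EFin \o (fun z => g z * i1 z)).
  by apply/measurable_EFinP; exact: meas2M.
have lim_f z : limn_einf (f^~ z) = (g z * i1 z)%:E.
  have : (f^~ z) m @[m --> \oo] --> (g z * i1 z)%:E.
    have H : h (m + M)%N z * i1 z @[m --> \oo] --> g z * i1 z.
      have [zN|zN] := boolP (z \in ~` N).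
        apply: (@cvgM R); last exact: cvg_cst.
        have := HN z; rewrite inE in zN => /(_ zN) => hz.
        by apply: (@cvg_comp _ _ _ (fun m => (m + M)%N) (fun m => h m z)) hz; exact: cvg_addnr.
      have -> : i1 z = 0 by rewrite /i1 indicE (negbTE zN).
      by rewrite mulr0; under eq_fun do rewrite mulr0; exact: cvg_cst.
    by apply: cvg_EFin; [exact: nearW|exact: H].
  by case/cvg_limn_einf_sup.
have le0 : (\int[mu2]_z (g z * i1 z)%:E <= c%:E)%E.
  under eq_integral do rewrite -lim_f.
  apply: (le_trans F); rewrite limn_einf_lim; apply: lime_le.
    exact: is_cvg_einfs.
  apply: nearW => m; apply: (@le_trans _ _ (\int[mu2]_z f m z)%E).
    by apply: ereal_inf_lbound; exists m => /=.
  apply: (@le_trans _ _ (int2 (h (m + M)%N))%:E); last by rewrite lee_fin hc // leq_addl.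
  rewrite -(int2_EFin (ih _)); apply: ge0_le_integral.
  - exact: measurableT.
  - by move=> z; exact: f0.
  - exact: mf.
  - by apply/measurable_EFinP; exact: intg2_meas.
  - by move=> z _; rewrite lee_fin ler_piMr //; have /andP[] := i01 z.
have eqg : (\int[mu2]_z (g z)%:E = \int[mu2]_z (g z * i1 z)%:E)%E.
  apply: ge0_ae_eq_integral.
  - exact: measurableT.
  - exact: mg'.
  - exact: mgi.
  - by move=> z _; rewrite lee_fin.
  - by move=> z _; rewrite lee_fin mulr_ge0 //; have /andP[] := i01 z.
  - exists N; split => // z /= nz; apply: contrapT => zN; apply: nz => _.
    by rewrite /i1 indicE mem_set // mulr1.
have le1 : (\int[mu2]_z (g z)%:E <= c%:E)%E by rewrite eqg.
split.
  apply/integrableP; split; first exact: mg'.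
  rewrite (_ : (\int[mu2]_z `|(EFin \o g) z|)%E = (\int[mu2]_z (g z)%:E)%E).
    by apply: (le_lt_trans le1); rewrite ltry.
  by apply: eq_integral => z _; rewrite /= ger0_norm.
rewrite int2_fine -lee_fin fineK; first exact: le1.
rewrite ge0_fin_numE; first by apply: (le_lt_trans le1); rewrite ltry.
by apply: integral_ge0 => z _; rewrite lee_fin.
Qed.

Lemma dct2 (W : nat -> R * R -> R) (g : R * R -> R) :
  (forall n, meas2 (W n)) -> intg2 g -> (forall n z, `|W n z| <= g z) ->
  ae2 (fun z => W n z @[n --> \oo] --> (0 : R)) ->
  forall e, 0 < e -> exists N, forall n, (N <= n)%N -> int2 (W n) <= e.
Proof.
move=> mW ig Wg W0 e e0.
have mf n : measurable_fun setT (EFin \o W n).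
  by apply/measurable_EFinP; exact: mW.
have H : {ae mu2, forall z, [set: R * R] z -> (EFin \o W n) z @[n --> \oo] --> (cst 0 z : \bar R)}.
  apply: ae2S W0 => z Wz _; apply: cvg_EFin => //; exact: nearW.
have B : {ae mu2, forall z, forall n, [set: R * R] z -> (`|(EFin \o W n) z| <= (EFin \o g) z)%E}.
  by apply: ae2T => z n _; rewrite lee_fin.
have [_ _ C] := @dominated_convergence _ _ _ mu2 setT measurableT (fun n => EFin \o W n) (cst 0%E) (EFin \o g) mf (@measurable_cst _ _ _ _ _ _) H ig B.
rewrite integral_cst // mul0e in C.
move: C => /fine_cvgP[_ /cvgrPdist_lt /(_ e e0)] [N _ hN].
exists N => n /hN /=; rewrite sub0r normrN => /ltW; apply: le_trans.
by rewrite int2_fine; exact: ler_norm.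
Qed.

End MeasureTools.

(** * Extremals *)

Section Attainment.
Variable R : realType.
Implicit Types (g h : fnt R) (u w : R * R -> R).

Lemma fnt_linE (c : R) g h : c *: g + h = (fun z => c * g z + h z).
Proof. by []. Qed.

Lemma Dx_sub g h z : test g -> test h -> Dx (g - h) z = Dx g z - Dx h z.
Proof.
move=> tg th; rewrite -scaleN1r addrC fnt_linE (Dx_lin (-1) th.1 tg.1).
by rewrite mulN1r addrC.
Qed.

Lemma Dx_mix (s t : R) g h z : test g -> test h ->
  Dx (s *: g + t *: h) z = s * Dx g z + t * Dx h z.
Proof.
move=> tg th; have tth := test_scale t th.
by rewrite fnt_linE (Dx_lin s tg.1 tth.1) (Dx_scale t th.1).
Qed.

Lemma test_sub g h : test g -> test h -> test (g - h).
Proof. exact: psB (fa_ps R) g h. Qed.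

Lemma ipYE g h : test g -> test h -> ipY (Dx g) (Dx h) = fa g h + fb g h.
Proof. by move=> tg th; rewrite /ipY (ipY0E tg th). Qed.

Lemma Dx_subE g h : test g -> test h -> (Dx g : R * R -> R) - Dx h = Dx (g - h).
Proof. by move=> tg th; apply/funext => z; rewrite (Dx_sub z tg th). Qed.

Lemma normY_sub g h : test g -> test h ->
  normY ((Dx g : R * R -> R) - Dx h) = Num.sqrt (fa (g - h) (g - h) + fb (g - h) (g - h)).
Proof.
move=> tg th; rewrite (Dx_subE tg th) /normY; congr Num.sqrt.
exact: ipYE (test_sub tg th) (test_sub tg th).
Qed.

Definition cauchyY (s : nat -> fnt R) : Prop := forall e : R, 0 < e ->
  exists N, forall j k, (N <= j)%N -> (N <= k)%N ->
    fa (s j - s k) (s j - s k) <= e /\ fb (s j - s k) (s j - s k) <= e.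

Lemma approx_intro u (s : nat -> fnt R) : (forall n, test (s n)) ->
  ae2 (fun z => Dx (s n) z @[n --> \oo] --> u z) -> cauchyY s ->
  Defs.approx u (fun n => Dx (s n)).
Proof.
move=> ts su cs; split=> //.
  by move=> n; exists (s n); split => //; exact/testP.
move=> e e0; have e2 : 0 < e ^+ 2 / 4 by rewrite divr_gt0 // exprn_gt0.
have [N HN] := cs _ e2; exists N => j k jN kN; have [h1 h2] := HN j k jN kN.
rewrite (normY_sub (ts j) (ts k)).
have <- : Num.sqrt (e ^+ 2) = e by rewrite sqrtr_sqr ger0_norm // ltW.
rewrite ltr_sqrt ?exprn_gt0 //.
have : 0 < e ^+ 2 by rewrite exprn_gt0.
move: h1 h2; move: (fa _ _) (fb _ _) (e ^+ 2) => a b c; lra.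
Qed.

Lemma approx_elim u s : Defs.approx u s -> exists g : nat -> fnt R,
  [/\ forall n, test (g n), s = (fun n => Dx (g n)),
      ae2 (fun z => Dx (g n) z @[n --> \oo] --> u z) & cauchyY g].
Proof.
move=> [sY su sC].
have /choice[g gP] : forall n, exists g, test g /\ s n = Dx g.
  by move=> n; have [g [/testP tg ->]] := sY n; exists g.
have E : s = (fun n => Dx (g n)) by apply/funext => n; exact: (gP n).2.
subst s; exists g; split => //; first by move=> n; exact: (gP n).1.
move=> e e0; have se : 0 < Num.sqrt e by rewrite sqrtr_gt0.
have [N HN] := sC _ se; exists N => j k jN kN.
have := HN j k jN kN; rewrite (normY_sub (gP j).1 (gP k).1).
rewrite ltr_sqrt // => H.
have tt := test_sub (gP j).1 (gP k).1.
have a0 := ps_ge0 (fa_ps R) tt; have b0 := ps_ge0 (fb_ps R) tt.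
by split; apply: le_trans (ltW H); rewrite ?lerDl ?lerDr.
Qed.

Variable q : R.
Hypothesis q2 : 2 < q.
Hypothesis q4 : q < 4.
Let q0 : 0 < q. Proof. by apply: lt_trans q2. Qed.

Lemma Phi_aff (k t s1 s2 : R) u : cc2 u -> 0 <= k -> 0 < t ->
  Phi q (fun z => k * (u \o aff t s1 (t ^+ 2) s2) z) = k `^ q / t ^+ 3 * Phi q u.
Proof.
move=> cu k0 t0; have cp := cc2_normpow q2 cu.
have t20 : 0 < t ^+ 2 by rewrite exprn_gt0.
have [cA _] := int2_aff s1 s2 cp t0 t20.
rewrite /Phi -mulrA -(int2_dil s1 s2 t0 cp) -(int2Z _ (cc2_int cA)).
congr int2; apply/funext => z /=.
by rewrite normrM powRM // ger0_norm.
Qed.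

Lemma PhiN u : Phi q (fun z => - u z) = Phi q u.
Proof. by congr int2; apply/funext => z; rewrite normrN. Qed.

Lemma Phi_dil (c t s1 s2 : R) g : test g -> 0 < t ->
  Phi q (Dx (dil c t s1 s2 g)) = (`|c| * t) `^ q / t ^+ 3 * Phi q (Dx g).
Proof.
move=> tg t0; rewrite (Dx_dil c t s1 s2 tg).
have k0 : 0 <= `|c| * t by rewrite mulr_ge0 // ltW.
rewrite -(Phi_aff s1 s2 (test_cc (test_Dx tg)) k0 t0).
have [c0|c0] := leP 0 c; first by rewrite ger0_norm.
rewrite -PhiN ltr0_norm //; congr Phi; apply/funext => z.
by rewrite !mulNr.
Qed.

(* strict superadditivity rules out splitting of the mass *)
Lemma no_splitting (r al : R) : 1 < r -> 0 < al -> al <= 1 ->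
  1 <= (1 - al) `^ r + al `^ r -> al = 1.
Proof.
move=> r1 al0 al1 H; apply/eqP; rewrite eq_le al1 /= leNgt; apply/negP => al1'.
have key x : 0 < x -> x < 1 -> x `^ r < x.
  move=> x0 x1; rewrite -(mulr_powRB1 (ltW x0) (lt_trans ltr01 r1)).
  rewrite gtr_pMr // /powR gt_eqF // expR_lt1 pmulr_rlt0 ?subr_gt0 //.
  by apply: ln_lt0; rewrite x0 x1.
have := key _ al0 al1'; have := key (1 - al); rewrite subr_gt0 => /(_ al1').
have -> : 1 - al < 1 by lra.
by move=> /(_ isT); lra.
Qed.

Lemma powR_near (r x d : R) : 0 < r -> 0 <= x -> 0 < d ->
  exists2 e, 0 < e & forall y, 0 <= y -> y <= x + e -> y `^ r <= x `^ r + d.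
Proof.
move=> r0 x0 d0; have := normpow_continuous r0 (x := x).
move=> /cvgrPdist_lt /(_ d d0) /nbhs_ballP[e /= e0 He].
have e2 : 0 < e / 2 by rewrite divr_gt0.
exists (e / 2) => // y y0 yx.
have xe : 0 <= x + e / 2 by rewrite addr_ge0 // ltW.
have := He (x + e / 2); rewrite /ball /= (ger0_norm x0) (ger0_norm xe).
rewrite opprD addNKr normrN (gtr0_norm e2) => /(_ ltac:(lra)).
rewrite ltr_distlC => /andP[_ h]; apply: le_trans (ltW h).
by apply: powR_le => //; exact: ltW.
Qed.

End Attainment.

(** * Maximising sequences, convex combinations and the Brezis-Lieb lemma *)

Section Attain.
Variable R : realType.
Implicit Types (g h : fnt R) (u w : R * R -> R).
Variable q : R.
Hypothesis q2 : 2 < q.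
Hypothesis q4 : q < 4.
Let q0 : 0 < q. Proof. by apply: lt_trans q2. Qed.

Variables (l1 l2 Lam A B : R).
Hypotheses (l10 : 0 < l1) (l20 : 0 < l2) (L0 : 0 < Lam).
Hypothesis AB : l1 * A + l2 * B = 1.
Hypothesis sup_bound : forall g, test g ->
  Phi q (Dx g) <= Lam * (fN l1 l2 g g) `^ (q / 2).

Let HN : psform (V := fnt R) (@test R) (fN l1 l2) := fN_ps (ltW l10) (ltW l20).

Definition maximizing (G : nat -> fnt R) : Prop :=
  [/\ forall n, test (G n), forall n, fa (G n) (G n) = A,
      forall n, fb (G n) (G n) = B &
      forall e, 0 < e -> exists N, forall n, (N <= n)%N -> Lam - e <= Phi q (Dx (G n))].

Lemma maximizing_translate (G : nat -> fnt R) : maximizing G ->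
  exists (e d : R) (G' : nat -> fnt R), [/\ 0 < e, 0 < d, maximizing G' &
    forall n, d <= G' n (e, 0) - G' n (0, 0)].
Proof.
move=> [tG GA GB GL].
have c0 : 0 < Lam / 2 by rewrite divr_gt0.
have A0 : 0 <= A by rewrite -(GA 0%N); exact: (ps_ge0 (fa_ps R)).
have B0 : 0 <= B by rewrite -(GB 0%N); exact: (ps_ge0 (fb_ps R)).
have [e [d [e0 d0 nv]]] := nonvanishing q2 q4 c0 (addr_ge0 A0 B0).
have [N0 HN0] := GL _ c0.
have /choice[z zP] : forall n, exists z, d <= `|G (n + N0)%N (z.1 + e, z.2) - G (n + N0)%N z|.
  move=> n; apply: nv; first exact: tG.
  - by rewrite GA lerDl.
  - by rewrite GB lerDr.
  - by have := HN0 _ (leq_addl n N0); lra.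
(* The sign makes the increment itself, and not only its absolute value, at least [d]: this is a
   lower bound on a linear functional, which survives convex combinations. *)
pose sg n : R := if 0 <= G (n + N0)%N ((z n).1 + e, (z n).2) - G (n + N0)%N (z n) then 1 else -1.
have sg2 n : sg n ^+ 2 = 1 by rewrite /sg; case: ifP; rewrite ?expr1n // sqrrN expr1n.
have nsg n : `|sg n| = 1 by rewrite /sg; case: ifP; rewrite ?normrN normr1.
exists e, d, (fun n => dil (sg n) 1 (z n).1 (z n).2 (G (n + N0)%N)); split; [exact: e0|exact: d0| |].
- split.
  + by move=> n; exact: (test_dil (sg n) _ _ ltr01 (tG _)).
  + by move=> n; rewrite (fa_dil (sg n) _ _ ltr01 (tG _)) sg2 !mul1r.
  + by move=> n; rewrite (fb_dil (sg n) _ _ ltr01 (tG _)) sg2 divr1 !mul1r.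
  + move=> e' e'0; have [N HN'] := GL _ e'0; exists N => n Nn.
    rewrite (Phi_dil q2 (sg n) _ _ (tG _) ltr01) nsg mulr1 powR1 expr1n divr1 mul1r.
    by apply: HN'; apply: leq_trans Nn (leq_addr _ _).
- move=> n; have := zP n; rewrite /dil /aff /= !expr1n !mul1r !add0r [e + _]addrC -surjective_pairing -mulrBr.
  rewrite /sg; case: ifPn => [h|]; first by rewrite ger0_norm // mul1r.
  by rewrite -ltNge => h; rewrite ltr0_norm // mulN1r.
Qed.

(** At a fixed point [z] the condition of lying within [e] of [w z] is convex, so it passes from a
    tail to its hull. *)
Lemma hull_cvg (s : nat -> fnt R) (v : nat -> fnt R) w z : (forall n, test (s n)) ->
  (forall m, hull (tail s m) (v m)) ->
  Dx (s n) z @[n --> \oo] --> w z -> Dx (v n) z @[n --> \oo] --> w z.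
Proof.
move=> ts vs /cvgrPdist_lt sw; apply/cvgrPdist_le => e e0.
have [K _ HK] := sw e e0; exists K => // m /= Km.
suff H : test (v m) /\ `|w z - Dx (v m) z| <= e by exact: H.2.
move: (v m) (vs m); apply: (hull_ind_convex (V := fnt R)).
  move=> _ [n mn ->]; split => //; apply: ltW; apply: HK => /=.
  exact: leq_trans Km mn.
move=> t x y /andP[t0 t1] [tx Hx] [ty Hy]; split; first exact: (ps_comb (fa_ps R)).
rewrite (Dx_mix _ _ _ tx ty).
have s0 : 0 <= 1 - t by lra.
move: Hx Hy; move: (Dx x z) (Dx y z) (w z) => a b c Ha Hb.
rewrite (_ : c - _ = (1 - t) * (c - a) + t * (c - b)); last by ring.
apply: (le_trans (ler_normD _ _)); rewrite !normrM (ger0_norm s0) (ger0_norm t0).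
have := ler_wpM2l s0 Ha; have := ler_wpM2l t0 Hb; lra.
Qed.

(** The increment from the origin to [(e, 0)] is linear in the function, so it stays at least [d] on
    the hull; the Hoelder bound in x turns it into a lower bound on the norm. This keeps the limit
    of the minimal norms away from 0. *)
Lemma hull_gap (s : nat -> fnt R) (v : nat -> fnt R) (e d : R) : 0 < e -> 0 < d ->
  (forall n, test (s n)) -> (forall m, hull (tail s m) (v m)) ->
  (forall n, d <= s n (e, 0) - s n (0, 0)) ->
  forall m, test (v m) /\ l1 * d ^+ 2 / e <= fN l1 l2 (v m) (v m).
Proof.
move=> e0 d0 ts vs sd m.
have [tv dv] : test (v m) /\ d <= v m (e, 0) - v m (0, 0).
  move: (v m) (vs m); apply: (hull_ind_convex (V := fnt R)).
    by move=> _ [n mn ->].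
  move=> t x y /andP[t0 t1] [tx Hx] [ty Hy]; split; first exact: (ps_comb (fa_ps R)).
  have s0 : 0 <= 1 - t by lra.
  have := ler_wpM2l s0 Hx; have := ler_wpM2l t0 Hy.
  change (((1 - t) *: x + t *: y : fnt R) (e, 0)) with ((1 - t) * x (e, 0) + t * y (e, 0)).
  change (((1 - t) *: x + t *: y : fnt R) (0, 0)) with ((1 - t) * x (0, 0) + t * y (0, 0)).
  lra.
split => //; rewrite ler_pdivrMr //.
have := @test_holder_x R (v m) e 0 0 tv (ltW e0); rewrite add0r => H.
have d2 : d ^+ 2 <= (v m (e, 0) - v m (0, 0)) ^+ 2 by apply: lerXn2r; rewrite ?nnegrE; [exact: ltW|exact: le_trans (ltW d0) dv|exact: dv].
have fb0 : 0 <= fb (v m) (v m) := ps_ge0 (fb_ps R) tv.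
rewrite /fN; have := le_trans d2 H.
move: (fa (v m) (v m)) (fb (v m) (v m)) fb0 => a b b0 K.
have := ler_wpM2l (ltW l10) K; have := mulr_ge0 (mulr_ge0 (ltW l20) b0) (ltW e0); lra.
Qed.

(** Only the upper bound is required. The positive part of [|s_n|^q - (1 + d) |s_n - w|^q - |w|^q]
    is dominated by a multiple of [|w|^q], by [normpow_add] with a weight [e] such that
    [(1 + e)^q <= 1 + d]; it tends to 0 almost everywhere, hence in the mean. *)
Lemma brezis_lieb (s : nat -> fnt R) w (c : R) (M : nat) (d : R) :
  (forall n, test (s n)) -> meas2 w ->
  ae2 (fun z => Dx (s n) z @[n --> \oo] --> w z) ->
  intg2 (fun z => `|w z| `^ q) ->
  (forall n, (M <= n)%N -> intg2 (fun z => `|Dx (s n) z - w z| `^ q) /\ Phi q (fun z => Dx (s n) z - w z) <= c) ->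
  0 < d -> exists N, forall n, (N <= n)%N ->
    Phi q (Dx (s n)) <= c + d * c + Phi q w + d.
Proof.
move=> ts mw sw iw H d0.
have [e e0 He] := powR_near q0 ler01 d0.
have en : (1 + e) `^ q <= 1 + d.
  by have := He (1 + e); rewrite powR1; apply; rewrite // addr_ge0 // ltW.
pose k := (1 + e^-1) `^ q.
have k0 : 0 <= k by exact: powR_ge0.
have ms n : meas2 (Dx (s n)) := cc2_meas (test_cc (test_Dx (ts n))).
have cpow := normpow_continuous q0.
have m1 n : meas2 (fun z => `|Dx (s n) z| `^ q) := meas2_comp cpow (ms n).
have m2 : meas2 (fun z => `|w z| `^ q) := meas2_comp cpow mw.
have m3 n : meas2 (fun z => `|Dx (s n) z - w z| `^ q) := meas2_comp cpow (meas2B (ms n) mw).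
pose X n z := `|Dx (s n) z| `^ q - (1 + d) * `|Dx (s n) z - w z| `^ q - `|w z| `^ q.
have cmax : continuous (fun x : R => Num.max x 0).
  move=> x; have E : (fun x : R => Num.max x 0) = (fun x : R => (x + `|x|) / 2).
    apply/funext => y; have [h|h] := leP y 0.
      by rewrite ler0_norm // subrr mul0r.
    by rewrite (gtr0_norm h); field.
  rewrite E; apply: (@cvgM R); last exact: cvg_cst.
  by apply: (@cvgD _ R^o); [exact: cvg_id|exact: norm_continuous].
have mX n : meas2 (X n).
  by apply: meas2B => //; apply: meas2B => //; exact: meas2Z.
pose W n z := Num.max (X n z) 0.
have mW n : meas2 (W n) := meas2_comp cmax (mX n).
have ik := intg2Z k iw.
have Wk n z : `|W n z| <= k * `|w z| `^ q.
  have kw : 0 <= k * `|w z| `^ q by rewrite mulr_ge0 ?powR_ge0.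
  rewrite ger0_norm; last by rewrite /W le_max lexx orbT.
  rewrite /W ge_max kw andbT /X.
  have := normpow_add q2 (Dx (s n) z - w z) (w z) e0; rewrite subrK -/k.
  have := ler_wpM2r (powR_ge0 `|Dx (s n) z - w z| q) en.
  have := powR_ge0 `|w z| q.
  move: (`|Dx (s n) z| `^ q) (`|Dx (s n) z - w z| `^ q) (`|w z| `^ q) => x1 x2 x3.
  lra.
have W0 : ae2 (fun z => W n z @[n --> \oo] --> (0 : R)).
  apply: ae2S sw => z sz.
  have -> : (0 : R) = Num.max (`|w z| `^ q - (1 + d) * `|w z - w z| `^ q - `|w z| `^ q) 0.
    by rewrite subrr normr0 powR0 ?gt_eqF // mulr0 subr0 subrr maxxx.
  apply: (@cvg_comp _ _ _ (fun n => X n z) (fun x => Num.max x 0)); last exact: cmax.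
  apply: (@cvgB _ R^o); last exact: cvg_cst.
  apply: (@cvgB _ R^o).
    by apply: (@cvg_comp _ _ _ (fun n => Dx (s n) z) (fun x => `|x| `^ q)) sz _; exact: cpow.
  apply: (@cvgM R); first exact: cvg_cst.
  apply: (@cvg_comp _ _ _ (fun n => Dx (s n) z - w z) (fun x => `|x| `^ q)); last exact: cpow.
  by apply: (@cvgB _ R^o); [exact: sz|exact: cvg_cst].
have [N HN'] := dct2 mW ik Wk W0 d0.
exists (maxn M N) => n; rewrite geq_max => /andP[Mn Nn].
have [iB cB] := H n Mn; have iW : intg2 (W n) by exact: intg2_le (mW n) ik (Wk n).
have d10 : 0 <= 1 + d by rewrite addr_ge0 // ltW.
apply: (@le_trans _ _ (int2 (fun z => (1 + d) * `|Dx (s n) z - w z| `^ q + (`|w z| `^ q + W n z)))).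
  apply: le_int2.
  - exact: cc2_int (cc2_normpow q2 (test_cc (test_Dx (ts n)))).
  - exact: intg2D (intg2Z _ iB) (intg2D iw iW).
  move=> z; have : X n z <= W n z by rewrite /W le_max lexx.
  rewrite /X; move: (`|Dx (s n) z| `^ q) ((1 + d) * _) (`|w z| `^ q) (W n z) => *; lra.
rewrite (int2D (intg2Z _ iB) (intg2D iw iW)) (int2D iw iW) (int2Z _ iB).
have := HN' n Nn; have := ler_wpM2l d10 cB.
rewrite -/(Phi q w); rewrite -/(Phi q (fun z => Dx (s n) z - w z)).
move: (Phi q _) (Phi q w) (int2 _) => x1 x2 x3; lra.
Qed.
End Attain.

(** * Attainment of the supremum *)

Section Attain2.
Variable R : realType.

Lemma le_eps (x y K : R) : 0 <= K ->
  (forall d, 0 < d -> d <= 1 -> x <= y + d * K) -> x <= y.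
Proof.
move=> K0 H; rewrite leNgt; apply/negP => yx.
have K1 : 0 < 2 * (K + 1) by rewrite mulr_gt0 // ltr_wpDl.
pose d := Num.min 1 ((x - y) / (2 * (K + 1))).
have d0 : 0 < d by rewrite lt_min ltr01 divr_gt0 // subr_gt0.
have d1 : d <= 1 by rewrite ge_min lexx.
have d2 : d * (2 * (K + 1)) <= x - y by rewrite -ler_pdivlMr // ge_min lexx orbT.
have := H d d0 d1; have := mulr_ge0 (ltW d0) K0; lra.
Qed.

Lemma quarter_sum (x y c : R) : x <= c / 4 -> y <= c / 4 -> 2 * x + 2 * y <= c.
Proof. lra. Qed.

Lemma weights_bound (m l1 l2 a b e : R) : 0 < m -> m <= l1 -> m <= l2 ->
  0 <= a -> 0 <= b -> l1 * a + l2 * b <= m * e -> a <= e /\ b <= e.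
Proof.
move=> m0 m1 m2 a0 b0 H; have h1 := ler_wpM2r a0 m1; have h2 := ler_wpM2r b0 m2.
have h3 := mulr_ge0 (ltW m0) a0; have h4 := mulr_ge0 (ltW m0) b0.
by split; rewrite -(ler_pM2l m0); lra.
Qed.

Lemma ps_N_sym (V : lmodType R) (P : V -> Prop) (B : V -> V -> R) (HB : psform P B) x y :
  P x -> P y -> B (x - y) (x - y) = B (y - x) (y - x).
Proof.
move=> px py; rewrite (ps_NB HB px py) (ps_NB HB py px) (ps_sym HB px py); ring.
Qed.

Variable q : R.
Hypothesis q2 : 2 < q.
Hypothesis q4 : q < 4.
Let q0 : 0 < q. Proof. by apply: lt_trans q2. Qed.
Let r := q / 2.
Let r1 : 1 < r. Proof. by rewrite /r ltr_pdivlMr // mul1r. Qed.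
Let r0 : 0 < r. Proof. exact: lt_trans r1. Qed.

Variables (l1 l2 Lam A B : R).
Hypotheses (l10 : 0 < l1) (l20 : 0 < l2) (L0 : 0 < Lam).
Hypothesis AB : l1 * A + l2 * B = 1.
Hypothesis sup_bound : forall g : fnt R, test g ->
  Phi q (Dx g) <= Lam * (fN l1 l2 g g) `^ r.

Let HN : psform (V := fnt R) (@test R) (fN l1 l2) := fN_ps (ltW l10) (ltW l20).

Lemma Phi_fatou (t : nat -> fnt R) (y : R * R -> R) (M : nat) (c : R) :
  (forall m, test (t m)) -> meas2 y ->
  ae2 (fun z => Dx (t m) z @[m --> \oo] --> y z) ->
  (forall m, (M <= m)%N -> fN l1 l2 (t m) (t m) `^ r <= c) ->
  intg2 (fun z => `|y z| `^ q) /\ Phi q y <= Lam * c.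
Proof.
move=> tt my ty Hc; have cpow := normpow_continuous q0.
apply: (@fatou2 R (fun m z => `|Dx (t m) z| `^ q) (fun z => `|y z| `^ q) (Lam * c) M).
- by move=> m; exact: cc2_int (cc2_normpow q2 (test_cc (test_Dx (tt m)))).
- by move=> m z; exact: powR_ge0.
- exact: meas2_comp cpow my.
- by move=> z; exact: powR_ge0.
- apply: ae2S ty => z tz.
  by apply: (@cvg_comp _ _ _ (fun n => Dx (t n) z) (fun x => `|x| `^ q)) tz _; exact: cpow.
- move=> m Mm; apply: (le_trans (sup_bound (tt m))).
  by rewrite ler_pM2l //; exact: Hc.
Qed.

Theorem attain (G : nat -> fnt R) : maximizing q Lam A B G ->
  exists (s : nat -> fnt R) (w : R * R -> R),
  [/\ forall n, [/\ test (s n), fa (s n) (s n) = A & fb (s n) (s n) = B],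
      meas2 w, ae2 (fun z => Dx (s n) z @[n --> \oo] --> w z), cauchyY s &
      intg2 (fun z => `|w z| `^ q) /\ Phi q w = Lam].
Proof.
move=> /(maximizing_translate q2 q4 L0)[e [d [G' [e0 d0 [tG GA GB GL] gap]]]].
have GA' n : fa (G' n) (G' n) <= A by rewrite GA.
have [phi [phik cv]] := local_compactness tG GA'.
pose s k := G' (phi k).
have ts n : test (s n) := tG (phi n).
have [w mw sw] := ae2_cvg_measurable (fun k => cc2_meas (test_cc (test_Dx (ts k)))) cv.
have Ns n : fN l1 l2 (s n) (s n) = 1 by rewrite /fN GA GB.
have Ns1 n : fN l1 l2 (s n) (s n) <= 1 by rewrite Ns.
have [v [al [/andP[al0 al1] vh valpha vC vs]]] := hull_min HN ts Ns1.
have gap' : forall m, test (v m) /\ l1 * d ^+ 2 / e <= fN l1 l2 (v m) (v m).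
  by apply: (hull_gap l10 l20 e0 d0 ts vh) => n; exact: gap.
have tv m : test (v m) := (gap' m).1.
have vw : ae2 (fun z => Dx (v m) z @[m --> \oo] --> w z).
  by apply: ae2S sw => z; exact: hull_cvg.
have alp : 0 < al.
  have g0 : 0 < l1 * d ^+ 2 / e by rewrite divr_gt0 // mulr_gt0 // exprn_gt0.
  rewrite ltNge; apply/negP => alle.
  have [M HM] := valpha _ g0; have /andP[_] := HM M (leqnn M).
  by have := (gap' M).2; lra.
have bnd_w dl : 0 < dl -> intg2 (fun z => `|w z| `^ q) /\ Phi q w <= Lam * (al `^ r + dl).
  move=> dl0; have [e1 e10 He1] := powR_near r0 al0 dl0.
  have [M HM] := valpha _ e10.
  apply: (@Phi_fatou v w M) => // m Mm; apply: He1; first exact: ps_ge0 HN _ (tv m).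
  by have /andP[_ /ltW] := HM m Mm.
have iw := (bnd_w 1 ltr01).1.
(* Here [n] is fixed and Fatou is applied in [m], along [s n - v m], whose norm is bounded by the
   last clause of [hull_min]. *)
have bnd_s dl : 0 < dl -> exists M, forall n, (M <= n)%N ->
    intg2 (fun z => `|Dx (s n) z - w z| `^ q) /\
    Phi q (fun z => Dx (s n) z - w z) <= Lam * ((1 - al) `^ r + dl).
  move=> dl0; have b0 : 0 <= 1 - al by rewrite subr_ge0.
  have [e1 e10 He1] := powR_near r0 b0 dl0.
  have [M HM] := vs _ e10; exists M => n Mn.
  have tt m : test (s n - v m : fnt R) by exact: test_sub.
  have ms n' : meas2 (Dx (s n')) := cc2_meas (test_cc (test_Dx (ts n'))).
  apply: (@Phi_fatou (fun m => s n - v m) _ M _ tt (meas2B (ms n) mw)).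
    apply: ae2S vw => z vz; under eq_fun => m do rewrite (Dx_sub z (ts n) (tv m)).
    by apply: (@cvgB _ R^o); [exact: cvg_cst|exact: vz].
  move=> m Mm; apply: He1; first exact: ps_ge0 HN _ (tt m).
  exact: HM.
set P1 := (1 - al) `^ r in bnd_s *; set P2 := al `^ r in bnd_w *.
have P10 : 0 <= P1 := powR_ge0 _ _.
have P11 : P1 <= 1.
  rewrite -[leRHS](_ : (1 : R) `^ r = 1); last by rewrite powR1.
  by apply: powR_le; [exact: ltW|lra|lra].
have split1 : Lam <= Lam * P1 + Phi q w.
  have L0' := L0; have K0 : 0 <= 3 * Lam + 2 by lra.
  apply: (le_eps K0) => dl dl0 dl1.
  have [M HM] := bnd_s _ dl0.
  have [N1 HN1] := brezis_lieb q2 ts mw sw iw HM dl0.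
  have [N2 HN2] := GL _ dl0.
  have := HN1 _ (leq_maxl N1 N2).
  have := HN2 _ (leq_trans (leq_maxr N1 N2) (phik _)).
  rewrite -/(s _); move: (Phi q (Dx _)) (Phi q w) => x y h1 h2.
  have k1 := mulr_ge0 (ltW dl0) (ltW L0).
  have k2 : dl * Lam * P1 <= dl * Lam by rewrite ler_piMr.
  have k3 : dl * (dl * Lam) <= dl * Lam by rewrite ler_piMl.
  move: h2; rewrite (_ : Lam * (P1 + dl) + dl * (Lam * (P1 + dl)) =
    Lam * P1 + dl * Lam + dl * Lam * P1 + dl * (dl * Lam)); last by ring.
  move: h1 k1 k2 k3; rewrite (_ : dl * (3 * Lam + 2) = 3 * (dl * Lam) + 2 * dl); last by ring.
  lra.
have split2 : Phi q w <= Lam * P2.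
  by apply: (le_eps (ltW L0)) => dl dl0 _; rewrite [dl * _]mulrC -mulrDr; exact: (bnd_w _ dl0).2.
have al_eq : al = 1.
  apply: (no_splitting r1 alp al1); rewrite -/P1 -/P2 -(ler_pM2l L0); lra.
have P1z : P1 = 0 by rewrite /P1 al_eq subrr powR0 // gt_eqF.
have P2o : P2 = 1 by rewrite /P2 al_eq powR1.
exists s, w; split; [|exact: mw|exact: sw| |]; last first.
- split; first exact: iw.
  apply/eqP; rewrite eq_le.
  by move: split1 split2; rewrite P1z P2o mulr0 mulr1 add0r => -> ->.
- move=> e' e'0.
(* Since [al = 1], both [s j] and [s k] are close to the same [v M]. The smaller of the two weights
   converts smallness of [fN] into smallness of [fa] and [fb] separately. *)
have m0 : 0 < Num.min l1 l2 by rewrite lt_min l10 l20.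
have m1 : Num.min l1 l2 <= l1 by rewrite ge_min lexx.
have m2 : Num.min l1 l2 <= l2 by rewrite ge_min lexx orbT.
have e4 : 0 < Num.min l1 l2 * e' / 4 by rewrite divr_gt0 // mulr_gt0.
have [M HM] := vs _ e4; exists M => j k jM kM.
have H1 := HM j M jM (leqnn M); have H2 := HM k M kM (leqnn M).
rewrite al_eq subrr add0r in H1 H2.
have H3 := ps_tri2 HN (ts j) (tv M) (ts k).
rewrite (ps_N_sym HN (tv M) (ts k)) in H3.
have tjk := test_sub (ts j) (ts k).
have a0 := ps_ge0 (fa_ps R) tjk; have b0 := ps_ge0 (fb_ps R) tjk.
have H4 : fN l1 l2 (s j - s k) (s j - s k) <= Num.min l1 l2 * e'.
  by apply: (le_trans H3); exact: quarter_sum H1 H2.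
move: a0 b0 H4; rewrite /fN; move: (fa (s j - s k) (s j - s k)) (fb (s j - s k) (s j - s k)) => a b.
exact: (weights_bound m0 m1 m2).
- by move=> n; split; [exact: ts|exact: GA|exact: GB].
Qed.
End Attain2.

(** * Closability and the space X *)

Section Closable.
Variable R : realType.
Implicit Types (g h : fnt R).

Lemma ibp_x (p px r rx : R * R -> R) : cc2 p -> cc2 px -> cc2 r -> cc2 rx ->
  (forall x y, is_derive x (1:R) (fun x => p (x, y)) (px (x, y))) ->
  (forall x y, is_derive x (1:R) (fun x => r (x, y)) (rx (x, y))) ->
  int2 (fun z => p z * rx z) = - int2 (fun z => px z * r z).
Proof.
move=> cp cpx cr crx dp dr; apply/eqP; rewrite -subr_eq0 opprK addrC.
have c1 := cc2MM cpx cr; have c2 := cc2MM cp crx; have c12 := cc2D c1 c2.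
rewrite -(int2D (cc2_int c1) (cc2_int c2)) (int2_yx c12); apply/eqP.
rewrite (_ : (fun y => _) = cst 0); first by rewrite /Int1 Rintegral_cst // mul0r.
apply/funext => y; have D x := is_derive_mul (dp x y) (dr x y).
exact: (Int1_deriv0 (cc2_x y (cc2MM cp cr)) (cc2_x y c12) D).
Qed.

Lemma ibp_y (p py r ry : R * R -> R) : cc2 p -> cc2 py -> cc2 r -> cc2 ry ->
  (forall x y, is_derive y (1:R) (fun y => p (x, y)) (py (x, y))) ->
  (forall x y, is_derive y (1:R) (fun y => r (x, y)) (ry (x, y))) ->
  int2 (fun z => p z * ry z) = - int2 (fun z => py z * r z).
Proof.
move=> cp cpx cr crx dp dr; apply/eqP; rewrite -subr_eq0 opprK addrC.
have c1 := cc2MM cpx cr; have c2 := cc2MM cp crx; have c12 := cc2D c1 c2.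
rewrite -(int2D (cc2_int c1) (cc2_int c2)) (int2_xy c12); apply/eqP.
rewrite (_ : (fun x => _) = cst 0); first by rewrite /Int1 Rintegral_cst // mul0r.
apply/funext => x; have D y := is_derive_mul (dp x y) (dr x y).
exact: (Int1_deriv0 (cc2_y x (cc2MM cp cr)) (cc2_y x c12) D).
Qed.

Lemma young_int2 (p h : R * R -> R) (eta : R) : cc2 p -> cc2 h -> 0 < eta ->
  - int2 (fun z => p z * h z) <= eta * int2 (fun z => p z ^+ 2) + eta^-1 * int2 (fun z => h z ^+ 2).
Proof.
move=> cp ch e0; have ei : 0 < eta^-1 by rewrite invr_gt0.
have c1 := cc2Z (-1) (cc2MM cp ch); have c2 := cc2Z eta (cc2X2 cp); have c3 := cc2Z eta^-1 (cc2X2 ch).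
rewrite -mulN1r -(int2Z _ (cc2_int (cc2MM cp ch))).
rewrite -(int2Z _ (cc2_int (cc2X2 cp))) -(int2Z _ (cc2_int (cc2X2 ch))).
rewrite -(int2D (cc2_int c2) (cc2_int c3)).
apply: (le_int2 (cc2_int c1) (cc2_int (cc2D c2 c3))) => z; move: (p z) (h z) => a b.
have E : eta * a ^+ 2 + eta^-1 * b ^+ 2 + a * b = eta^-1 * ((eta * a + b / 2) ^+ 2 + 3 / 4 * b ^+ 2).
  by field; rewrite gt_eqF.
have := mulr_ge0 (ltW ei) (addr_ge0 (sqr_ge0 (eta * a + b / 2)) (mulr_ge0 (_ : 0 <= 3 / 4) (sqr_ge0 b))).
by rewrite -E => /(_ ltac:(lra)); lra.
Qed.

Lemma int2_add_split (p p' r r' : R * R -> R) : cc2 p -> cc2 p' -> cc2 r -> cc2 r' ->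
  int2 (fun z => p z * p' z + r z * r' z) = int2 (fun z => p z * p' z) + int2 (fun z => r z * r' z).
Proof.
by move=> c1 c2 c3 c4; exact: (int2D (cc2_int (cc2MM c1 c2)) (cc2_int (cc2MM c3 c4))).
Qed.

Lemma young_add (f f1 f2 a b c eta i x1 x2 y1 y2 : R) :
  f = f1 + f2 -> f1 = a -> f2 = b -> c = y1 ->
  a <= eta * x1 + i * y1 -> b <= eta * x2 + i * y2 ->
  f <= eta * (x1 + x2) + i * (c + y2).
Proof. by move=> -> -> -> ->; lra. Qed.

(** Integration by parts moves derivatives onto the smooth fixed [g], leaving [h_x] and [h] in L2.
    The norm of [h] itself is not controlled by that of [h_x], and this is why the lemma is applied
    to a difference of translates. *)
Lemma fa_young g h (eta : R) : test g -> test h -> 0 < eta ->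
  fa g h <= eta * (int2 (fun z => Dx (Dx (Dx g)) z ^+ 2) + int2 (fun z => Dy (Dy g) z ^+ 2)) +
    eta^-1 * (fb h h + int2 (fun z => h z ^+ 2)).
Proof.
move=> tg th e0.
have tx := test_Dx tg; have txx := test_Dx tx; have txxx := test_Dx txx.
have ty := test_Dy tg; have tyy := test_Dy ty.
have hx := test_Dx th; have hxx := test_Dx hx; have hy := test_Dy th.
have E1 := ibp_x (test_cc txx) (test_cc txxx) (test_cc hx) (test_cc hxx)
  (fun x y => is_derive_x x y txx.1) (fun x y => is_derive_x x y hx.1).
have E2 := ibp_y (test_cc ty) (test_cc tyy) (test_cc th) (test_cc hy)
  (fun x y => is_derive_y x y ty.1) (fun x y => is_derive_y x y th.1).
have Y1 := young_int2 (test_cc txxx) (test_cc hx) e0.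
have Y2 := young_int2 (test_cc tyy) (test_cc th) e0.
have E3 := int2_add_split (test_cc txx) (test_cc hxx) (test_cc ty) (test_cc hy).
have E4 : fa g h = int2 (fun z => Dx (Dx g) z * Dx (Dx h) z) + int2 (fun z => Dy g z * Dy h z) by exact: E3.
exact: (young_add E4 E1 E2 (fbE h) Y1 Y2).
Qed.

Definition tau (s : R) g : fnt R := dil 1 1 s 0 g.

Lemma tauE s g z : tau s g z = g (z.1 + s, z.2).
Proof. by rewrite /tau /dil /aff /= expr1n !mul1r addr0. Qed.

Lemma test_tau s g : test g -> test (tau s g).
Proof. by move=> tg; exact: (test_dil 1 s 0 ltr01 tg). Qed.

Lemma fa_tau s g : test g -> fa (tau s g) (tau s g) = fa g g.
Proof. by move=> tg; rewrite (fa_dil 1 s 0 ltr01 tg) expr1n !mul1r. Qed.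

Lemma fb_tau s g : test g -> fb (tau s g) (tau s g) = fb g g.
Proof. by move=> tg; rewrite (fb_dil 1 s 0 ltr01 tg) expr1n divr1 !mul1r. Qed.

Lemma tau_sub s g h : tau s (g - h) = tau s g - tau s h.
Proof.
apply/funext => z; rewrite tauE.
change (g (z.1 + s, z.2) - h (z.1 + s, z.2) = tau s g z - tau s h z).
by rewrite !tauE.
Qed.

Lemma support_disjoint (p r : R * R -> R) : 
  (exists M : R, forall x y, (M < `|x|) || (M < `|y|) -> p (x, y) = 0) ->
  (exists M : R, forall x y, (M < `|x|) || (M < `|y|) -> r (x, y) = 0) ->
  exists s0 : R, 0 <= s0 /\ forall s, s0 <= s -> forall c z, p z * (c * r (aff 1 s (1 ^+ 2) 0 z)) = 0.
Proof.
move=> [M pM] [M' rM]; exists (`|M| + `|M'| + 1); split; first by rewrite !addr_ge0.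
move=> s hs c [x y]; rewrite /aff /= mul1r.
have [xM|xM] := leP `|x| M; last by rewrite pM ?xM // mul0r.
rewrite rM ?mulr0 //; apply/orP; left.
have := ler_norm M; have := ler_norm M'; have := normr_ge0 M; have := ler_norm (x + s).
have := lerNnormlW (lexx `|x|); lra.
Qed.

Lemma fa_tau_disjoint g : test g -> exists2 s, 0 <= s & fa g (tau s g) = 0.
Proof.
move=> tg; have txx := test_Dx (test_Dx tg); have ty := test_Dy tg.
have [s1 [s10 H1]] := support_disjoint txx.2 txx.2.
have [s2 [s20 H2]] := support_disjoint ty.2 ty.2.
exists (s1 + s2); first exact: addr_ge0.
rewrite (fa_repr erefl erefl (Dxx_dil 1 1 (s1 + s2) 0 tg) (Dy_dil 1 1 (s1 + s2) 0 tg)).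
rewrite (_ : (fun z => _) = (fun=> 0 * (fun z : R * R => 0 : R) 0)).
  have c0 : cc2 (fun _ : R * R => 0 : R) by split; [exact: cst_continuous|exists 0].
  by rewrite (int2Z 0 (cc2_int c0)) mul0r.
apply/funext => z; rewrite mul0r.
have := H1 (s1 + s2) _ (1 * 1 ^+ 2) z; have := H2 (s1 + s2) _ (1 * 1 ^+ 2) z.
rewrite lerDl lerDr => /(_ s10) h2 /(_ s20) h1.
by apply: etrans (congr2 +%R h1 h2) _; rewrite addr0.
Qed.

Lemma ps_quarter (V : lmodType R) (P : V -> Prop) (B : V -> V -> R) (HB : psform P B) x y :
  P x -> P y -> B x y <= B x x / 4 + B y y.
Proof.
move=> px py; have := ps_ge0 HB (ps_comb HB (2^-1) (-1) px py).
rewrite (ps_N_mix HB) //; lra.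
Qed.

Lemma ps_Nsub_le (V : lmodType R) (P : V -> Prop) (B : V -> V -> R) (HB : psform P B) x y :
  P x -> P y -> B (x - y) (x - y) <= 2 * B x x + 2 * B y y.
Proof.
move=> px py; have := ps_ge0 HB (ps_comb HB 1 1 px py).
rewrite (ps_NB HB) // (ps_N_mix HB) //; lra.
Qed.

Lemma ps_Bsub (V : lmodType R) (P : V -> Prop) (B : V -> V -> R) (HB : psform P B) x y z :
  P x -> P y -> P z -> B x (y - z) = B x y - B x z.
Proof.
move=> px py pz; rewrite (ps_sym HB px (psB HB py pz)) -scaleN1r addrC.
rewrite (ps_Blin HB _ pz py px) (ps_sym HB pz px) (ps_sym HB py px).
by rewrite mulN1r addrC.
Qed.

Lemma telescope3 (a b c s d1 d2 d3 : R) :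
  d1 = a - b -> d2 = b - c -> d3 = c - s -> s = 0 -> a = d1 + d2 + d3.
Proof. by move=> -> -> -> ->; ring. Qed.

Lemma double_bound (x y : R) : x <= 2 * y + 2 * y -> x <= 4 * y.
Proof. lra. Qed.

Lemma split_bound (f k i hb h2 s2 b c : R) : 0 <= i -> f <= k + i * (hb + h2) ->
  k <= c -> hb <= 4 * b -> h2 <= s2 * b -> i * (4 + s2) * b <= c -> f <= c + c.
Proof.
move=> i0 H1 H2 H3 H4 H5; have := ler_wpM2l i0 (lerD H3 H4).
by rewrite -mulrDl mulrA; lra.
Qed.

Lemma closable_bound (e a x1 x2 x3 y1 y2 : R) : a = x1 + x2 + x3 ->
  x1 <= a / 4 + y1 -> x3 <= a / 4 + y2 -> y1 <= e / 8 -> y2 <= e / 8 ->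
  x2 <= e / 8 + e / 8 -> a <= e.
Proof. lra. Qed.

(** With [T] the translation by a large [s], [g_n] is the sum of [g_n - g_m], [g_m - T g_m],
    [T (g_m - g_n)] and [T g_n], and [fa g_n g_n] splits accordingly. The last term is 0 by
    disjointness of supports; the first and third are small by the Cauchy property, each after
    absorbing a quarter of the left side. The second is handled by [fa_young], as both
    [h = g_m - T g_m] and its x-derivative are bounded in L2 by [(g_m)_x], which tends to 0. *)
Lemma closable (g : nat -> fnt R) : (forall n, test (g n)) -> cauchyY g ->
  ae2 (fun z => Dx (g n) z @[n --> \oo] --> (0 : R)) ->
  forall e, 0 < e -> exists N, forall n, (N <= n)%N ->
    fa (g n) (g n) <= e /\ fb (g n) (g n) <= e.
Proof.
move=> tg cg g0.
(* For the mass this is Fatou in [m] applied to [g n - g m], whose derivatives converge to that of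
   [g n]. *)
have fb0 e : 0 < e -> exists N, forall n, (N <= n)%N -> fb (g n) (g n) <= e.
  move=> e0; have [N HN] := cg e e0; exists N => n Nn; rewrite fbE.
  have cgn := test_cc (test_Dx (tg n)).
  have tt m := test_sub (tg n) (tg m).
  apply: (@fatou2 R (fun m z => Dx (g n - g m) z ^+ 2) (fun z => Dx (g n) z ^+ 2) e N _ _ _ _ _ _).2.
  - by move=> m; exact: cc2_int (cc2X2 (test_cc (test_Dx (tt m)))).
  - by move=> m z; exact: sqr_ge0.
  - exact: cc2_meas (cc2X2 cgn).
  - by move=> z; exact: sqr_ge0.
  - apply: ae2S g0 => z gz; under eq_fun => m do rewrite (Dx_sub z (tg n) (tg m)).
    have H : (Dx (g n) z - Dx (g m) z) @[m --> \oo] --> Dx (g n) z - 0.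
      by apply: (@cvgB _ R^o); [exact: cvg_cst|exact: gz].
    by rewrite subr0 in H; exact: (cvgM H H).
  - by move=> m Nm; rewrite -fbE; exact: (HN n m Nn Nm).2.
move=> e e0; have e8 : 0 < e / 8 by rewrite divr_gt0.
have [N1 HN1] := cg _ e8; have [N2 HN2] := fb0 _ e0.
exists (maxn N1 N2) => n; rewrite geq_max => /andP[n1 n2]; split; last exact: HN2.
have [s s0 sd] := fa_tau_disjoint (tg n).
set K := int2 (fun z => Dx (Dx (Dx (g n))) z ^+ 2) + int2 (fun z => Dy (Dy (g n)) z ^+ 2).
have K0 : 0 <= K by rewrite addr_ge0 //; apply: int2_ge0 => z; exact: sqr_ge0.
(* [K], [eta] and [s] depend on [n], which is fixed; [m] is chosen last and can be as large as they
   demand. *)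
pose eta := e / 8 / (K + 1).
have eta0 : 0 < eta by rewrite divr_gt0 // ltr_wpDl.
have etaK : eta * K <= e / 8.
  have : eta * (K + 1) = e / 8 by rewrite divfK // gt_eqF // ltr_wpDl.
  by rewrite mulrDr mulr1; lra.
pose c := eta^-1 * (4 + s ^+ 2).
have c0 : 0 < c by rewrite mulr_gt0 ?invr_gt0 // ltr_wpDr // sqr_ge0.
have ec : 0 < e / 8 / c by rewrite divr_gt0.
have [N3 HN3] := fb0 _ ec.
pose m := maxn N1 N3.
have mN1 : (N1 <= m)%N by rewrite leq_maxl.
have bm : c * fb (g m) (g m) <= e / 8.
  by rewrite mulrC -ler_pdivlMr //; apply: HN3; rewrite leq_maxr.
pose h : fnt R := g m - tau s (g m).
have tm := test_tau s (tg m); have th : test h := test_sub (tg m) tm.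
have Y : fa (g n) h <= eta * K + eta^-1 * (fb h h + int2 (fun z => h z ^+ 2)).
  exact: (fa_young (tg n) th eta0).
have hb : fb h h <= 4 * fb (g m) (g m).
  have := ps_Nsub_le (fb_ps R) (tg m) tm; rewrite (fb_tau s (tg m)).
  exact: double_bound.
have h2 : int2 (fun z => h z ^+ 2) <= s ^+ 2 * fb (g m) (g m).
  have := test_diffx (tg m) s0; congr (_ <= _); congr int2; apply/funext => z.
  by rewrite -sqrrN opprB -tauE.
have i0 : 0 <= eta^-1 by rewrite invr_ge0 ltW.
have Yc : fa (g n) h <= e / 8 + e / 8 := split_bound i0 Y etaK hb h2 bm.
have tnm := test_sub (tg n) (tg m); have tmn := test_sub (tg m) (tg n).
have Q1 := ps_quarter (fa_ps R) (tg n) tnm.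
have tmn' := test_tau s tmn.
have Q2 := ps_quarter (fa_ps R) (tg n) tmn'; rewrite (fa_tau s tmn) in Q2.
have B1 := (HN1 n m n1 mN1).1; have B2 := (HN1 m n mN1 n1).1.
have ttn := test_tau s (tg n).
have D1 := ps_Bsub (fa_ps R) (tg n) (tg n) (tg m).
have D2 := ps_Bsub (fa_ps R) (tg n) (tg m) tm.
have D3 := ps_Bsub (fa_ps R) (tg n) tm ttn; rewrite -tau_sub in D3.
exact: (closable_bound (telescope3 D1 D2 D3 sd) Q1 Q2 B1 B2 Yc).
Qed.

End Closable.

Import HBNNSimple.

(** * Integrals of functions that agree off a null set *)

Section AeIntegral.
Context d (T : measurableType d) (R : realType) (mu : {measure set T -> \bar R}).

(* the library's [ge0_ae_eq_integral] requires measurable integrands, but the elements of X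
   need only be a.e. limits of measurable functions *)
Lemma ge0_integral_off_null (N : set T) (f f' : T -> \bar R) :
  measurable N -> mu N = 0%E -> (forall z, (0 <= f z)%E) -> (forall z, (0 <= f' z)%E) ->
  (forall z, ~ N z -> f z = f' z) -> (\int[mu]_z f z <= \int[mu]_z f' z)%E.
Proof.
move=> mN N0 f0 f'0 ff'; rewrite (ge0_integralTE _ f0) (ge0_integralTE _ f'0).
have mC : measurable (~` N) by exact: measurableC.
apply: ge_ereal_sup => _ [h hf <-]; apply: ereal_sup_ubound.
exists (proj_nnsfun h mC).
  move=> z; rewrite /= mindicE.
  have [zN|zN] := boolP (z \in ~` N); last by rewrite mulr0.
  by rewrite inE in zN; rewrite mulr1 -(ff' z zN); exact: hf.
rewrite -!integralT_nnsfun; apply: ge0_ae_eq_integral.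
- exact: measurableT.
- exact/measurable_EFinP.
- exact/measurable_EFinP.
- by move=> z _; rewrite lee_fin.
- by move=> z _; rewrite lee_fin.
- exists N; split => // z /= nz; apply: contrapT => zN; apply: nz => _.
  by rewrite mindicE mem_set // mulr1.
Qed.

End AeIntegral.

Lemma int2_ae (R : realType) (h k : R * R -> R) : ae2 (fun z => h z = k z) -> int2 h = int2 k.
Proof.
move=> /ae2_null[N [mN N0 HN]]; rewrite !int2E /Rintegral; congr fine.
have off := @ge0_integral_off_null _ _ R (@lebesgue_measure R \x @lebesgue_measure R)%E N _ _ mN N0.
rewrite integralE [RHS]integralE; congr (_ - _)%E; apply/eqP; rewrite eq_le; apply/andP; split;
  by apply: off => // z /HN E; rewrite ?funeposE ?funenegE E.
Qed.

(** * Continuity of a form along Cauchy sequences *)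

Section Closeness.
Variables (R : realType) (V : lmodType R) (P : V -> Prop) (B : V -> V -> R).
Hypothesis HB : psform P B.

(** The Cauchy property across two sequences. With [y = x] it is the usual one, and with [y]
    constant it is convergence, so a single continuity lemma covers [ip0] and the L2 product. *)
Definition near_seq (x y : nat -> V) := forall e : R, 0 < e ->
  exists N, forall j k, (N <= j)%N -> (N <= k)%N -> B (x j - y k) (x j - y k) <= e.

Lemma ps_N_le x y : P x -> P y -> B x x <= 2 * B (x - y) (x - y) + 2 * B y y.
Proof.
move=> px py; have := ps_ge0 HB (ps_comb HB 1 (-2) px py).
rewrite (ps_NB HB) // (ps_N_mix HB) //; lra.
Qed.

Lemma ps_close x x' y y' (e M : R) : 0 <= e -> 0 <= M -> P x -> P x' -> P y -> P y' ->
  B (x - x') (x - x') <= e -> B (y - y') (y - y') <= e -> B y y <= M -> B x' x' <= M ->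
  `|B x y - B x' y'| <= 2 * Num.sqrt (e * M).
Proof.
move=> e0 M0 px px' py py' ex ey yM xM.
have C z w : P z -> P w -> B z z <= e -> B w w <= M -> `|B z w| <= Num.sqrt (e * M).
  move=> pz pw ze wM; rewrite -(sqrtr_sqr (B z w)) ler_wsqrtr //.
  by apply: le_trans (ps_CS HB pz pw) _; exact: ler_pM (ps_ge0 HB pz) (ps_ge0 HB pw) ze wM.
have pxx := psB HB px px'; have pyy := psB HB py py'.
have -> : B x y - B x' y' = B (x - x') y + B (y - y') x'.
  rewrite (ps_sym HB pxx py) (ps_sym HB pyy px') (ps_Bsub HB py px px') (ps_Bsub HB px' py py').
  rewrite (ps_sym HB py px) (ps_sym HB py px'); ring.
by apply: le_trans (ler_normD _ _) _; rewrite mulr_natl mulr2n lerD // C.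
Qed.

Lemma near_seq_form x x' y y' : (forall n, P (x n)) -> (forall n, P (x' n)) ->
  (forall n, P (y n)) -> (forall n, P (y' n)) -> near_seq x x' -> near_seq y y' ->
  forall e, 0 < e -> exists N, forall j k, (N <= j)%N -> (N <= k)%N ->
    `|B (x j) (y j) - B (x' k) (y' k)| <= e.
Proof.
move=> px px' py py' nx ny e e0.
have [Nx HNx] := nx 1 ltr01; have [Ny HNy] := ny 1 ltr01.
pose M := 4 + 2 * B (x Nx) (x Nx) + 2 * B (y' Ny) (y' Ny).
have M0 : 0 < M.
  by rewrite ltr_wpDr ?mulr_ge0 ?(ps_ge0 HB) // ltr_wpDr ?mulr_ge0 ?(ps_ge0 HB).
pose d := (e / 2) ^+ 2 / M.
have e2 : 0 < e / 2 by rewrite divr_gt0.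
have d0 : 0 < d by rewrite divr_gt0 // exprn_gt0.
have [N1 H1] := nx d d0; have [N2 H2] := ny d d0.
exists (maxn (maxn Nx Ny) (maxn N1 N2)) => j k.
rewrite !geq_max => /andP[/andP[jx jy] /andP[j1 j2]] /andP[/andP[kx ky] /andP[k1 k2]].
have bx : B (x' k) (x' k) <= M.
  have h1 := ps_N_le (px' k) (px Nx); have h2 := HNx Nx k (leqnn _) kx.
  have h3 := ps_ge0 HB (py' Ny).
  have E : B (x' k - x Nx) (x' k - x Nx) = B (x Nx - x' k) (x Nx - x' k).
    rewrite (ps_NB HB (px' k) (px Nx)) (ps_NB HB (px Nx) (px' k)) (ps_sym HB (px' k) (px Nx)); ring.
  rewrite E in h1; rewrite /M; lra.
have by_ : B (y j) (y j) <= M.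
  have h1 := ps_N_le (py j) (py' Ny); have h2 := HNy j Ny jy (leqnn _).
  by have h3 := ps_ge0 HB (px Nx); rewrite /M; lra.
apply: le_trans (ps_close (ltW d0) (ltW M0) (px j) (px' k) (py j) (py' k)
  (H1 j k j1 k1) (H2 j k j2 k2) by_ bx) _.
rewrite /d divfK ?gt_eqF // sqrtr_sqr gtr0_norm //; lra.
Qed.

Lemma near_seq_cvg x x' y y' (l : R) : (forall n, P (x n)) -> (forall n, P (x' n)) ->
  (forall n, P (y n)) -> (forall n, P (y' n)) -> near_seq x x' -> near_seq y y' ->
  B (x' n) (y' n) @[n --> \oo] --> l -> B (x n) (y n) @[n --> \oo] --> l.
Proof.
move=> px px' py py' nx ny /cvgrPdist_le Hl; apply/cvgrPdist_le => e e0.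
have e2 : 0 < e / 2 by rewrite divr_gt0.
have [N HN] := near_seq_form px px' py py' nx ny e2.
near=> n; have Nn : (N <= n)%N by near: n; exists N.
have h1 : `|l - B (x' n) (y' n)| <= e / 2 by near: n; exact: Hl.
have h2 := HN n n Nn Nn; rewrite distrC in h2.
have := ler_normD (l - B (x' n) (y' n)) (B (x' n) (y' n) - B (x n) (y n)).
rewrite addrA subrK => h; apply: le_trans h _; lra.
Unshelve. all: by end_near.
Qed.

Lemma near_seq_cauchy_cvg x y : (forall n, P (x n)) -> (forall n, P (y n)) ->
  near_seq x x -> near_seq y y -> cvgn (fun n => B (x n) (y n)).
Proof.
move=> px py nx ny; apply: cauchy_cvg; apply/cauchy_exP => e e0.
have e2 : 0 < e / 2 by rewrite divr_gt0.
have [N HN] := near_seq_form px px py py nx ny e2.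
exists (B (x N) (y N)); exists N => // n /= Nn.
by apply: le_lt_trans (HN N n (leqnn _) Nn) _; lra.
Qed.

End Closeness.

Section L2.
Variable R : realType.
Implicit Types u v w : fnt R.

Lemma normM_le (a b : R) : `|a * b| <= a ^+ 2 + b ^+ 2.
Proof.
have := sqr_ge0 (a + b); have := sqr_ge0 (a - b); have := sqr_ge0 a; have := sqr_ge0 b.
rewrite ler_norml sqrrB sqrrD !expr2 => h1 h2 h3 h4; apply/andP; split; lra.
Qed.

Definition l2P u : Prop := meas2 u /\ intg2 (fun z => u z ^+ 2).
Definition l2B u v : R := int2 (fun z => u z * v z).

Lemma l2_intgM u v : l2P u -> l2P v -> intg2 (fun z => u z * v z).
Proof.
move=> [mu_ iu] [mv iv]; apply: (intg2_le (meas2M mu_ mv) (intg2D iu iv)) => z.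
exact: normM_le.
Qed.

Lemma l2_ps : psform (V := fnt R) l2P l2B.
Proof.
split.
- move=> c u v [mu_ iu] [mv iv]; have muv := l2_intgM (conj mu_ iu) (conj mv iv).
  split; first exact: meas2D (meas2Z c mu_) mv.
  have := intg2D (intg2D (intg2Z (c ^+ 2) iu) (intg2Z (2 * c) muv)) iv.
  congr intg2; apply/funext => z.
  by change ((c *: u + v) z) with (c * u z + v z); move: (u z) (v z) => a b; ring.
- move=> c u v w lu lv lw; have iuw := l2_intgM lu lw; have ivw := l2_intgM lv lw.
  rewrite /l2B -(int2Z _ iuw) -(int2D (intg2Z c iuw) ivw); congr int2.
  apply/funext => z.
  by change ((c *: u + v) z) with (c * u z + v z); move: (u z) (v z) => a b; ring.
- by move=> u v _ _; congr int2; apply/funext => z; rewrite mulrC.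
- by move=> u _; apply: int2_ge0 => z; rewrite -expr2 sqr_ge0.
Qed.

End L2.

Lemma subrACA (V : zmodType) (a b c d : V) : (a - b) - (c - d) = (a - c) - (b - d).
Proof. by rewrite !opprD !opprK addrACA. Qed.

(** * The space [X] through primitives and measurable representatives *)

Section XSpace.
Variable R : realType.
Implicit Types (u v : R * R -> R) (g h : nat -> fnt R).

(** An element [u] of [X] comes with primitives [g] of an approximating sequence and a measurable
    version [w]: Fatou and differentiation under the integral are applied to [w], and [int2_ae]
    returns the results to [u]. *)
Record xrep u g (w : R * R -> R) : Prop := XRep {
  xr_test : forall n, test (g n);
  xr_cauchy : cauchyY g;
  xr_meas : meas2 w;
  xr_cvg : ae2 (fun z => Dx (g n) z @[n --> \oo] --> w z);
  xr_ae : ae2 (fun z => u z = w z) }.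

Lemma approx_xrep u s : Defs.approx u s ->
  exists g w, xrep u g w /\ s = (fun n => Dx (g n)).
Proof.
move=> /approx_elim[g [tg -> cu cg]].
have mg n : meas2 (Dx (g n)) := cc2_meas (test_cc (test_Dx (tg n))).
have cu' : ae2 (fun z => cvgn (fun n => Dx (g n) z)).
  by apply: ae2S cu => z cz; apply/cvg_ex; exists (u z).
have [w mw cw] := ae2_cvg_measurable mg cu'; exists g, w; split => //; split => //.
apply: (ae2S2 _ cu cw) => z c1 c2; exact: (cvg_unique _ c1 c2).
Qed.

Lemma inX_xrep u : inX u -> exists g w, xrep u g w.
Proof. by move=> [s /approx_xrep[g [w [? _]]]]; exists g, w. Qed.

Lemma xrep_approx u g w : xrep u g w -> Defs.approx u (fun n => Dx (g n)).
Proof.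
move=> X; apply: (approx_intro (xr_test X) _ (xr_cauchy X)).
by apply: (ae2S2 _ (xr_cvg X) (xr_ae X)) => z c ->.
Qed.

Lemma xrep_inX u g w : xrep u g w -> inX u.
Proof. by move=> /xrep_approx; exists (fun n => Dx (g n)). Qed.

Lemma xrep_cvg u g w : xrep u g w -> ae2 (fun z => Dx (g n) z @[n --> \oo] --> u z).
Proof. by move=> X; apply: (ae2S2 _ (xr_cvg X) (xr_ae X)) => z c ->. Qed.

(** The difference of two representing sequences is Cauchy with derivatives tending to 0 almost
    everywhere, so [closable] applies to it. *)
Lemma xrep_near_fa u g w g' w' : xrep u g w -> xrep u g' w' ->
  near_seq (V := fnt R) (@fa R) g g'.
Proof.
move=> X X'; have tg := xr_test X; have tg' := xr_test X'.
have td n : test (g n - g' n : fnt R) := test_sub (tg n) (tg' n).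
have cd : cauchyY (fun n => g n - g' n).
  move=> e e0; have e4 : 0 < e / 4 by rewrite divr_gt0.
  have [N HN] := xr_cauchy X e4; have [N' HN'] := xr_cauchy X' e4.
  exists (maxn N N') => j k; rewrite !geq_max => /andP[j1 j2] /andP[k1 k2].
  have [h1 h2] := HN j k j1 k1; have [h1' h2'] := HN' j k j2 k2.
  have tj := test_sub (tg j) (tg k); have tj' := test_sub (tg' j) (tg' k).
  rewrite (subrACA (V := fnt R)); split.
    exact: le_trans (ps_Nsub_le (fa_ps R) tj tj') (quarter_sum h1 h1').
  exact: le_trans (ps_Nsub_le (fb_ps R) tj tj') (quarter_sum h2 h2').
have ad : ae2 (fun z => Dx (g n - g' n) z @[n --> \oo] --> (0 : R)).
  apply: (ae2S2 _ (xrep_cvg X) (xrep_cvg X')) => z c c'.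
  under eq_fun => n do rewrite (Dx_sub z (tg n) (tg' n)).
  by rewrite -(subrr (u z)); apply: (@cvgB _ R^o); [exact: c|exact: c'].
move=> e e0; have e4 : 0 < e / 4 by rewrite divr_gt0.
have [N HN] := closable td cd ad e4; have [N' HN'] := xr_cauchy X e4.
exists (maxn N N') => j k; rewrite !geq_max => /andP[j1 j2] /andP[k1 k2].
have h1 := (HN k k1).1; have h2 := (HN' j k j2 k2).1.
exact: le_trans (ps_tri2 (fa_ps R) (tg j) (tg k) (tg' k)) (quarter_sum h2 h1).
Qed.

(** The sequences selected in [aseq] are themselves representing sequences, so the limit defining
    [ip0] exists and can be computed along any others. *)
Lemma xrep_ip0 u g w v h w' : xrep u g w -> xrep v h w' ->
  fa (g n) (h n) @[n --> \oo] --> ip0 u v.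
Proof.
move=> X X'.
have au : Defs.approx u (aseq u) by apply: xgetPex; exact: xrep_inX X.
have av : Defs.approx v (aseq v) by apply: xgetPex; exact: xrep_inX X'.
have [gu [wu [Xu Eu]]] := approx_xrep au.
have [gv [wv [Xv Ev]]] := approx_xrep av.
have tgu := xr_test Xu; have tgv := xr_test Xv.
have E : ip0 u v = limn (fun n => fa (gu n) (gv n)).
  rewrite /ip0 Eu Ev; apply: (congr1 (fun f : nat -> R => limn f)).
  apply/funext => n; exact: ipY0E (tgu n) (tgv n).
rewrite E; apply: (near_seq_cvg (fa_ps R) (xr_test X) tgu (xr_test X') tgv
  (xrep_near_fa X Xu) (xrep_near_fa X' Xv)).
exact: (near_seq_cauchy_cvg (fa_ps R) tgu tgv (xrep_near_fa Xu Xu) (xrep_near_fa Xv Xv)).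
Qed.

(** For fixed [n], Fatou in [m] on [g n - g m] bounds the L2 distance from [Dx (g n)] to [w];
    integrability of [w^2] follows by difference. *)
Lemma xrep_l2 u g w : xrep u g w ->
  l2P w /\ near_seq (V := fnt R) (@l2B R) (fun n => Dx (g n)) (fun=> w).
Proof.
move=> X; have tg := xr_test X.
have lg n : l2P (Dx (g n)).
  have c := test_cc (test_Dx (tg n)); split; first exact: cc2_meas c.
  exact: cc2_int (cc2X2 c).
have F n N e : (forall m, (N <= m)%N -> fb (g n - g m) (g n - g m) <= e) ->
    intg2 (fun z => (Dx (g n) z - w z) ^+ 2) /\ int2 (fun z => (Dx (g n) z - w z) ^+ 2) <= e.
  move=> H; apply: (@fatou2 R (fun m z => Dx (g n - g m) z ^+ 2) _ e N).
  - by move=> m; exact: cc2_int (cc2X2 (test_cc (test_Dx (test_sub (tg n) (tg m))))).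
  - by move=> m z; exact: sqr_ge0.
  - apply: (meas2_comp (F := fun x : R => x ^+ 2)); first exact: exprn_continuous.
    exact: meas2B (lg n).1 (xr_meas X).
  - by move=> z; exact: sqr_ge0.
  - apply: ae2S (xr_cvg X) => z wz; under eq_fun => m do rewrite (Dx_sub z (tg n) (tg m)).
    have H' : (Dx (g n) z - Dx (g m) z) @[m --> \oo] --> Dx (g n) z - w z.
      by apply: (@cvgB _ R^o); [exact: cvg_cst|exact: wz].
    exact: (cvgM H' H').
  - by move=> m Nm; rewrite -fbE; exact: H.
have [N1 HN1] := xr_cauchy X ltr01.
have I1 := (F N1 N1 1 (fun m Nm => (HN1 N1 m (leqnn _) Nm).2)).1.
have ld : l2P (fun z => Dx (g N1) z - w z).
  by split => //; exact: meas2B (lg N1).1 (xr_meas X).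
have lw : l2P w.
  have := psB (l2_ps R) (lg N1) ld; congr l2P; apply/funext => z.
  by change (Dx (g N1) z - (Dx (g N1) z - w z) = w z); rewrite opprB addrC subrK.
split; first exact: lw.
move=> e e0; have [N HN] := xr_cauchy X e0; exists N => j k jN kN.
exact: (F j N e (fun m Nm => (HN j m jN Nm).2)).2.
Qed.

Lemma xrep_int2 u g w v h w' : xrep u g w -> xrep v h w' ->
  fb (g n) (h n) @[n --> \oo] --> int2 (fun z => u z * v z).
Proof.
move=> X X'; have [lw nw] := xrep_l2 X; have [lw' nw'] := xrep_l2 X'.
have -> : int2 (fun z => u z * v z) = l2B w w'.
  by apply: int2_ae; apply: (ae2S2 _ (xr_ae X) (xr_ae X')) => z -> ->.
have lD n (f : nat -> fnt R) : test (f n) -> l2P (Dx (f n)).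
  move=> tf; have c := test_cc (test_Dx tf); split; first exact: cc2_meas c.
  exact: cc2_int (cc2X2 c).
have H := @near_seq_cvg R (fnt R) (@l2P R) (@l2B R) (l2_ps R) (fun n => Dx (g n)) (fun=> w)
  (fun n => Dx (h n)) (fun=> w') (l2B w w') (fun n => lD n g (xr_test X n)) (fun=> lw)
  (fun n => lD n h (xr_test X' n)) (fun=> lw') nw nw' (cvg_cst _).
exact: H.
Qed.

Lemma comb_small (t e x y n : R) : 0 < e -> x <= e / (4 * (1 + t ^+ 2)) ->
  y <= e / (4 * (1 + t ^+ 2)) -> n = (- t) ^+ 2 * y -> 2 * x + 2 * n <= e.
Proof.
move=> + + + ->; rewrite sqrrN; have := sqr_ge0 t; move: (t ^+ 2) => s s0 e0.
have p : 0 < 4 * (1 + s) by lra.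
rewrite !ler_pdivlMr // => hx hy; rewrite -(ler_pM2r p).
have := mulr_ge0 s0 (ltW e0); have := ler_wpM2l s0 hy; lra.
Qed.

Lemma xrep_comb u g w v h w' (t : R) : xrep u g w -> xrep v h w' ->
  xrep (u \+ t *: v) (fun n => g n + t *: h n) (fun z => w z + t * w' z).
Proof.
move=> X X'; have tg := xr_test X; have th := xr_test X'; split.
- by move=> n; have := ps_comb (fa_ps R) 1 t (tg n) (th n); rewrite scale1r.
- move=> e e0; pose M := 4 * (1 + t ^+ 2).
  have M0 : 0 < M by rewrite mulr_gt0 // ltr_wpDr // sqr_ge0.
  have eM : 0 < e / M by rewrite divr_gt0.
  have [N HN] := xr_cauchy X eM; have [N' HN'] := xr_cauchy X' eM.
  exists (maxn N N') => j k; rewrite !geq_max => /andP[j1 j2] /andP[k1 k2].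
  have [h1 h2] := HN j k j1 k1; have [h1' h2'] := HN' j k j2 k2.
  have tj := test_sub (tg j) (tg k); have tj' := test_sub (th j) (th k).
  have -> : g j + t *: h j - (g k + t *: h k) = (g j - g k) - (- t) *: (h j - h k) :> fnt R.
    by rewrite scaleNr opprK opprD addrACA scalerBr.
  have ttj := test_scale (- t) tj'.
  have za := ps_NZ (fa_ps R) (- t) tj'; have zb := ps_NZ (fb_ps R) (- t) tj'.
  split; first exact: le_trans (ps_Nsub_le (fa_ps R) tj ttj) (comb_small e0 h1 h1' za).
  exact: le_trans (ps_Nsub_le (fb_ps R) tj ttj) (comb_small e0 h2 h2' zb).
- exact: meas2D (xr_meas X) (meas2Z t (xr_meas X')).
- apply: (ae2S2 _ (xr_cvg X) (xr_cvg X')) => z c c'.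
  have E n : Dx (g n + t *: h n) z = Dx (g n) z + t * Dx (h n) z.
    by have := Dx_mix 1 t z (tg n) (th n); rewrite scale1r mul1r.
  under eq_fun => n do rewrite E.
  apply: (@cvgD _ R^o); first exact: c.
  by apply: (@cvgM R); [exact: cvg_cst|exact: c'].
- apply: (ae2S2 _ (xr_ae X) (xr_ae X')) => z E E'.
  by change (u z + t * v z = w z + t * w' z); rewrite E E'.
Qed.

Lemma quad_cvg (x y z : nat -> R) (a b c t : R) :
  x n @[n --> \oo] --> a -> y n @[n --> \oo] --> b -> z n @[n --> \oo] --> c ->
  (x n + 2 * t * y n + t ^+ 2 * z n) @[n --> \oo] --> a + 2 * t * b + t ^+ 2 * c.
Proof.
move=> hx hy hz; apply: (@cvgD _ R^o); first apply: (@cvgD _ R^o); first exact: hx.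
  by apply: (@cvgM R); [exact: cvg_cst|exact: hy].
by apply: (@cvgM R); [exact: cvg_cst|exact: hz].
Qed.

Lemma form_comb (B : fnt R -> fnt R -> R) (HB : psform (V := fnt R) (@test R) B) (x y : fnt R) (t : R) :
  test x -> test y -> B (x + t *: y) (x + t *: y) = B x x + 2 * t * B x y + t ^+ 2 * B y y.
Proof.
by move=> tx ty; have := ps_N_mix HB 1 t tx ty; rewrite scale1r expr1n !mul1r.
Qed.

(** The combination [g + t h] represents [u + t v], though it is unrelated to the sequence that
    [aseq] selects for [u + t v]; [xrep_ip0] is what permits its use. *)
Lemma ip0_expand u v (t : R) : inX u -> inX v ->
  ip0 (u \+ t *: v) (u \+ t *: v) = ip0 u u + 2 * t * ip0 u v + t ^+ 2 * ip0 v v.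
Proof.
move=> /inX_xrep[g [w X]] /inX_xrep[h [w' X']]; have Y := xrep_comb t X X'.
have H := xrep_ip0 Y Y.
have E : (fun n => fa (g n + t *: h n : fnt R) (g n + t *: h n : fnt R)) =
    (fun n => fa (g n) (g n) + 2 * t * fa (g n) (h n) + t ^+ 2 * fa (h n) (h n)).
  by apply/funext => n; exact (form_comb (fa_ps R) t (xr_test X n) (xr_test X' n)).
rewrite E in H.
have Q := quad_cvg (t := t) (xrep_ip0 X X) (xrep_ip0 X X') (xrep_ip0 X' X').
exact: etrans (esym (cvg_lim (@Rhausdorff R) H)) (cvg_lim (@Rhausdorff R) Q).
Qed.

Lemma int2_expand u v (t : R) : inX u -> inX v ->
  int2 (fun z => (u \+ t *: v) z ^+ 2) =
    int2 (fun z => u z ^+ 2) + 2 * t * int2 (fun z => u z * v z) + t ^+ 2 * int2 (fun z => v z ^+ 2).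
Proof.
move=> /inX_xrep[g [w X]] /inX_xrep[h [w' X']]; have Y := xrep_comb t X X'.
have H := xrep_int2 Y Y.
have E : (fun n => fb (g n + t *: h n : fnt R) (g n + t *: h n : fnt R)) =
    (fun n => fb (g n) (g n) + 2 * t * fb (g n) (h n) + t ^+ 2 * fb (h n) (h n)).
  by apply/funext => n; exact (form_comb (fb_ps R) t (xr_test X n) (xr_test X' n)).
rewrite E in H.
have Q := quad_cvg (t := t) (xrep_int2 X X) (xrep_int2 X X') (xrep_int2 X' X').
exact: etrans (esym (cvg_lim (@Rhausdorff R) H)) (cvg_lim (@Rhausdorff R) Q).
Qed.

Lemma cvgn_ge0 (x : nat -> R) (l : R) : x n @[n --> \oo] --> l ->
  (forall n, 0 <= x n) -> 0 <= l.
Proof.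
move=> H x0; rewrite -(cvg_lim (@Rhausdorff R) H); apply: limr_ge.
  by apply/cvg_ex; exists l.
exact: nearW.
Qed.

Lemma ip0_ge0 u : inX u -> 0 <= ip0 u u.
Proof.
move=> /inX_xrep[g [w X]].
apply: (cvgn_ge0 (xrep_ip0 X X)) => n; exact: (ps_ge0 (fa_ps R) (xr_test X n)).
Qed.

(** Fatou transfers an upper bound of [Phi] by the two squared norms from test functions to [X],
    provided that the bound converges along the sequence. *)
Lemma xrep_Phi q (C : R -> R -> R) u g w : 2 < q -> xrep u g w ->
  (forall x, test x -> Phi q (Dx x) <= C (fa x x) (fb x x)) ->
  C (fa (g n) (g n)) (fb (g n) (g n)) @[n --> \oo] --> C (ip0 u u) (int2 (fun z => u z ^+ 2)) ->
  intg2 (fun z => `|w z| `^ q) /\ Phi q w <= C (ip0 u u) (int2 (fun z => u z ^+ 2)).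
Proof.
move=> q2 X HC cC; have tg := xr_test X; set c := C (ip0 u u) _ in cC *.
have q0 : 0 < q by apply: lt_trans q2.
have cpow := normpow_continuous q0.
have F e : 0 < e -> intg2 (fun z => `|w z| `^ q) /\ Phi q w <= c + e * 1.
  move=> e0; move/cvgrPdist_le : cC => /(_ e e0)[N _ HN].
  apply: (@fatou2 R (fun m z => `|Dx (g m) z| `^ q) (fun z => `|w z| `^ q) (c + e * 1) N).
  - by move=> m; exact: cc2_int (cc2_normpow q2 (test_cc (test_Dx (tg m)))).
  - by move=> m z; exact: powR_ge0.
  - exact: meas2_comp cpow (xr_meas X).
  - by move=> z; exact: powR_ge0.
  - apply: ae2S (xr_cvg X) => z tz.
    by apply: (@cvg_comp _ _ _ (fun n => Dx (g n) z) (fun x => `|x| `^ q)) tz _; exact: cpow.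
  - move=> m /HN /=; rewrite ler_distlC => /andP[_ h].
    by apply: le_trans (HC _ (tg m)) _; rewrite mulr1.
split; first exact: (F 1 ltr01).1.
by apply: (@le_eps R _ _ 1) => // d d0 _; exact: (F d d0).2.
Qed.

End XSpace.

(** * A nonzero test function *)

Section Bump.
Variable R : realType.

(* The family [s^-k exp(-1/s)] is closed under differentiation up to linear combinations, so [elem]
   below is closed under directional derivatives and consists of smooth functions. *)
Definition psi (k : nat) (s : R) : R := if 0 < s then s^-1 ^+ k * expR (- s^-1) else 0.

(** With [i = 1/s], the single term [i^(k+1) / (k+1)!] of the exponential series suffices. Since
    dividing [psi k] by its argument gives [psi k.+1], the same bound also shows that the derivative
    at 0 is 0. *)
Lemma psi_small k s : `|psi k s| <= (k.+1)`!%:R * `|s|.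
Proof.
rewrite /psi; case: ifPn => s0; last by rewrite normr0 mulr_ge0.
have i0 : 0 < s^-1 by rewrite invr_gt0.
rewrite (gtr0_norm s0) ger0_norm ?mulr_ge0 ?exprn_ge0 ?expR_ge0 ?(ltW i0) //.
have F0 : 0 < (k.+1)`!%:R :> R by rewrite ltr0n fact_gt0.
rewrite expRN ler_pdivrMr ?expR_gt0 //.
have := expR_ge1Dxn k (ltW i0); move: (s^-1) i0 (invrK s) => i i0 <- h.
have : i ^+ k.+1 / (k.+1)`!%:R <= expR i by apply: le_trans h; lra.
rewrite ler_pdivrMr // exprS => h'.
by rewrite mulrAC ler_pdivlMr // mulrC [leRHS]mulrC.
Qed.

Lemma psi_derive k s : is_derive s (1:R) (psi k) (- k%:R * psi k.+1 s + psi k.+2 s).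
Proof.
have [s0|s0|->] := ltgtP s 0.
- apply: (@near_eq_is_derive R R^o R^o (cst 0)).
    near=> t; have t0 : t < 0 by near: t; exact: (@lt_nbhsl R).
    by rewrite /psi ltNge (ltW t0).
  rewrite /psi ltNge (ltW s0) /= mulr0 addr0; exact: is_derive_cst.
- apply: (@near_eq_is_derive R R^o R^o (fun s => s^-1 ^+ k * expR (- s^-1))).
    near=> t; have t0 : 0 < t by near: t; exact: (@lt_nbhsr R).
    by rewrite /psi t0.
  have dV := is_deriveV (lt0r_neq0 s0) (is_derive_id s (1:R)).
  have dE : is_derive s (1:R) (fun s => expR (- s^-1)) (expR (- s^-1) * s^-1 ^+ 2).
    apply: (is_derive_eq (@is_derive1_comp R expR (fun s => - s^-1) s _ _ (is_derive_expR _) (is_deriveN dV))).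
    by rewrite /GRing.scale /= mulr1 opprK exprVn.
  have dV' : is_derive s (1:R) (fun s => s^-1) (- (s^-1 ^+ 2)).
    by apply: (is_derive_eq dV); rewrite /GRing.scale /= mulr1 exprVn.
  have dX : is_derive s (1:R) (fun s => s^-1 ^+ k) (- k%:R * s^-1 ^+ k.+1).
    elim: k => [|k IH]; first by rewrite oppr0 mul0r; exact: is_derive_cst.
    rewrite (_ : (fun s => _) = (fun s => s^-1 * s^-1 ^+ k)).
      by apply: (is_derive_eq (is_derive_mul dV' IH)); rewrite -natr1 !exprS; ring.
    by apply/funext => t; rewrite exprS.
  apply: (is_derive_eq (is_derive_mul dX dE)).
  by rewrite /psi s0 !exprS; ring.
- rewrite {2 3}/psi ltxx mulr0 addr0.
  have H : (fun h : R => h^-1 *: ((psi k \o shift 0) (h *: (1:R)) - psi k 0)) @ (0:R)^' --> (0:R).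
    apply/cvgrPdist_lt => e e0; have F0 : 0 < (k.+2)`!%:R :> R by rewrite ltr0n fact_gt0.
    near=> h; have h0 : h != 0 by near: h; exact: nbhs_dnbhs_neq.
    rewrite /shift /= addr0 {2}/psi ltxx subr0 sub0r normrN /GRing.scale /= mulr1.
    have -> : h^-1 * psi k h = psi k.+1 h.
      by rewrite /psi; case: ifP => _; rewrite ?mulr0 // mulrA exprS.
    apply: le_lt_trans (psi_small _ _) _; rewrite mulrC -ltr_pdivlMr //.
    near: h; apply: (@dnbhs0_lt _ R^o); exact: divr_gt0.
  by apply: DeriveDef; [apply/cvg_ex; exists 0; exact: H|apply/cvg_lim => //; exact: H].
Unshelve. all: by end_near. Qed.

Lemma psi_continuous k : continuous (psi k).
Proof.
move=> s; apply: differentiable_continuous; apply/derivable1_diffP.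
by have [] := psi_derive k s.
Qed.

Inductive elem : (R * R -> R) -> Prop :=
| elem_cst c : elem (fun=> c)
| elem_fst : elem fst
| elem_snd : elem snd
| elem_add f g : elem f -> elem g -> elem (fun z => f z + g z)
| elem_mul f g : elem f -> elem g -> elem (fun z => f z * g z)
| elem_psi k f : elem f -> elem (fun z => psi k (f z)).

Lemma elem_continuous f : elem f -> continuous f.
Proof.
elim=> {f} [c|||f g _ cf _ cg|f g _ cf _ cg|k f _ cf] z.
- exact: cvg_cst.
- exact: cvg_fst.
- exact: cvg_snd.
- by apply: (@cvgD _ R^o); [exact: cf|exact: cg].
- by apply: (@cvgM R); [exact: cf|exact: cg].
- apply: (@continuous_comp _ _ _ f (psi k)); [exact: cf|exact: psi_continuous].
Qed.

(** Directional derivatives are read along a line, where the chain rule in one variable handles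
    [psi k] composed with [f]. *)
Lemma is_derive_line (f : R * R -> R) (z v : R * R) (l : R) :
  is_derive (0 : R) (1:R) (fun h => f (z + h *: v)) l <-> is_derive z v f l.
Proof.
have E : (fun h : R => h^-1 *: ((f \o shift z) (h *: v) - f z)) =
   (fun h : R => h^-1 *: (((fun h => f (z + h *: v)) \o shift 0) (h *: 1) - f (z + 0 *: v))).
  by apply/funext => h /=; rewrite addr0 scale0r addr0 [_ + z]addrC /GRing.scale /= mulr1.
by split=> -[H <-]; apply: DeriveDef; rewrite /derivable /derive ?E //; move: H; rewrite /derivable E.
Qed.

Lemma elem_derive f : elem f -> forall v, exists2 f', elem f' & forall z, is_derive z v f (f' z).
Proof.
elim=> {f} [c|||f g ef df eg dg|f g ef df eg dg|k f ef df] v.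
- by exists (fun=> 0); [exact: elem_cst|move=> z; exact: is_derive_cst].
- exists (fun=> v.1); [exact: elem_cst|move=> z; apply/is_derive_line].
  rewrite (_ : (fun h => _) = (fun h => v.1 * h + z.1)); first exact: is_derive_affine.
  by apply/funext => h /=; rewrite addrC /GRing.scale /= mulrC.
- exists (fun=> v.2); [exact: elem_cst|move=> z; apply/is_derive_line].
  rewrite (_ : (fun h => _) = (fun h => v.2 * h + z.2)); first exact: is_derive_affine.
  by apply/funext => h /=; rewrite addrC /GRing.scale /= mulrC.
- have [f' ef' Df] := df v; have [g' eg' Dg] := dg v.
  exists (fun z => f' z + g' z); first exact: elem_add.
  by move=> z; exact: is_deriveD.
- have [f' ef' Df] := df v; have [g' eg' Dg] := dg v.
  exists (fun z => f' z * g z + f z * g' z); first by apply: elem_add; exact: elem_mul.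
  move=> z; apply: (is_derive_eq (is_deriveM (Df z) (Dg z))).
  by rewrite /GRing.scale /=; ring.
- have [f' ef' Df] := df v.
  exists (fun z => (- k%:R * psi k.+1 (f z) + psi k.+2 (f z)) * f' z).
    apply: elem_mul => //; apply: elem_add; last exact: elem_psi.
    by apply: elem_mul; [exact: elem_cst|exact: elem_psi].
  move=> z; apply/is_derive_line; have /is_derive_line D := Df z.
  have D2 := psi_derive k (f (z + 0 *: v)).
  apply: (is_derive_eq (@is_derive1_comp R (psi k) (fun h => f (z + h *: v)) 0 _ _ D2 D)).
  by rewrite scale0r addr0 /GRing.scale /= mulrC.
Qed.

Lemma elem_smooth f : elem f -> smooth f.
Proof.
move=> ef l; have el : elem (Defs.iterD l f).
  elim: l => //= v l IH; have [f' ef' Df] := elem_derive IH v.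
  rewrite (_ : (fun z => _) = f') //; apply/funext => z.
  by have D := Df z; rewrite derive_val.
split; first exact: elem_continuous.
by move=> z v; have [f' _ Df] := elem_derive el v; have [] := Df z.
Qed.

Definition parab (z : R * R) : R := 1 + (- 1 * (z.1 * z.1) + - 1 * (z.2 * z.2)).
Definition bump (z : R * R) : R := psi 0 (parab z).

Lemma elem_parab : elem parab.
Proof.
apply: elem_add (elem_cst 1) (elem_add _ _); apply: elem_mul (elem_cst _) (elem_mul _ _);
  exact: elem_fst || exact: elem_snd.
Qed.

Lemma bump_test : test bump.
Proof.
split; first exact: elem_smooth (elem_psi 0 elem_parab).
exists 1 => x y xy; rewrite /bump /psi ifF //; apply/negbTE; rewrite -leNgt /parab /=.
have h : 1 < x ^+ 2 \/ 1 < y ^+ 2.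
  by case/orP: xy => h; [left|right]; rewrite normE2 exprn_egt1.
have := sqr_ge0 x; have := sqr_ge0 y; rewrite !expr2 in h *; case: h; lra.
Qed.

Lemma Dx_bump x y : Dx bump (x, y) = - 2 * x * psi 2 (parab (x, y)).
Proof.
have D1 : is_derive x (1:R) (fun x => parab (x, y)) (- 2 * x).
  have d2 := is_derive_mul (is_derive_id x 1) (is_derive_id x 1).
  rewrite (_ : (fun x => _) = cst (1 - y * y) + (- 1) *: (fun x => x * x)).
    apply: (is_derive_eq (is_deriveD (is_derive_cst (1 - y * y) x 1) (is_deriveZ (- 1) d2))).
    by rewrite /GRing.scale /=; ring.
  apply/funext => t; change (parab (t, y) = (1 - y * y) + (- 1) * (t * t)).
  by rewrite /parab /=; ring.
have D2 := psi_derive 0 (parab (x, y)).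
have D3 := @is_derive1_comp R (psi 0) (fun x => parab (x, y)) x _ _ D2 D1.
have D4 := is_derive_x x y bump_test.1.
rewrite -(@derive_val _ _ _ _ _ _ _ D4) (@derive_val _ _ _ _ _ _ _ D3).
by rewrite /GRing.scale /= oppr0 mul0r add0r mulrC.
Qed.

(** On the open square of side 1/2 at the origin both [x] and [parab] are positive, so [Dx bump] has
    no zero there. *)
Lemma bump_not_ae0 : ~ ae2 (fun z => Dx bump z = 0).
Proof.
move=> /ae2_null[N [mN N0 HN]].
pose B : set R := [set` `]0, 1/2[%R].
have mB : measurable B by exact: measurable_itv.
have sub : B `*` B `<=` N.
  move=> [x y] [/= Bx By]; apply: contrapT => /HN.
  move: Bx By; rewrite /B /= !in_itv /= => /andP[x0 x1] /andP[y0 y1].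
  rewrite Dx_bump => /eqP; rewrite !mulf_eq0 oppr_eq0 pnatr_eq0 (gt_eqF x0) /= /psi.
  have p0 : 0 < parab (x, y).
    rewrite /parab /=; have := ltr_pM (ltW x0) (ltW x0) x1 x1.
    have := ltr_pM (ltW y0) (ltW y0) y1 y1; lra.
  by rewrite p0 mulf_eq0 expf_eq0 /= invr_eq0 (gt_eqF p0) gt_eqF // expR_gt0.
have : (leb2 (B `*` B) <= leb2 N)%E by apply: le_measure => //; rewrite inE //; exact: measurableX.
rewrite [X in (_ <= X)%E]N0 [X in (X <= _)%E]product_measure1E //.
move=> H; have {H} : (@lebesgue_measure R B * @lebesgue_measure R B <= 0)%E := H.
rewrite /B lebesgue_measure_itv /= lte_fin ifT ?divr_gt0 // -EFinD -EFinM lee_fin.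
by rewrite subr0 leNgt mulr_gt0 // divr_gt0.
Qed.

Lemma int2_sqr_eq0 (u : R * R -> R) (k : R -> R) : cc2 (fun z => k (u z)) ->
  (forall x, 0 <= k x) -> (forall x, k x = 0 -> x = 0) ->
  int2 (fun z => k (u z)) <= 0 -> ae2 (fun z => u z = 0).
Proof.
move=> ck k0 kz le0.
have i0 : (\int[(@lebesgue_measure R \x @lebesgue_measure R)%E]_z (k (u z))%:E = 0)%E.
  rewrite (int2_EFin (cc2_int ck)); congr EFin; apply/eqP; rewrite eq_le le0.
  exact: int2_ge0.
have := @ae_eq_integral_abs _ _ R (@lebesgue_measure R \x @lebesgue_measure R)%E setT measurableT
  (EFin \o (fun z => k (u z))).
move=> /(_ _)[|H _]; first by apply/measurable_EFinP; exact: cc2_meas ck.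
apply: ae2S (H _); last first.
  by rewrite -[RHS]i0; apply: eq_integral => z _ /=; rewrite ger0_norm.
by move=> z /(_ I) /= [] /kz.
Qed.

Lemma fb0_ae (g : fnt R) : test g -> fb g g <= 0 -> ae2 (fun z => Dx g z = 0).
Proof.
move=> tg; apply: (@int2_sqr_eq0 (Dx g) (fun x => x ^+ 2)).
- exact: cc2X2 (test_cc (test_Dx tg)).
- by move=> x; exact: sqr_ge0.
- by move=> x /eqP; rewrite sqrf_eq0 => /eqP.
Qed.

(** The energy does not contain g_x itself; [test_L4] is what forces g_x to vanish. *)
Lemma fa0_ae (g : fnt R) : test g -> fa g g <= 0 -> ae2 (fun z => Dx g z = 0).
Proof.
move=> tg le0; apply: (@int2_sqr_eq0 (Dx g) (fun x => x ^+ 4)).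
- exact: cc2X4 (test_cc (test_Dx tg)).
- by move=> x; rewrite exprn_even_ge0.
- by move=> x /eqP; rewrite expf_eq0 => /andP[_ /eqP].
- apply: le_trans (test_L4 tg) _; apply: mulr_le0_ge0 => //.
  by apply: addr_ge0; [exact: ps_ge0 (fb_ps R) _ tg|exact: ps_ge0 (fa_ps R) _ tg].
Qed.

Lemma bump_fb : 0 < fb bump bump.
Proof.
by rewrite ltNge; apply/negP => le0; apply: bump_not_ae0; exact: fb0_ae bump_test le0.
Qed.

Lemma bump_fa : 0 < fa bump bump.
Proof.
by rewrite ltNge; apply/negP => le0; apply: bump_not_ae0; exact: fa0_ae bump_test le0.
Qed.

Lemma bump_Phi q : 2 < q -> 0 < Phi q (Dx bump).
Proof.
move=> q2; rewrite ltNge; apply/negP => le0; apply: bump_not_ae0.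
apply: (@int2_sqr_eq0 (Dx bump) (fun x => `|x| `^ q)) => //.
- exact (cc2_normpow q2 (test_cc (test_Dx bump_test))).
- by move=> x /eqP; rewrite powR_eq0 normr_eq0 => /andP[/eqP].
Qed.

End Bump.

(** * The sharp inequality and the ground state *)

Section GN.
Variable R : realType.

Lemma amgm (p a b : R) : 0 < p -> p < 1 -> 0 <= a -> 0 <= b ->
  a `^ p * b `^ (1 - p) <= p * a + (1 - p) * b.
Proof.
move=> p0 p1 a0 b0; have p1' : 0 < 1 - p by rewrite subr_gt0.
have := @conjugate_powR R (a `^ p) (b `^ (1 - p)) p^-1 (1 - p)^-1.
rewrite !invrK -!powRrM !divff ?gt_eqF // !powRr1 // => H.
rewrite [p * a]mulrC [_ * b]mulrC.
by apply: H; rewrite ?powR_ge0 ?invr_gt0 //; ring.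
Qed.

Lemma powR_posE (a r : R) : 0 < a -> a `^ r = expR (r * ln a).
Proof. by move=> a0; rewrite /powR gt_eqF. Qed.

Variable q : R.
Hypothesis q2 : 2 < q.
Hypothesis q103 : q < 10 / 3.
(* the exponents that make [fa^al fb^be] scale like [Phi] under every dilation [dil c t] *)
Definition al : R := 3 * (q - 2) / 4.
Definition be : R := (6 - q) / 4.

Lemma gn_exponents : [/\ 0 < al, al < 1, 0 < be, al + be = q / 2 & q < 4].
Proof. by rewrite /al /be; have := q2; have := q103 => *; split; lra. Qed.

Lemma rescale_factor (c t : R) : 0 < c -> 0 < t ->
  (`|c| * t) `^ q / t ^+ 3 = (c ^+ 2 * t) `^ al * (c ^+ 2 / t) `^ be.
Proof.
move=> c0 t0; rewrite (gtr0_norm c0) -powR_mulrn ?(ltW t0) //.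
have c20 : 0 < c ^+ 2 by rewrite exprn_gt0.
have ti : 0 < t^-1 by rewrite invr_gt0.
rewrite !powR_posE ?mulr_gt0 // -expRB -expRD !lnM ?posrE // lnV ?posrE //.
by congr expR; rewrite /al /be; field.
Qed.

(** The two equations [c^2 t = x] and [c^2 / t = y] are solved by [t = sqrt (x/y)] and
    [c^2 = sqrt (x y)]. *)
Lemma rescale (g : fnt R) (x y : R) : test g -> 0 < x -> 0 < y ->
  exists g' : fnt R, [/\ test g', fa g' g' = x * fa g g, fb g' g' = y * fb g g &
    Phi q (Dx g') = x `^ al * y `^ be * Phi q (Dx g)].
Proof.
move=> tg x0 y0; pose t := Num.sqrt (x / y); pose c := Num.sqrt (Num.sqrt (x * y)).
have xy : 0 < x * y by rewrite mulr_gt0.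
have xy' : 0 < x / y by rewrite divr_gt0.
have t0 : 0 < t by rewrite sqrtr_gt0.
have c0 : 0 < c by rewrite !sqrtr_gt0.
have c2 : c ^+ 2 = Num.sqrt (x * y) by rewrite sqr_sqrtr // sqrtr_ge0.
have E1 : c ^+ 2 * t = x.
  rewrite c2 /t -sqrtrM ?(ltW xy) // (_ : x * y * (x / y) = x ^+ 2); last by field; rewrite gt_eqF.
  by rewrite sqrtr_sqr gtr0_norm.
have E2 : c ^+ 2 / t = y.
  apply: (mulIf (lt0r_neq0 t0)); rewrite divfK ?gt_eqF //.
  apply: (mulIf (lt0r_neq0 t0)); rewrite E1 -mulrA -expr2 sqr_sqrtr ?(ltW xy') //.
  by rewrite mulrC divfK // gt_eqF.
exists (dil c t 0 0 g); split.
- exact: test_dil.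
- by rewrite (fa_dil c 0 0 t0 tg) E1.
- by rewrite (fb_dil c 0 0 t0 tg) E2.
- by rewrite (Phi_dil q2 c 0 0 tg t0) (rescale_factor c0 t0) E1 E2.
Qed.

Lemma Phi_ae0 (u : R * R -> R) : ae2 (fun z => u z = 0) -> Phi q u = 0.
Proof.
move=> u0; have q0 : q != 0 by rewrite gt_eqF // (lt_trans _ q2).
have c0 : cc2 (fun _ : R * R => 0 : R) by split; [exact: cst_continuous|exists 0].
rewrite -[RHS](mul0r (int2 (fun _ : R * R => 0 : R))) -(int2Z 0 (cc2_int c0)).
by apply: int2_ae; apply: ae2S u0 => z ->; rewrite normr0 powR0 // mulr0.
Qed.

(** [K] is the supremum of [Phi] over functions with both norms equal to 1, and [rescale] brings
    every other function to this normalisation. If one of the norms is 0 then g_x vanishes almost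
    everywhere. *)
Lemma gagliardo_nirenberg : exists K : R, [/\ 0 < K,
  forall g : fnt R, test g -> Phi q (Dx g) <= K * (fa g g `^ al * fb g g `^ be) &
  forall d, 0 < d -> exists g : fnt R,
    [/\ test g, fa g g = 1, fb g g = 1 & K - d < Phi q (Dx g)]].
Proof.
have [al0 _ be0 _ _] := gn_exponents.
pose E := [set x : R | exists g : fnt R, [/\ test g, fa g g = 1, fb g g = 1 & x = Phi q (Dx g)]].
have normalize g : test g -> 0 < fa g g -> 0 < fb g g ->
    E ((fa g g)^-1 `^ al * (fb g g)^-1 `^ be * Phi q (Dx g)).
  move=> tg a0 b0.
  have ai : 0 < (fa g g)^-1 by rewrite invr_gt0.
  have bi : 0 < (fb g g)^-1 by rewrite invr_gt0.
  have [g' [tg' fa' fb' Phi']] := rescale tg ai bi.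
  exists g'; rewrite fa' fb' Phi' !mulVf ?gt_eqF //.
have Ebump := normalize _ (@bump_test R) (@bump_fa R) (@bump_fb R).
have supE : has_sup E.
  split; first by eexists; exact: Ebump.
  (* [Phi] is at most the integral of [u^2], here 1, plus that of [u^4], here at most
     [1 * (1 + 1)]. *)
  exists 3 => _ [g [tg fa1 fb1 ->]].
  apply: (le_trans (Phi_le q2 (let: And5 _ _ _ _ h := gn_exponents in h) (test_cc (test_Dx tg)))).
  have := test_L4 tg; rewrite -fbE fa1 fb1; move: (int2 _) => x; lra.
exists (sup E); split.
- apply: lt_le_trans (sup_upper_bound supE Ebump).
  by rewrite !mulr_gt0 ?powR_gt0 ?invr_gt0 ?bump_fa ?bump_fb // bump_Phi.
- move=> g tg; have a0 := ps_ge0 (fa_ps R) tg; have b0 := ps_ge0 (fb_ps R) tg.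
  have K0 : 0 <= sup E.
    apply: le_trans (sup_upper_bound supE Ebump).
    by rewrite !mulr_ge0 ?powR_ge0 // Phi_ge0.
  have [b1|b1] := leP (fb g g) 0.
    by rewrite (Phi_ae0 (fb0_ae tg b1)) !mulr_ge0 ?powR_ge0.
  have [a1|a1] := leP (fa g g) 0.
    by rewrite (Phi_ae0 (fa0_ae tg a1)) !mulr_ge0 ?powR_ge0.
  have := sup_upper_bound supE (normalize g tg a1 b1).
  have inv (x r : R) : 0 < x -> x^-1 `^ r = (x `^ r)^-1.
    by move=> x0; rewrite -powR_inv1 ?(ltW x0) // -powRrM mulN1r powRN.
  rewrite !inv // -invfM [_ * Phi _ _]mulrC ler_pdivrMr // mulr_gt0 // powR_gt0 //.
- move=> d d0; have [x [g [tg fa1 fb1 ->]] lt] := sup_adherent d0 supE.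
  by exists g.
Qed.

End GN.

(* [As] minimises [x/2 - K x^al b^be / q]; the last two clauses are its minimality and the linear
   bound of the product by [l1 x + l2 y], tangent at [(As, b)]. *)
Lemma parameters (R : realType) (q al be K b : R) :
  0 < q -> 0 < al -> al < 1 -> 0 < be -> al + be = q / 2 -> 0 < K -> 0 < b -> exists As Lam l1 l2 : R,
  [/\ [/\ 0 < As, 0 < Lam, 0 < l1 & 0 < l2], l1 * As + l2 * b = 1,
      Lam * l1 = 1 /\ Lam = K * (As `^ al * b `^ be),
      forall x y, 0 <= x -> 0 <= y -> K * (x `^ al * y `^ be) <= Lam * (l1 * x + l2 * y) `^ (q / 2) &
      forall x, 0 <= x -> As / 2 - Lam / q <= x / 2 - K * (x `^ al * b `^ be) / q].
Proof.
move=> q0 al0 al1 be0 ab K0 b0.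
have al1' : 0 < 1 - al by rewrite subr_gt0.
pose c := K * b `^ be / q.
have c0 : 0 < c by rewrite divr_gt0 // mulr_gt0 // powR_gt0.
have c20 : 0 < 2 * c * al by apply: mulr_gt0 al0; exact: mulr_gt0 c0.
(* The zero of the derivative of [x/2 - c x^al], namely [x^(1 - al) = 2 c al]. *)
pose As := (2 * c * al) `^ (1 - al)^-1.
have As0 : 0 < As by rewrite powR_gt0.
have EAs : As `^ (1 - al) = 2 * c * al.
  by rewrite /As -powRrM mulVf ?gt_eqF // powRr1 // ltW.
have EA2 : As `^ al * (2 * c * al) = As.
  rewrite -EAs -powRD; last by apply/implyP => _; rewrite gt_eqF.
  by rewrite addrC subrK powRr1 // ltW.
have Asal : 0 < As `^ al by rewrite powR_gt0.
pose Lam := K * (As `^ al * b `^ be).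
have EL : Lam = q * As / (2 * al).
  rewrite -[As in RHS]EA2 /Lam /c; field.
  by rewrite gt_eqF // gt_eqF.
have L0 : 0 < Lam by rewrite EL divr_gt0 // mulr_gt0.
(* The weights [p] and [1 - p] are [al] and [be] divided by [q/2]. The weighted AM-GM inequality for
   [x / As] and [y / b], raised to the power [q/2], restores the exponents, with equality at
   [(As, b)]. *)
pose p := 2 * al / q.
have p0 : 0 < p by rewrite divr_gt0 // mulr_gt0.
have p1 : p < 1 by rewrite /p ltr_pdivrMr // mul1r; lra.
have p1' : 0 < 1 - p by rewrite subr_gt0.
have pr : p * (q / 2) = al by rewrite /p; field; rewrite gt_eqF.
have pr' : (1 - p) * (q / 2) = be by rewrite mulrBl mul1r pr; lra.
exists As, Lam, (p / As), ((1 - p) / b); split.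
- by split => //; rewrite divr_gt0.
- by rewrite !divfK ?gt_eqF // addrC subrK.
- by split => //; rewrite EL /p; field; rewrite !gt_eqF.
- move=> x y x0 y0.
  have xA0 : 0 <= x / As by rewrite divr_ge0 // ltW.
  have yb0 : 0 <= y / b by rewrite divr_ge0 // ltW.
  have r0 : 0 <= q / 2 by rewrite divr_ge0 // ltW.
  have H : ((x / As) `^ p * (y / b) `^ (1 - p)) `^ (q / 2) <= (p / As * x + (1 - p) / b * y) `^ (q / 2).
    apply: powR_le => //; first by rewrite mulr_ge0 // powR_ge0.
    by rewrite mulrAC -mulrA [(1 - p) / b * y]mulrAC -[(1 - p) * y / b]mulrA; exact: amgm.
  rewrite powRM ?powR_ge0 // -!powRrM pr pr' in H.
  have Ex : x `^ al = (x / As) `^ al * As `^ al by rewrite -powRM ?(ltW As0) // divfK ?gt_eqF.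
  have Ey : y `^ be = (y / b) `^ be * b `^ be by rewrite -powRM ?(ltW b0) // divfK ?gt_eqF.
  apply: le_trans (ler_wpM2l (ltW L0) H); rewrite Ex Ey /Lam.
  by rewrite le_eqVlt; apply/orP; left; apply/eqP; ring.
(* AM-GM with weights [al] and [1 - al] between [x] and [As] is the tangent line of the concave
   function [x^al] at [As]. *)
- move=> x x0; have H := amgm al0 al1 x0 (ltW As0); rewrite EAs in H.
  have -> : K * (x `^ al * b `^ be) / q = (x `^ al * (2 * c * al)) / (2 * al).
    by rewrite /c; field; rewrite !gt_eqF.
  have : x `^ al * (2 * c * al) / (2 * al) <= (al * x + (1 - al) * As) / (2 * al).
    by rewrite ler_pM2r // invr_gt0 mulr_gt0.
  have -> : (al * x + (1 - al) * As) / (2 * al) = x / 2 + As / (2 * al) - As / 2.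
    by field; rewrite gt_eqF.
  have -> : Lam / q = As / (2 * al) by rewrite EL; field; rewrite !gt_eqF.
  lra.
Qed.

(** * The inequality, the energy and its first variation on [X] *)

Section Variational.
Variable R : realType.
Variable q : R.
Hypothesis q2 : 2 < q.
Hypothesis q103 : q < 10 / 3.
Let q0 : 0 < q. Proof. exact: lt_trans q2. Qed.
Notation al := (al q).
Notation be := (be q).
Implicit Types (u v phi : R * R -> R).

Lemma normpow2_cvg (x y : nat -> R) (a b K : R) :
  x n @[n --> \oo] --> a -> y n @[n --> \oo] --> b ->
  K * (`|x n| `^ al * `|y n| `^ be) @[n --> \oo] --> K * (`|a| `^ al * `|b| `^ be).
Proof.
move=> hx hy; have [al0 _ be0 _ _] := gn_exponents q2 q103.
apply: (@cvgM R); first exact: cvg_cst.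
apply: (@cvgM R).
  by apply: (@cvg_comp _ _ _ x (fun t => `|t| `^ al)) hx _; exact: normpow_continuous.
by apply: (@cvg_comp _ _ _ y (fun t => `|t| `^ be)) hy _; exact: normpow_continuous.
Qed.

Lemma Phi_xrep u g w : xrep u g w -> Phi q u = Phi q w.
Proof. by move=> X; apply: int2_ae; apply: ae2S (xr_ae X) => z ->. Qed.

Section Bound.
Variable K : R.
Hypothesis GN : forall g : fnt R, test g -> Phi q (Dx g) <= K * (fa g g `^ al * fb g g `^ be).

Lemma GN_X u g w : xrep u g w -> intg2 (fun z => `|w z| `^ q) /\
  Phi q u <= K * (ip0 u u `^ al * int2 (fun z => u z ^+ 2) `^ be).
Proof.
move=> X; rewrite (Phi_xrep X).
have uX := xrep_inX X; have B0 : 0 <= int2 (fun z => u z ^+ 2) by apply: int2_ge0 => z; exact: sqr_ge0.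
have H := @xrep_Phi R q (fun x y => K * (`|x| `^ al * `|y| `^ be)) u g w q2 X.
rewrite /= (ger0_norm (ip0_ge0 uX)) (ger0_norm B0) in H; apply: H.
  move=> x tx; rewrite !ger0_norm ?(ps_ge0 (fa_ps R) tx) ?(ps_ge0 (fb_ps R) tx) //; exact: GN.
have := normpow2_cvg (K := K) (xrep_ip0 X X) (xrep_int2 X X).
by rewrite (ger0_norm (ip0_ge0 uX)) (ger0_norm B0).
Qed.

Lemma J_X u : inX u -> J q u = ip0 u u / 2 - Phi q u / q.
Proof.
move=> /inX_xrep[g [w X]]; rewrite /J (Phi_xrep X); congr (_ - _).
rewrite [_ / q]mulrC -(int2Z _ (GN_X X).1); apply: int2_ae.
by apply: ae2S (xr_ae X) => z ->; rewrite FqE.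
Qed.

(** Differentiation under the integral for [|t| < 1], on measurable representatives. The dominating
    function comes from [normpow_add] with weight 1, and is integrable because [GN_X] puts [w] and
    [w'] in L^q. *)
Lemma Phi_derive u phi : inX u -> inX phi ->
  is_derive (0 : R) (1:R) (fun t : R => Phi q (u \+ t *: phi))
    (q * int2 (fun z => fq q (u z) * phi z)).
Proof.
move=> /inX_xrep[g [w X]] /inX_xrep[h [w' X']].
have [iw _] := GN_X X; have [iw' _] := GN_X X'.
have mw := xr_meas X; have mw' := xr_meas X'.
pose f (t : R) z := `|w z + t * w' z| `^ q.
have D (t : R) z : is_derive t (1:R) (f ^~ z) (q * fq q (w z + t * w' z) * w' z).
  have d : is_derive t (1:R) (fun t => w z + t * w' z) (w' z).
    rewrite (_ : (fun t => _) = (fun t => w' z * t + w z)); first exact: is_derive_affine.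
    by apply/funext => s; rewrite addrC mulrC.
  apply: (is_derive_eq (@is_derive1_comp R (fun x => `|x| `^ q) _ t _ _ (is_derive_normpow q2 _) d)).
  by rewrite /GRing.scale /= mulrC.
have p1 t z : partial1of2 f t z = q * fq q (w z + t * w' z) * w' z.
  by rewrite partial1of2E; exact: (@derive_val _ _ _ _ _ _ _ (D t z)).
pose G z := q * (2 `^ q * `|w z| `^ q + 2 `^ q * `|w' z| `^ q).
have I0 : `](-1), 1[%classic (0 : R) by rewrite /= in_itv /=; apply/andP; split; lra.
have add (x y : R) : (`|x| + `|y|) `^ q <= 2 `^ q * `|x| `^ q + 2 `^ q * `|y| `^ q.
  have := normpow_add q2 `|x| `|y| ltr01; rewrite invr1 !normr_id.
  by rewrite (ger0_norm (addr_ge0 (normr_ge0 x) (normr_ge0 y))).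
have cpow := normpow_continuous q0.
have iG0 : intg2 (fun z => 2 `^ q * `|w z| `^ q + 2 `^ q * `|w' z| `^ q).
  by apply: intg2D; exact: intg2Z.
have if_ (t : R) : `](-1), 1[%classic t -> intg2 (f t).
  rewrite /= in_itv /= => /andP[t1 t2].
  apply: (intg2_le _ iG0).
    exact: (meas2_comp cpow (meas2D mw (meas2Z t mw'))).
  move=> z; rewrite (ger0_norm (powR_ge0 _ _ : 0 <= f t z)).
  apply: le_trans (add (w z) (w' z)).
  apply: powR_le; [exact: ltW|exact: normr_ge0|].
  apply: le_trans (ler_normD _ _) _; rewrite lerD2l normrM ler_piMl // ler_norml.
  by rewrite !ltW.
have df (t : R) z : `](-1), 1[%classic t -> [set: R * R] z -> derivable (f ^~ z) t 1.
  by move=> _ _; exact: (@ex_derive _ _ _ _ _ _ _ (D t z)).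
have G0 z : 0 <= G z by rewrite mulr_ge0 ?(ltW q0) // addr_ge0 // mulr_ge0 ?powR_ge0.
have iG : intg2 G by exact: intg2Z.
have Gub (t : R) z : `](-1), 1[%classic t -> [set: R * R] z -> `|partial1of2 f t z| <= G z.
  rewrite /= in_itv /= => /andP[t1 t2] _; rewrite p1 -mulrA normrM (gtr0_norm q0) /G ler_pM2l //.
  apply: le_trans (fq_bound q2 _ _ _) (add (w z) (w' z)).
  by rewrite ler_norml !ltW.
have D1 := @derivable_under_integral R _ _ (@lebesgue_measure R \x @lebesgue_measure R)%E f setT measurableT 0 (-1) 1 I0 if_ df G G0 iG Gub.
have E1 := @differentiation_under_integral R _ _ (@lebesgue_measure R \x @lebesgue_measure R)%E f setT measurableT 0 (-1) 1 I0 if_ df G G0 iG Gub.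
have -> : (fun t : R => Phi q (u \+ t *: phi)) = (fun t => \int[(@lebesgue_measure R \x @lebesgue_measure R)%E]_z f t z).
  apply/funext => t; rewrite -int2E; exact: (Phi_xrep (xrep_comb t X X')).
have EI : int2 (fun z => q * (fq q (w z) * w' z)) = q * int2 (fun z => fq q (u z) * phi z).
  have ifq : intg2 (fun z => fq q (w z) * w' z).
    apply: (intg2_le _ iG0).
      by apply: meas2M mw'; exact: meas2_comp (fq_continuous q2) mw.
    move=> z; apply: le_trans (add (w z) (w' z)); have := fq_bound q2 (w z) (w' z) (t := 0).
    by rewrite mul0r addr0 normr0 => /(_ ler01).
  rewrite (int2Z _ ifq); congr (_ * _); apply: int2_ae.
  by apply: (ae2S2 _ (xr_ae X) (xr_ae X')) => z -> ->.
apply: DeriveDef; first exact: D1.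
rewrite -derive1E -EI int2E; apply: etrans; first exact: E1.
by congr Rintegral; apply/funext => z; rewrite p1 mul0r addr0 mulrA.
Qed.

End Bound.
End Variational.

Lemma min_derive0 (R : realType) (D : R -> R) (l : R) :
  is_derive (0:R) (1:R) D l -> (forall t, D 0 <= D t) -> l = 0.
Proof.
move=> [dD <-] Dmin; set d := 'D_1 D 0.
have H : (fun h : R => h^-1 *: ((D \o shift 0) (h *: (1:R)) - D 0)) @ (0:R)^' --> d by exact: dD.
apply/eqP; apply: contraT => d0; have nd : 0 < `|d| by rewrite normr_gt0.
move/cvgrPdist_lt : H => /(_ _ nd) /nbhs_ballP[e /= e0 He].
have e2 : 0 < e / 2 by rewrite divr_gt0.
(* For a step [h] against the sign of [d], minimality gives the quotient the sign opposite to [d] or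
   0, whereas a quotient within [|d|] of [d] has the strict sign of [d]. *)
have contra (h : R) : `|h| = e / 2 -> h * d < 0 -> False.
  move=> hn hd; have h0 : h != 0 by rewrite -normr_gt0 hn.
  have := He h; rewrite /ball /= sub0r normrN hn => /(_ ltac:(lra) h0).
  rewrite /shift /= addr0 /GRing.scale /= mulr1.
  have := Dmin h; rewrite -subr_ge0; move: (D h - D 0) => x x0.
  have yd : h^-1 * x * d <= 0.
    rewrite (_ : _ * d = (x / h ^+ 2) * (h * d)); last by field.
    by apply: mulr_ge0_le0; [rewrite divr_ge0 // sqr_ge0|exact: ltW].
  move: (h^-1 * x) yd => y yd; rewrite ltNge => /negP; apply.
  rewrite -(ler_pM2r nd) -[leRHS]normrM -expr2 -normE2.
  by apply: le_trans (ler_norm _); rewrite mulrBl -expr2; lra.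
suff: False by [].
case: (ltgtP d 0) d0 => // dlt _.
  by apply: (contra (e / 2)); rewrite ?(gtr0_norm e2) // pmulr_rlt0.
by apply: (contra (- (e / 2))); rewrite ?normrN ?(gtr0_norm e2) // mulNr oppr_lt0 mulr_gt0.
Qed.

Lemma quad_pow_derive (R : realType) (Lam r n m : R) :
  is_derive (0:R) (1:R) (fun t : R => Lam * (1 + 2 * t * n + t ^+ 2 * m) `^ r) (Lam * (r * (2 * n))).
Proof.
have dq : is_derive (0:R) (1:R) (fun t : R => 1 + 2 * t * n + t ^+ 2 * m) (2 * n).
  have := is_deriveD (is_derive_affine (2 * n) 1 0)
    (is_derive_mul (is_derive_id (0:R) (1:R)) (is_derive_affine m 0 0)).
  rewrite (_ : _ + _ = (fun t : R => 1 + 2 * t * n + t ^+ 2 * m)); last first.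
    apply/funext => t; change (2 * n * t + 1 + t * (m * t + 0) = 1 + 2 * t * n + t ^+ 2 * m).
    by ring.
  by move=> H; apply: (is_derive_eq H); ring.
have q1 : 1 + 2 * 0 * n + 0 ^+ 2 * m = 1 by rewrite expr0n /=; ring.
have dp : is_derive (1 + 2 * 0 * n + 0 ^+ 2 * m) (1:R) (@powR R ^~ r) r.
  rewrite q1; have D : derivable (@powR R ^~ r) 1 1.
    by apply: derivable_powR; rewrite in_itv /= ltr01.
  apply: DeriveDef => //; rewrite -derive1E powR_derive1 ?powR1 ?mulr1 //.
  by rewrite in_itv /= ltr01.
have d := @is_derive1_comp R (@powR R ^~ r) (fun t : R => 1 + 2 * t * n + t ^+ 2 * m) 0 _ _ dp dq.
rewrite (_ : (fun t => _) = Lam *: ((@powR R ^~ r) \o (fun t : R => 1 + 2 * t * n + t ^+ 2 * m))) //.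
apply: (is_derive_eq (is_deriveZ Lam d)).
by rewrite /GRing.scale /=; ring.
Qed.

Lemma quad_derive (R : realType) (A n m : R) :
  is_derive (0:R) (1:R) (fun t : R => (A + 2 * t * n + t ^+ 2 * m) / 2) n.
Proof.
have := is_deriveD (is_derive_affine n (A / 2) 0)
  (is_derive_mul (is_derive_id (0:R) (1:R)) (is_derive_affine (m / 2) 0 0)).
rewrite (_ : _ + _ = (fun t : R => (A + 2 * t * n + t ^+ 2 * m) / 2)); last first.
  apply/funext => t.
  change (n * t + A / 2 + t * (m / 2 * t + 0) = (A + 2 * t * n + t ^+ 2 * m) / 2).
  by field.
by move=> H; apply: (is_derive_eq H); ring.
Qed.

Lemma lagrange (R : realType) (q Lam l1 l2 n k F : R) : 0 < q -> Lam * l1 = 1 ->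
  Lam * (q / 2 * (2 * (l1 * n + l2 * k))) - q * F = 0 -> n - (- (Lam * l2)) * k - F = 0.
Proof.
move=> q0 Ll H; apply: (mulfI (lt0r_neq0 q0)); rewrite mulr0 -H.
have -> : Lam * (q / 2 * (2 * (l1 * n + l2 * k))) = q * ((Lam * l1) * n + Lam * l2 * k).
  by field.
by rewrite Ll; ring.
Qed.

Theorem theorem1p1 (R : realType) (q : R) :
  2 < q -> q < 10 / 3 ->
  forall a : R, 0 < a ->
  exists (u : R * R -> R) (lambda : R),
    [/\ weak_solution q a lambda u, lambda < 0 & normalized_ground_state q a u].
Proof.
move=> q2 q103 a a0.
have q0 : 0 < q by exact: lt_trans q2.
have [al0 al1 be0 ab q4] := gn_exponents q2 q103.
have [K [K0 GN sharp]] := gagliardo_nirenberg q2 q103.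
have b0 : 0 < a ^+ 2 by rewrite exprn_gt0.
have [As [Lam [l1 [l2 [[As0 L0 l10 l20] l12 [Ll1 EL] amgmq Jmin]]]]] :=
  parameters q0 al0 al1 be0 ab K0 b0.
have sup_bound (g : fnt R) : test g -> Phi q (Dx g) <= Lam * (fN l1 l2 g g) `^ (q / 2).
  move=> tg; apply: le_trans (GN g tg) (amgmq _ _ _ _).
    exact (ps_ge0 (fa_ps R) tg).
  exact (ps_ge0 (fb_ps R) tg).
have P0 : 0 < As `^ al q * (a ^+ 2) `^ be q by rewrite mulr_gt0 ?powR_gt0.
have /choice[G GP] : forall n : nat, exists g : fnt R,
    [/\ test g, fa g g = As, fb g g = a ^+ 2 & Lam - n.+1%:R^-1 <= Phi q (Dx g)].
  (* [rescale] multiplies [Phi] by [As^al (a^2)^be], so the tolerance is divided by that factor in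
     advance. *)
  move=> n; have d0 : 0 < n.+1%:R^-1 / (As `^ al q * (a ^+ 2) `^ be q).
    by rewrite divr_gt0 // invr_gt0 ltr0n.
  have [g [tg fa1 fb1 gK]] := sharp _ d0.
  have [g' [tg' fa' fb' Phi']] := rescale q2 tg As0 b0.
  exists g'; split; first exact: tg'.
  - exact: etrans fa' (etrans (congr1 (fun x => As * x) fa1) (mulr1 As)).
  - exact: etrans fb' (etrans (congr1 (fun x => a ^+ 2 * x) fb1) (mulr1 _)).
  rewrite Phi' EL; apply: le_trans (ler_wpM2l (ltW P0) (ltW gK)).
  by rewrite mulrBr [X in _ <= _ - X]mulrC divfK ?gt_eqF // [K * _]mulrC.
have maxG : maximizing q Lam As (a ^+ 2) G.
  split; [by move=> n; have [] := GP n|by move=> n; have [] := GP n|by move=> n; have [] := GP n|].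
  move=> e e0; have [N _ HN] : \forall n \near \oo, n.+1%:R^-1 < e :> R.
    exact: near_infty_natSinv_lt (PosNum e0).
  exists N => n Nn; have [_ _ _ h] := GP n; apply: le_trans h.
  by have := HN n Nn; move: (_^-1) => x /= xe; rewrite lerD2l lerN2 ltW.
have [s [u [sP mu_ su cs [iu Phiu]]]] := attain q2 q4 l10 l20 L0 l12 sup_bound maxG.
have ts n : test (s n) by have [] := sP n.
have X : xrep u s u := XRep ts cs mu_ su (ae2T (fun z => erefl (u z))).
have uX : inX u := xrep_inX X.
have Au : ip0 u u = As.
  have H := xrep_ip0 X X; rewrite -(cvg_lim (@Rhausdorff R) H).
  rewrite (_ : (fun n => fa (s n) (s n)) = fun=> As) ?lim_cst //.
  by apply/funext => n; have [] := sP n.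
have Bu : int2 (fun z => u z ^+ 2) = a ^+ 2.
  have H := xrep_int2 X X; rewrite -(cvg_lim (@Rhausdorff R) H).
  rewrite (_ : (fun n => fb (s n) (s n)) = fun=> a ^+ 2) ?lim_cst //.
  by apply/funext => n; have [] := sP n.
have Su : S a u by split.
(* In the first variation of [Lam * N^(q/2)] at [u], where [N u = 1], the energy has coefficient
   [q Lam l1 = q] and the mass [q Lam l2]; the latter becomes the multiplier. *)
pose lambda := - (Lam * l2).
have weak phi : inX phi ->
    ip0 u phi - lambda * int2 (fun z => u z * phi z) - int2 (fun z => fq q (u z) * phi z) = 0.
  move=> pX; set n := ip0 u phi; set k := int2 (fun z => u z * phi z).
  set F := int2 _.
  (* The function [Lam * N^(q/2) - Phi] is nonnegative on [X] and vanishes at [u], so its derivative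
     along [u + t phi] is 0 for every [phi], tangent to the sphere or not. *)
  have dP := Phi_derive q2 q103 GN uX pX.
  pose m := l1 * ip0 phi phi + l2 * int2 (fun z => phi z ^+ 2).
  have dN := quad_pow_derive Lam (q / 2) (l1 * n + l2 * k) m.
  have dD := is_deriveB dN dP.
  have E t : l1 * ip0 (u \+ t *: phi) (u \+ t *: phi) + l2 * int2 (fun z => (u \+ t *: phi) z ^+ 2)
      = 1 + 2 * t * (l1 * n + l2 * k) + t ^+ 2 * m.
    rewrite (ip0_expand t uX pX) (int2_expand t uX pX) Au Bu -/n -/k -l12 /m; ring.
  have ge0 t : Phi q (u \+ t *: phi) <= Lam * (1 + 2 * t * (l1 * n + l2 * k) + t ^+ 2 * m) `^ (q / 2).
    have [h [w' X']] := inX_xrep pX; have Y := xrep_comb t X X'.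
    rewrite -E; apply: le_trans (GN_X q2 q103 GN Y).2 (amgmq _ _ _ _).
      exact: ip0_ge0 (xrep_inX Y).
    by apply: int2_ge0 => z; exact: sqr_ge0.
  have u0 : u \+ 0 *: phi = u.
    by apply/funext => z; change (u z + 0 * phi z = u z); rewrite mul0r addr0.
  have H : Lam * (q / 2 * (2 * (l1 * n + l2 * k))) - q * F = 0.
    apply: (min_derive0 dD) => t.
    change (Lam * (1 + 2 * 0 * (l1 * n + l2 * k) + 0 ^+ 2 * m) `^ (q / 2) - Phi q (u \+ 0 *: phi) <=
      Lam * (1 + 2 * t * (l1 * n + l2 * k) + t ^+ 2 * m) `^ (q / 2) - Phi q (u \+ t *: phi)).
    rewrite u0 Phiu expr0n mulr0 !mul0r !addr0 powR1 mulr1 subrr subr_ge0.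
    exact: ge0.
  exact: lagrange q0 Ll1 H.
have lam0 : lambda < 0 by rewrite oppr_lt0 mulr_gt0.
exists u, lambda; split; [exact: (conj Su weak)|exact: lam0|].
split; last first.
  (* Only membership of [v] in [S a] is used: [u] minimises [J] on the whole sphere, in particular
     among its critical points. *)
  move=> v [[vX Bv] _]; have [h [w X']] := inX_xrep vX.
  rewrite (J_X q2 q103 GN uX) (J_X q2 q103 GN vX) Au Phiu.
  apply: le_trans (Jmin _ (ip0_ge0 vX)) _.
  rewrite lerD2l lerN2 ler_pM2r ?invr_gt0 // -Bv.
  exact: (GN_X q2 q103 GN X').2.
split; [exact: Su|move=> phi pX orth].
have dP := Phi_derive q2 q103 GN uX pX.
have dA := quad_derive As (ip0 u phi) (ip0 phi phi).
have E : (fun t : R => J q (u \+ t *: phi)) =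
    (fun t => (As + 2 * t * ip0 u phi + t ^+ 2 * ip0 phi phi) / 2) - q^-1 *: (fun t : R => Phi q (u \+ t *: phi)).
  apply/funext => t; have [h [w' X']] := inX_xrep pX.
  rewrite (J_X q2 q103 GN (xrep_inX (xrep_comb t X X'))) (ip0_expand t uX pX) Au.
  by rewrite [_ / q]mulrC.
have dJ := is_deriveB dA (is_deriveZ q^-1 dP); rewrite -E in dJ.
have [dJ1 dJ2] := dJ; split; first exact: dJ1.
(* The derivative of [J] along [phi] is the weak equation without its multiplier term, and that term
   vanishes since [phi] is orthogonal to [u]. *)
rewrite dJ2 /GRing.scale /= mulKf ?gt_eqF //.
by have := weak phi pX; rewrite orth mulr0 subr0.
Qed.
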